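(* Consider the equation $$y^{(4)}+\frac{1}{y'+r}\big(-10y''+F_2y'^2+F_1y'+F_0\big)y'''+\frac{1}{(y'+r)^2}\Big[15y''^3+(H_2y'^2+H_1y'+H_0)y''^2+(J_4y'^4+J_3y'^3+J_2y'^2+J_1y'+J_0)y''+K_7y'^7+K_6y'^6+K_5y'^5+K_4y'^4+K_3y'^3+K_2y'^2+K_1y'+K_0\Big]=0,$$ where $r,F_i,H_i,J_i,K_i$ are functions of $(x,y)$. This equation is linearizable by a point transformation if and only if its coefficients satisfy the following eighteen equations: (1) $10r_{yy}=-(F_{1y}-F_{2x}-F_{2y}r-r_yF_2)$; (2) $10r_x=10r_yr-F_0+F_1r-F_2r^2$; (3) $H_2=-3F_2$; (4) $4H_1=-3(5F_1-2F_2r)$; (5) $4H_0=-3(6F_0-F_1r)$; (6) $10F_{1yy}=-(F_{1y}F_2-40F_{2xy}-16F_{2x}F_2+20F_{2yy}r+40F_{2y}r_y+14F_{2y}F_2r+20J_{4x}-20J_{4y}r+14r_yF_2^2-40r_yJ_4)$; (7) $12F_{2x}=12F_{2y}r-3F_1F_2+6F_2^2r+4J_3-16J_4r$; (8) $60F_{1x}=60F_{1y}r-36F_0F_2-15F_1^2+66F_1F_2r-36F_2^2r^2+40J_2-80J_3r+80J_4r^2$; (9) $60F_{0x}=60F_{0y}r-51F_0F_1+66F_0F_2r+36F_1^2r-72F_1F_2r^2+36F_2^2r^3+60J_1-80J_2r+80J_3r^2-80J_4r^3$; (10) $20J_0=9F_0^2-18F_0F_1r+18F_0F_2r^2+9F_1^2r^2-18F_1F_2r^3+9F_2^2r^4+20J_1r-20J_2r^2+20J_3r^3-20J_4r^4$;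 (11) $120J_{3yy}=216F_{1y}F_{2y}+54F_{1y}F_2^2-48F_{1y}J_4+360F_{2yy}r_y+90F_{2yy}F_1-180F_{2yy}F_2r-432F_{2y}^2r+324F_{2y}r_yF_2+189F_{2y}F_1F_2-486F_{2y}F_2^2r-192F_{2y}J_3+864F_{2y}J_4r-60J_{3y}F_2+720J_{4xy}+180J_{4x}F_2-240J_{4yy}r-1200J_{4y}r_y+60J_{4y}F_2r+720K_{6x}-720K_{6y}r-5040K_{7x}r+5040K_{7y}r^2+36r_yF_2^3-432r_yF_2J_4-2160r_yK_6+15120r_yK_7r+504F_0K_7+36F_1F_2^3-102F_1F_2J_4-504F_1K_7r-72F_2^4r-48F_2^2J_3+396F_2^2J_4r+504F_2K_7r^2+136J_3J_4-544J_4^2r$; (12) $240J_{4xyy}=-(36F_{1y}F_{2yy}+162F_{1y}F_{2y}F_2-72F_{1y}J_{4y}+36F_{1y}F_2^3-168F_{1y}F_2J_4-72F_{1y}K_6-168F_{1y}K_7r-72F_{2yy}F_{2y}r+144F_{2yy}r_yF_2+54F_{2yy}F_1F_2-108F_{2yy}F_2^2r-72F_{2yy}J_3+288F_{2yy}J_4r+432F_{2y}^2r_y+108F_{2y}^2F_1-540F_{2y}^2F_2r-144F_{2y}J_{3y}+528F_{2y}J_{4x}+192F_{2y}J_{4y}r+324F_{2y}r_yF_2^2-1008F_{2y}r_yJ_4+162F_{2y}F_1F_2^2-132F_{2y}F_1J_4-396F_{2y}F_2^3r-180F_{2y}F_2J_3+1320F_{2y}F_2J_4r+144F_{2y}K_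6r-336F_{2y}K_7r^2-36J_{3y}F_2^2+176J_{3y}J_4+120J_{4xy}F_2+132J_{4x}F_2^2-432J_{4x}J_4-240J_{4yyy}r-960J_{4yy}r_y-120J_{4yy}F_2r-768J_{4y}r_yF_2-138J_{4y}F_1F_2+288J_{4y}F_2^2r+184J_{4y}J_3-1008J_{4y}J_4r+960K_{6xy}+240K_{6x}F_2-960K_{6yy}r-3840K_{6y}r_y-240K_{6y}F_2r-1920K_{7xy}r-2400K_{7xx}+2880K_{7x}r_y-600K_{7x}F_1-480K_{7x}F_2r+4320K_{7yy}r^2+24000K_{7y}r_yr+432K_{7y}F_0+168K_{7y}F_1r+912K_{7y}F_2r^2+20160r_y^2K_7+1728r_yF_1K_7+36r_yF_2^4-264r_yF_2^2J_4-1248r_yF_2K_6+5280r_yF_2K_7r+160r_yJ_4^2+408F_0F_2K_7+150F_1^2K_7+27F_1F_2^4-120F_1F_2^2J_4-168F_1F_2K_6+168F_1F_2K_7r-54F_2^5r-36F_2^3J_3+384F_2^3J_4r+336F_2^2K_6r-1344F_2^2K_7r^2+160F_2J_3J_4-640F_2J_4^2r-400J_2K_7+224J_3K_6-368J_3K_7r-896J_4K_6r+3872J_4K_7r^2+672F_{0y}K_7)$; (13) $4J_{4x}=4J_{4y}r-F_1J_4+2F_2J_4r-4K_5+24K_6r-84K_7r^2$; (14) $60F_{0yy}=-(30F_{0y}F_2+36F_{1y}F_1-36F_{1y}F_2r-60F_{2yy}r^2+24F_{2y}F_0-36F_{2y}F_1r-54F_{2y}F_2r^2-40J_{2y}+40J_{3y}r+80J_{4y}r^2-36r_yF_1F_2+36r_yF_2^2r+40r_yJ_3-80r_yJ_4r+6F_0F_2^2-6F_0J_4+9F_1^2F_2-18F_1F_2^2r-12F_1J_3+24F_1J_4r-6F_2^3r^2-10F_2J_2+22F_2J_3r+26F_2J_4r^2-60K_4+180K_5r-180K_6r^2-420K_7r^3)$;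 (15) $20J_{2x}=20J_{2y}r+20J_{3x}r-20J_{3y}r^2-14F_0J_3+28F_0J_4r-5F_1J_2+19F_1J_3r-28F_1J_4r^2+10F_2J_2r-24F_2J_3r^2+28F_2J_4r^3-120K_3+360K_4r-640K_5r^2+840K_6r^3-840K_7r^4$; (16) $60J_{1x}=60J_{1y}r-40J_{3x}r^2+40J_{3y}r^3-42F_0J_2+42F_0J_3r-70F_0J_4r^2-15F_1J_1+42F_1J_2r-52F_1J_3r^2+70F_1J_4r^3+30F_2J_1r-42F_2J_2r^2+62F_2J_3r^3-70F_2J_4r^4-600K_2+1080K_3r-1380K_4r^2+1700K_5r^3-2100K_6r^4+2100K_7r^5$; (17) $80K_1=3F_0^2F_1-6F_0^2F_2r-6F_0F_1^2r+18F_0F_1F_2r^2-12F_0F_2^2r^3-8F_0J_1+16F_0J_2r-24F_0J_3r^2+32F_0J_4r^3+3F_1^3r^2-12F_1^2F_2r^3+15F_1F_2^2r^4+8F_1J_1r-16F_1J_2r^2+24F_1J_3r^3-32F_1J_4r^4-6F_2^3r^5-8F_2J_1r^2+16F_2J_2r^3-24F_2J_3r^4+32F_2J_4r^5+160K_2r-240K_3r^2+320K_4r^3-400K_5r^4+480K_6r^5-560K_7r^6$; (18) $400K_0=-(6F_0^3-33F_0^2F_1r+48F_0^2F_2r^2+48F_0F_1^2r^2-126F_0F_1F_2r^3+78F_0F_2^2r^4+40F_0J_1r-80F_0J_2r^2+120F_0J_3r^3-160F_0J_4r^4-21F_1^3r^3+78F_1^2F_2r^4-93F_1F_2^2r^5-40F_1J_1r^2+80F_1J_2r^3-120F_1J_3r^4+160F_1J_4r^5+36F_2^3r^6+40F_2J_1r^3-80F_2J_2r^4+120F_2J_3r^5-160F_2J_4r^6-400K_2r^2+800K_3r^3-1200K_4r^4+1600K_5r^5-2000K_6r^6+2400K_7r^7)$.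 Suppose these conditions hold. Then the point transformation $t=\varphi(x,y)$, $u=\psi(x,y)$ mapping the equation to a linear equation $u^{(4)}+\alpha u'+\beta u=0$ is obtained by solving the following compatible system for $\varphi$ and $\psi$: $$\varphi_x=r\varphi_y,\qquad \varphi_y\psi_x=r\varphi_y\psi_y-\Delta,\qquad 10\Delta\varphi_{yy}=\varphi_y(4\Delta_y-F_2\Delta),$$ $$\begin{aligned} 500\varphi_y\psi_{yyyy}\Delta^3={}&300\psi_{yyy}\varphi_y\Delta^2(4\Delta_y-F_2\Delta)\\ &+5\psi_{yy}\varphi_y\Delta(-120F_{2y}\Delta^2-144\Delta_y^2+72\Delta_yF_2\Delta-39F_2^2\Delta^2+80J_4\Delta^2)\\ &+\psi_y\varphi_y(-500\varphi_y^3\alpha\Delta^3-150F_{2yy}\Delta^3+360F_{2y}\Delta_y\Delta^2-165F_{2y}F_2\Delta^3+100J_{4y}\Delta^3\\ &\qquad+96\Delta_y^3-72\Delta_y^2F_2\Delta+108\Delta_yF_2^2\Delta^2-240\Delta_yJ_4\Delta^2-24F_2^3\Delta^3+60F_2J_4\Delta^3)\\ &-500\psi\varphi_y^5\beta\Delta^3+500K_7\Delta^4. \end{aligned}$$ The coefficients $\alpha,\beta$ of the resulting linear equation, expressed in terms of $(x,y)$, are $$\alpha=\frac{\Theta}{8\varphi_y^3},$$ $$\begin{aligned} \beta=(1600\Delta\varphi_y^4)^{-1}\Big[&\Delta\big(-144F_{2y}^2-72F_{2y}F_2^2+352F_{2y}J_4+160J_{4yy}+80J_{4y}F_2+640K_{6y}-1600K_{7x}-2880K_{7y}r+80\Theta_y\\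 &\quad-4480r_yK_7-400F_1K_7-9F_2^4+88F_2^2J_4+160F_2K_6-320F_2K_7r-144J_4^2\big)-120\Delta_y\Theta\Big], \end{aligned}$$ where $$\Theta=(F_2^2-4J_4)F_2-8(K_6-7K_7r)-8J_{4y}+6F_{2y}F_2+4F_{2yy}.$$
   Context: Here $y=y(x)$, and subscripts denote partial derivatives with respect to $x$ and $y$. ''Linearizable by a point transformation'' means that there is a change of variables $t=\varphi(x,y)$, $u=\psi(x,y)$ with nonzero Jacobian $\Delta=\varphi_x\psi_y-\varphi_y\psi_x$ that maps the equation to a linear fourth-order equation in Laguerre form $u^{(4)}+\alpha(t)u'+\beta(t)u=0$; here $u=u(t)$ and primes on $u$ denote $d/dt$. In the system for $\varphi$ and $\psi$, $\Delta$ denotes this Jacobian. The functions $\alpha$ and $\beta$ appearing there are the coefficients of the target linear equation, evaluated at $t=\varphi(x,y)$.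
   Formalization: The system is shown to hold for every linearizing transformation, and one exists locally; that every solution of the system linearizes is not claimed, being false: for r=F=H=J=K=0, φ=y, ψ=e^x solves it but does not linearize. Coefficients and transformations are smooth. *)

(* Defs.v *)
From Stdlib Require Import Reals List.
From Coquelicot Require Import Coquelicot.
Open Scope R_scope.

Definition dX (f : R -> R -> R) : R -> R -> R :=
  fun x y => Derive (fun t => f t y) x.
Definition dY (f : R -> R -> R) : R -> R -> R :=
  fun x y => Derive (fun t => f x t) y.

Definition pd (d : bool) (f : R -> R -> R) : R -> R -> R :=
  if d then dX f else dY f.
Definition iter_pd (l : list bool) (f : R -> R -> R) : R -> R -> R :=
  fold_right pd f l.

Definition open2 (U : R -> R -> Prop) : Prop :=
  open (fun p : R * R => U (fst p) (snd p)).

Definition smooth_on (U : R -> R -> Prop) (f : R -> R -> R) : Prop :=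
  forall (l : list bool) (x y : R), U x y ->
    ex_derive (fun t => iter_pd l f t y) x /\
    ex_derive (fun t => iter_pd l f x t) y /\
    continuous (fun p : R * R => iter_pd l f (fst p) (snd p)) (x, y).

Definition Jac (phi psi : R -> R -> R) : R -> R -> R :=
  fun x y => dX phi x y * dY psi x y - dY phi x y * dX psi x y.

Record coefs := Coefs {
  cr : R -> R -> R;
  cF0 : R -> R -> R; cF1 : R -> R -> R; cF2 : R -> R -> R;
  cH0 : R -> R -> R; cH1 : R -> R -> R; cH2 : R -> R -> R;
  cJ0 : R -> R -> R; cJ1 : R -> R -> R; cJ2 : R -> R -> R;
  cJ3 : R -> R -> R; cJ4 : R -> R -> R;
  cK0 : R -> R -> R; cK1 : R -> R -> R; cK2 : R -> R -> R; cK3 : R -> R -> R;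
  cK4 : R -> R -> R; cK5 : R -> R -> R; cK6 : R -> R -> R; cK7 : R -> R -> R
}.

Definition coefs_smooth_on (U : R -> R -> Prop) (c : coefs) : Prop :=
  smooth_on U (cr c) /\
  smooth_on U (cF0 c) /\ smooth_on U (cF1 c) /\ smooth_on U (cF2 c) /\
  smooth_on U (cH0 c) /\ smooth_on U (cH1 c) /\ smooth_on U (cH2 c) /\
  smooth_on U (cJ0 c) /\ smooth_on U (cJ1 c) /\ smooth_on U (cJ2 c) /\
  smooth_on U (cJ3 c) /\ smooth_on U (cJ4 c) /\
  smooth_on U (cK0 c) /\ smooth_on U (cK1 c) /\ smooth_on U (cK2 c) /\
  smooth_on U (cK3 c) /\ smooth_on U (cK4 c) /\ smooth_on U (cK5 c) /\
  smooth_on U (cK6 c) /\ smooth_on U (cK7 c).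

(** Left-hand side of the equation, evaluated on the jet
    (x, y, p = y', q = y'', s = y''', w = y''''). *)
Definition ode_expr (c : coefs) (x y p q s w : R) : R :=
  let r := cr c x y in
  let F0 := cF0 c x y in let F1 := cF1 c x y in let F2 := cF2 c x y in
  let H0 := cH0 c x y in let H1 := cH1 c x y in let H2 := cH2 c x y in
  let J0 := cJ0 c x y in let J1 := cJ1 c x y in let J2 := cJ2 c x y in
  let J3 := cJ3 c x y in let J4 := cJ4 c x y in
  let K0 := cK0 c x y in let K1 := cK1 c x y in let K2 := cK2 c x y in
  let K3 := cK3 c x y in let K4 := cK4 c x y in let K5 := cK5 c x y in
  let K6 := cK6 c x y in let K7 := cK7 c x y in
  w + / (p + r) * (-10 * q + F2 * p ^ 2 + F1 * p + F0) * s
    + / ((p + r) ^ 2) *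
      (15 * q ^ 3 + (H2 * p ^ 2 + H1 * p + H0) * q ^ 2
       + (J4 * p ^ 4 + J3 * p ^ 3 + J2 * p ^ 2 + J1 * p + J0) * q
       + K7 * p ^ 7 + K6 * p ^ 6 + K5 * p ^ 5 + K4 * p ^ 4 + K3 * p ^ 3
       + K2 * p ^ 2 + K1 * p + K0).

Definition curve_smooth_near (y : R -> R) (x0 : R) : Prop :=
  exists eps : R, 0 < eps /\
    forall (k : nat) (x : R), Rabs (x - x0) < eps -> ex_derive (Derive_n y k) x.

(** Along the curve y = y(x), t(x) = phi(x,y(x)), u(x) = psi(x,y(x)), and
    u', u'', u''', u'''' (derivatives with respect to t) are computed by
    d/dt = (1/t_x) d/dx. [lin_expr] is u'''' + alpha(t) u' + beta(t) u at x0. *)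
Definition lin_expr (phi psi : R -> R -> R) (alpha beta : R -> R)
    (y : R -> R) (x0 : R) : R :=
  let T := fun x => phi x (y x) in
  let Uc := fun x => psi x (y x) in
  let u1 := fun x => Derive Uc x / Derive T x in
  let u2 := fun x => Derive u1 x / Derive T x in
  let u3 := fun x => Derive u2 x / Derive T x in
  let u4 := Derive u3 x0 / Derive T x0 in
  u4 + alpha (T x0) * u1 x0 + beta (T x0) * Uc x0.

(** (phi, psi) with nonzero Jacobian on the open set V maps the equation to
    u'''' + alpha(t) u' + beta(t) u = 0: for every smooth curve y through V,
    at every point where both equations make sense (y' + r <> 0 and
    dt/dx <> 0), y solves the original equation iff u(t) solves the linear
    one. *)
Definition linearizes (c : coefs) (V : R -> R -> Prop)
    (phi psi : R -> R -> R) (alpha beta : R -> R) : Prop :=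
  smooth_on V phi /\ smooth_on V psi /\
  (forall x y, V x y -> Jac phi psi x y <> 0) /\
  forall (y : R -> R) (x0 : R),
    V x0 (y x0) -> curve_smooth_near y x0 ->
    Derive_n y 1 x0 + cr c x0 (y x0) <> 0 ->
    Derive (fun x => phi x (y x)) x0 <> 0 ->
    (ode_expr c x0 (y x0) (Derive_n y 1 x0) (Derive_n y 2 x0)
        (Derive_n y 3 x0) (Derive_n y 4 x0) = 0
     <-> lin_expr phi psi alpha beta y x0 = 0).

Definition locally_linearizable (c : coefs) (U : R -> R -> Prop) : Prop :=
  forall x0 y0, U x0 y0 ->
    exists V : R -> R -> Prop,
      open2 V /\ V x0 y0 /\ (forall x y, V x y -> U x y) /\
      exists (phi psi : R -> R -> R) (alpha beta : R -> R),
        linearizes c V phi psi alpha beta.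

Definition conditions (c : coefs) (x y : R) : Prop :=
  let r := cr c x y in
  let rx := dX (cr c) x y in let ry := dY (cr c) x y in
  let ryy := dY (dY (cr c)) x y in
  let F0 := cF0 c x y in let F0x := dX (cF0 c) x y in
  let F0y := dY (cF0 c) x y in let F0yy := dY (dY (cF0 c)) x y in
  let F1 := cF1 c x y in let F1x := dX (cF1 c) x y in
  let F1y := dY (cF1 c) x y in let F1yy := dY (dY (cF1 c)) x y in
  let F2 := cF2 c x y in let F2x := dX (cF2 c) x y in
  let F2y := dY (cF2 c) x y in let F2xy := dX (dY (cF2 c)) x y in
  let F2yy := dY (dY (cF2 c)) x y in
  let H0 := cH0 c x y in let H1 := cH1 c x y in let H2 := cH2 c x y in
  let J0 := cJ0 c x y in
  let J1 := cJ1 c x y in let J1x := dX (cJ1 c) x y in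
  let J1y := dY (cJ1 c) x y in
  let J2 := cJ2 c x y in let J2x := dX (cJ2 c) x y in
  let J2y := dY (cJ2 c) x y in
  let J3 := cJ3 c x y in let J3x := dX (cJ3 c) x y in
  let J3y := dY (cJ3 c) x y in let J3yy := dY (dY (cJ3 c)) x y in
  let J4 := cJ4 c x y in let J4x := dX (cJ4 c) x y in
  let J4y := dY (cJ4 c) x y in let J4xy := dX (dY (cJ4 c)) x y in
  let J4yy := dY (dY (cJ4 c)) x y in
  let J4xyy := dX (dY (dY (cJ4 c))) x y in
  let J4yyy := dY (dY (dY (cJ4 c))) x y in
  let K0 := cK0 c x y in let K1 := cK1 c x y in let K2 := cK2 c x y in
  let K3 := cK3 c x y in let K4 := cK4 c x y in let K5 := cK5 c x y in
  let K6 := cK6 c x y in let K6x := dX (cK6 c) x y in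
  let K6y := dY (cK6 c) x y in let K6xy := dX (dY (cK6 c)) x y in
  let K6yy := dY (dY (cK6 c)) x y in
  let K7 := cK7 c x y in let K7x := dX (cK7 c) x y in
  let K7y := dY (cK7 c) x y in let K7xy := dX (dY (cK7 c)) x y in
  let K7xx := dX (dX (cK7 c)) x y in let K7yy := dY (dY (cK7 c)) x y in
  10 * ryy = - (F1y - F2x - F2y * r - ry * F2) /\
  10 * rx = 10 * ry * r - F0 + F1 * r - F2 * r ^ 2 /\
  H2 = - (3 * F2) /\
  4 * H1 = - (3 * (5 * F1 - 2 * F2 * r)) /\
  4 * H0 = - (3 * (6 * F0 - F1 * r)) /\
  10 * F1yy = - (F1y * F2 - 40 * F2xy - 16 * F2x * F2 + 20 * F2yy * r
     + 40 * F2y * ry + 14 * F2y * F2 * r + 20 * J4x - 20 * J4y * r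
     + 14 * ry * F2 ^ 2 - 40 * ry * J4) /\
  12 * F2x = 12 * F2y * r - 3 * F1 * F2 + 6 * F2 ^ 2 * r + 4 * J3
     - 16 * J4 * r /\
  60 * F1x = 60 * F1y * r - 36 * F0 * F2 - 15 * F1 ^ 2 + 66 * F1 * F2 * r
     - 36 * F2 ^ 2 * r ^ 2 + 40 * J2 - 80 * J3 * r + 80 * J4 * r ^ 2 /\
  60 * F0x = 60 * F0y * r - 51 * F0 * F1 + 66 * F0 * F2 * r
     + 36 * F1 ^ 2 * r - 72 * F1 * F2 * r ^ 2 + 36 * F2 ^ 2 * r ^ 3
     + 60 * J1 - 80 * J2 * r + 80 * J3 * r ^ 2 - 80 * J4 * r ^ 3 /\
  20 * J0 = 9 * F0 ^ 2 - 18 * F0 * F1 * r + 18 * F0 * F2 * r ^ 2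
     + 9 * F1 ^ 2 * r ^ 2 - 18 * F1 * F2 * r ^ 3 + 9 * F2 ^ 2 * r ^ 4
     + 20 * J1 * r - 20 * J2 * r ^ 2 + 20 * J3 * r ^ 3 - 20 * J4 * r ^ 4 /\
  120 * J3yy = 216 * F1y * F2y + 54 * F1y * F2 ^ 2 - 48 * F1y * J4
     + 360 * F2yy * ry + 90 * F2yy * F1 - 180 * F2yy * F2 * r
     - 432 * F2y ^ 2 * r + 324 * F2y * ry * F2 + 189 * F2y * F1 * F2
     - 486 * F2y * F2 ^ 2 * r - 192 * F2y * J3 + 864 * F2y * J4 * r
     - 60 * J3y * F2 + 720 * J4xy + 180 * J4x * F2 - 240 * J4yy * r
     - 1200 * J4y * ry + 60 * J4y * F2 * r + 720 * K6x - 720 * K6y * r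
     - 5040 * K7x * r + 5040 * K7y * r ^ 2 + 36 * ry * F2 ^ 3
     - 432 * ry * F2 * J4 - 2160 * ry * K6 + 15120 * ry * K7 * r
     + 504 * F0 * K7 + 36 * F1 * F2 ^ 3 - 102 * F1 * F2 * J4
     - 504 * F1 * K7 * r - 72 * F2 ^ 4 * r - 48 * F2 ^ 2 * J3
     + 396 * F2 ^ 2 * J4 * r + 504 * F2 * K7 * r ^ 2 + 136 * J3 * J4
     - 544 * J4 ^ 2 * r /\
  240 * J4xyy = - (36 * F1y * F2yy + 162 * F1y * F2y * F2 - 72 * F1y * J4y
     + 36 * F1y * F2 ^ 3 - 168 * F1y * F2 * J4 - 72 * F1y * K6
     - 168 * F1y * K7 * r - 72 * F2yy * F2y * r + 144 * F2yy * ry * F2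
     + 54 * F2yy * F1 * F2 - 108 * F2yy * F2 ^ 2 * r - 72 * F2yy * J3
     + 288 * F2yy * J4 * r + 432 * F2y ^ 2 * ry + 108 * F2y ^ 2 * F1
     - 540 * F2y ^ 2 * F2 * r - 144 * F2y * J3y + 528 * F2y * J4x
     + 192 * F2y * J4y * r + 324 * F2y * ry * F2 ^ 2 - 1008 * F2y * ry * J4
     + 162 * F2y * F1 * F2 ^ 2 - 132 * F2y * F1 * J4 - 396 * F2y * F2 ^ 3 * r
     - 180 * F2y * F2 * J3 + 1320 * F2y * F2 * J4 * r + 144 * F2y * K6 * r
     - 336 * F2y * K7 * r ^ 2 - 36 * J3y * F2 ^ 2 + 176 * J3y * J4
     + 120 * J4xy * F2 + 132 * J4x * F2 ^ 2 - 432 * J4x * J4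
     - 240 * J4yyy * r - 960 * J4yy * ry - 120 * J4yy * F2 * r
     - 768 * J4y * ry * F2 - 138 * J4y * F1 * F2 + 288 * J4y * F2 ^ 2 * r
     + 184 * J4y * J3 - 1008 * J4y * J4 * r + 960 * K6xy + 240 * K6x * F2
     - 960 * K6yy * r - 3840 * K6y * ry - 240 * K6y * F2 * r
     - 1920 * K7xy * r - 2400 * K7xx + 2880 * K7x * ry - 600 * K7x * F1
     - 480 * K7x * F2 * r + 4320 * K7yy * r ^ 2 + 24000 * K7y * ry * r
     + 432 * K7y * F0 + 168 * K7y * F1 * r + 912 * K7y * F2 * r ^ 2
     + 20160 * ry ^ 2 * K7 + 1728 * ry * F1 * K7 + 36 * ry * F2 ^ 4
     - 264 * ry * F2 ^ 2 * J4 - 1248 * ry * F2 * K6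
     + 5280 * ry * F2 * K7 * r + 160 * ry * J4 ^ 2 + 408 * F0 * F2 * K7
     + 150 * F1 ^ 2 * K7 + 27 * F1 * F2 ^ 4 - 120 * F1 * F2 ^ 2 * J4
     - 168 * F1 * F2 * K6 + 168 * F1 * F2 * K7 * r - 54 * F2 ^ 5 * r
     - 36 * F2 ^ 3 * J3 + 384 * F2 ^ 3 * J4 * r + 336 * F2 ^ 2 * K6 * r
     - 1344 * F2 ^ 2 * K7 * r ^ 2 + 160 * F2 * J3 * J4
     - 640 * F2 * J4 ^ 2 * r - 400 * J2 * K7 + 224 * J3 * K6
     - 368 * J3 * K7 * r - 896 * J4 * K6 * r + 3872 * J4 * K7 * r ^ 2
     + 672 * F0y * K7) /\
  4 * J4x = 4 * J4y * r - F1 * J4 + 2 * F2 * J4 * r - 4 * K5 + 24 * K6 * r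
     - 84 * K7 * r ^ 2 /\
  60 * F0yy = - (30 * F0y * F2 + 36 * F1y * F1 - 36 * F1y * F2 * r
     - 60 * F2yy * r ^ 2 + 24 * F2y * F0 - 36 * F2y * F1 * r
     - 54 * F2y * F2 * r ^ 2 - 40 * J2y + 40 * J3y * r + 80 * J4y * r ^ 2
     - 36 * ry * F1 * F2 + 36 * ry * F2 ^ 2 * r + 40 * ry * J3
     - 80 * ry * J4 * r + 6 * F0 * F2 ^ 2 - 6 * F0 * J4 + 9 * F1 ^ 2 * F2
     - 18 * F1 * F2 ^ 2 * r - 12 * F1 * J3 + 24 * F1 * J4 * r
     - 6 * F2 ^ 3 * r ^ 2 - 10 * F2 * J2 + 22 * F2 * J3 * r
     + 26 * F2 * J4 * r ^ 2 - 60 * K4 + 180 * K5 * r - 180 * K6 * r ^ 2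
     - 420 * K7 * r ^ 3) /\
  20 * J2x = 20 * J2y * r + 20 * J3x * r - 20 * J3y * r ^ 2 - 14 * F0 * J3
     + 28 * F0 * J4 * r - 5 * F1 * J2 + 19 * F1 * J3 * r
     - 28 * F1 * J4 * r ^ 2 + 10 * F2 * J2 * r - 24 * F2 * J3 * r ^ 2
     + 28 * F2 * J4 * r ^ 3 - 120 * K3 + 360 * K4 * r - 640 * K5 * r ^ 2
     + 840 * K6 * r ^ 3 - 840 * K7 * r ^ 4 /\
  60 * J1x = 60 * J1y * r - 40 * J3x * r ^ 2 + 40 * J3y * r ^ 3
     - 42 * F0 * J2 + 42 * F0 * J3 * r - 70 * F0 * J4 * r ^ 2 - 15 * F1 * J1
     + 42 * F1 * J2 * r - 52 * F1 * J3 * r ^ 2 + 70 * F1 * J4 * r ^ 3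
     + 30 * F2 * J1 * r - 42 * F2 * J2 * r ^ 2 + 62 * F2 * J3 * r ^ 3
     - 70 * F2 * J4 * r ^ 4 - 600 * K2 + 1080 * K3 * r - 1380 * K4 * r ^ 2
     + 1700 * K5 * r ^ 3 - 2100 * K6 * r ^ 4 + 2100 * K7 * r ^ 5 /\
  80 * K1 = 3 * F0 ^ 2 * F1 - 6 * F0 ^ 2 * F2 * r - 6 * F0 * F1 ^ 2 * r
     + 18 * F0 * F1 * F2 * r ^ 2 - 12 * F0 * F2 ^ 2 * r ^ 3 - 8 * F0 * J1
     + 16 * F0 * J2 * r - 24 * F0 * J3 * r ^ 2 + 32 * F0 * J4 * r ^ 3
     + 3 * F1 ^ 3 * r ^ 2 - 12 * F1 ^ 2 * F2 * r ^ 3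
     + 15 * F1 * F2 ^ 2 * r ^ 4 + 8 * F1 * J1 * r - 16 * F1 * J2 * r ^ 2
     + 24 * F1 * J3 * r ^ 3 - 32 * F1 * J4 * r ^ 4 - 6 * F2 ^ 3 * r ^ 5
     - 8 * F2 * J1 * r ^ 2 + 16 * F2 * J2 * r ^ 3 - 24 * F2 * J3 * r ^ 4
     + 32 * F2 * J4 * r ^ 5 + 160 * K2 * r - 240 * K3 * r ^ 2
     + 320 * K4 * r ^ 3 - 400 * K5 * r ^ 4 + 480 * K6 * r ^ 5
     - 560 * K7 * r ^ 6 /\
  400 * K0 = - (6 * F0 ^ 3 - 33 * F0 ^ 2 * F1 * r + 48 * F0 ^ 2 * F2 * r ^ 2
     + 48 * F0 * F1 ^ 2 * r ^ 2 - 126 * F0 * F1 * F2 * r ^ 3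
     + 78 * F0 * F2 ^ 2 * r ^ 4 + 40 * F0 * J1 * r - 80 * F0 * J2 * r ^ 2
     + 120 * F0 * J3 * r ^ 3 - 160 * F0 * J4 * r ^ 4 - 21 * F1 ^ 3 * r ^ 3
     + 78 * F1 ^ 2 * F2 * r ^ 4 - 93 * F1 * F2 ^ 2 * r ^ 5
     - 40 * F1 * J1 * r ^ 2 + 80 * F1 * J2 * r ^ 3 - 120 * F1 * J3 * r ^ 4
     + 160 * F1 * J4 * r ^ 5 + 36 * F2 ^ 3 * r ^ 6 + 40 * F2 * J1 * r ^ 3
     - 80 * F2 * J2 * r ^ 4 + 120 * F2 * J3 * r ^ 5 - 160 * F2 * J4 * r ^ 6
     - 400 * K2 * r ^ 2 + 800 * K3 * r ^ 3 - 1200 * K4 * r ^ 4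
     + 1600 * K5 * r ^ 5 - 2000 * K6 * r ^ 6 + 2400 * K7 * r ^ 7).

Definition Theta (c : coefs) : R -> R -> R := fun x y =>
  let r := cr c x y in
  let F2 := cF2 c x y in let F2y := dY (cF2 c) x y in
  let F2yy := dY (dY (cF2 c)) x y in
  let J4 := cJ4 c x y in let J4y := dY (cJ4 c) x y in
  let K6 := cK6 c x y in let K7 := cK7 c x y in
  (F2 ^ 2 - 4 * J4) * F2 - 8 * (K6 - 7 * K7 * r) - 8 * J4y + 6 * F2y * F2
    + 4 * F2yy.

Definition trans_system (c : coefs) (phi psi : R -> R -> R)
    (alpha beta : R -> R) (x y : R) : Prop :=
  let r := cr c x y in
  let F2 := cF2 c x y in let F2y := dY (cF2 c) x y in
  let F2yy := dY (dY (cF2 c)) x y in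
  let J4 := cJ4 c x y in let J4y := dY (cJ4 c) x y in
  let K7 := cK7 c x y in
  let phx := dX phi x y in let phy := dY phi x y in
  let phyy := dY (dY phi) x y in
  let ps := psi x y in
  let psx := dX psi x y in let psy := dY psi x y in
  let psyy := dY (dY psi) x y in let psyyy := dY (dY (dY psi)) x y in
  let psyyyy := dY (dY (dY (dY psi))) x y in
  let D := Jac phi psi x y in let Dy := dY (Jac phi psi) x y in
  let a := alpha (phi x y) in let b := beta (phi x y) in
  phx = r * phy /\
  phy * psx = r * phy * psy - D /\
  10 * D * phyy = phy * (4 * Dy - F2 * D) /\
  500 * phy * psyyyy * D ^ 3 =
    300 * psyyy * phy * D ^ 2 * (4 * Dy - F2 * D)
    + 5 * psyy * phy * D * (-120 * F2y * D ^ 2 - 144 * Dy ^ 2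
        + 72 * Dy * F2 * D - 39 * F2 ^ 2 * D ^ 2 + 80 * J4 * D ^ 2)
    + psy * phy * (-500 * phy ^ 3 * a * D ^ 3 - 150 * F2yy * D ^ 3
        + 360 * F2y * Dy * D ^ 2 - 165 * F2y * F2 * D ^ 3
        + 100 * J4y * D ^ 3 + 96 * Dy ^ 3 - 72 * Dy ^ 2 * F2 * D
        + 108 * Dy * F2 ^ 2 * D ^ 2 - 240 * Dy * J4 * D ^ 2
        - 24 * F2 ^ 3 * D ^ 3 + 60 * F2 * J4 * D ^ 3)
    - 500 * ps * phy ^ 5 * b * D ^ 3 + 500 * K7 * D ^ 4.

Definition alpha_formula (c : coefs) (phi : R -> R -> R) (x y : R) : R :=
  Theta c x y / (8 * dY phi x y ^ 3).

Definition beta_formula (c : coefs) (phi psi : R -> R -> R) (x y : R) : R :=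
  let r := cr c x y in let ry := dY (cr c) x y in
  let F1 := cF1 c x y in
  let F2 := cF2 c x y in let F2y := dY (cF2 c) x y in
  let J4 := cJ4 c x y in let J4y := dY (cJ4 c) x y in
  let J4yy := dY (dY (cJ4 c)) x y in
  let K6 := cK6 c x y in let K6y := dY (cK6 c) x y in
  let K7 := cK7 c x y in let K7x := dX (cK7 c) x y in
  let K7y := dY (cK7 c) x y in
  let Th := Theta c x y in let Thy := dY (Theta c) x y in
  let D := Jac phi psi x y in let Dy := dY (Jac phi psi) x y in
  let phy := dY phi x y in
  / (1600 * D * phy ^ 4) *
  (D * (-144 * F2y ^ 2 - 72 * F2y * F2 ^ 2 + 352 * F2y * J4 + 160 * J4yy
        + 80 * J4y * F2 + 640 * K6y - 1600 * K7x - 2880 * K7y * r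
        + 80 * Thy - 4480 * ry * K7 - 400 * F1 * K7 - 9 * F2 ^ 4
        + 88 * F2 ^ 2 * J4 + 160 * F2 * K6 - 320 * F2 * K7 * r
        - 144 * J4 ^ 2)
   - 120 * Dy * Th).

(* Main.v *)
(* In the frame X = d/dx - r d/dy, Y = (1/phi_y) d/dy, where P = y' + r plays
   the role of y', a point transformation (phi, psi) linearizes the equation iff
   X phi = 0 and the coefficients of the equation are given polynomials in the
   jets of phi, psi, alpha o phi, beta o phi; this is seen by comparing the two
   sides as polynomials in P, y'', y'''.

   Necessity: alpha and beta are arbitrary functions, but alpha o phi and
   beta o phi are expressed through jets of phi and psi, hence are smooth, and X
   kills them because it is tangent to the level curves of phi. Eliminating the
   jets of the transformation gives the conditions as polynomial identities.

   Sufficiency: phi_yy / phi_y satisfies a Riccati equation, linearized by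
   phi_yy / phi_y = -2 w_y / w. Once w is known, phi_y, phi, X psi and the
   Y-derivatives of psi solve a linear system of total differential equations,
   and the conditions are exactly its flatness; X-invariance then makes the
   expected alpha and beta functions of phi. *)
Require Import Defs.
From Stdlib Require Import Reals List QArith Qreals Lra Lia Psatz ClassicalEpsilon Ranalysis5.
From Coquelicot Require Import Coquelicot.
Import ListNotations.
Open Scope R_scope.
Arguments Q2R : simpl never.
Arguments Qred : simpl never.

(** * Polynomials in jets *)

(** A jet [(f, a, b)] stands for [a] y-derivatives of [b] X-derivatives of the function numbered
    [f]. Identities between derivatives are settled by reflection: known relations act as rewriting
    rules for jets, and a computation checks that a difference reduces to the zero polynomial.
    Soundness only asks that every rule hold on an open set, where it may be differentiated.
    Termination and confluence are never proved, for an incomplete reduction can only make a check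
    fail.

    Polynomials have rational coefficients, so no rule may contain a denominator. This dictates the
    choice of unknowns (logarithmic derivatives, rescaled derivatives of [psi], coefficients
    expanded in powers of P); the few divisions, by functions without zeros, are separate steps.

    Only linear total differential equations are solved, because then the square on which the
    solution lives is fixed by bounds on the coefficients and all estimates follow from one Gronwall
    inequality. *)

Definition jet : Type := nat * nat * nat.
Definition mono : Type := list jet.
Definition pol : Type := list (Q * mono).

Definition vcmp (v w : jet) : comparison :=
  match v, w with (f, a, b), (g, c, d) =>
    match Nat.compare f g with
    | Eq => match Nat.compare a c with Eq => Nat.compare b d | o => o end
    | o => o
    end
  end.

(** A lexicographic order in which smaller jets are larger variables. Being compatible with
    multiplication, it keeps the lists made by [pmulm] sorted. Sortedness is never proved: it only
    lets [padd] find the cancellations. *)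
Fixpoint mcmp (m k : mono) : comparison :=
  match m, k with
  | [], [] => Eq
  | [], _ => Lt
  | _, [] => Gt
  | v :: m', w :: k' =>
      match vcmp v w with Eq => mcmp m' k' | Lt => Gt | Gt => Lt end
  end.

Fixpoint vins (v : jet) (m : mono) : mono :=
  match m with
  | [] => [v]
  | w :: m' => match vcmp v w with Gt => w :: vins v m' | _ => v :: m end
  end.

(** Merging of sorted lists; the inner fixpoint lets a step consume either argument. Zero
    coefficients are dropped, so that a vanishing polynomial can be recognized as [[]]. *)
Fixpoint padd (p : pol) : pol -> pol :=
  match p with
  | [] => fun q => q
  | (c, m) :: p' =>
      fix go (q : pol) : pol :=
        match q with
        | [] => p
        | (d, k) :: q' =>
            match mcmp m k with
            | Eq => let s := Qred (c + d) in
                    if Qeq_bool s 0 then padd p' q' else (s, m) :: padd p' q'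
            | Gt => (c, m) :: padd p' q
            | Lt => (d, k) :: go q'
            end
        end
  end.

Definition pmulm (c : Q) (m : mono) (q : pol) : pol :=
  map (fun t => (Qred (c * fst t), fold_right vins (snd t) m)) q.
Definition pmul (p q : pol) : pol :=
  fold_right (fun t acc => padd (pmulm (fst t) (snd t) q) acc) [] p.
Definition pc (c : Q) : pol := if Qeq_bool c 0 then [] else [(c, [])].
Definition pv (v : jet) : pol := [(1%Q, [v])].
Definition pscale (c : Q) (p : pol) : pol := pmul (pc c) p.
Definition psub (p q : pol) : pol := padd p (pscale (-1) q).
Fixpoint ppow (p : pol) (n : nat) : pol :=
  match n with O => pc 1 | S k => pmul p (ppow p k) end.

Fixpoint mder (d : jet -> pol) (m : mono) : pol :=
  match m with
  | [] => []
  | v :: m' => padd (pmul (d v) [(1%Q, m')]) (pmul (pv v) (mder d m'))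
  end.
Definition pder (d : jet -> pol) (p : pol) : pol :=
  fold_right (fun t acc => padd (pscale (fst t) (mder d (snd t))) acc) [] p.

Definition mbind (s : jet -> pol) (m : mono) : pol :=
  fold_right (fun v acc => pmul (s v) acc) (pc 1) m.
Definition pbind (s : jet -> pol) (p : pol) : pol :=
  fold_right (fun t acc => padd (pscale (fst t) (mbind s (snd t))) acc) [] p.

Definition evm (rho : jet -> R) (m : mono) : R :=
  fold_right (fun v acc => rho v * acc) 1 m.
Definition ev (rho : jet -> R) (p : pol) : R :=
  fold_right (fun t acc => Q2R (fst t) * evm rho (snd t) + acc) 0 p.

Lemma vcmp_eq v w : vcmp v w = Eq -> v = w.
Proof.
  destruct v as [[f a] b], w as [[g c] d]; simpl.
  destruct (Nat.compare f g) eqn:E1; try discriminate.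
  destruct (Nat.compare a c) eqn:E2; try discriminate.
  intros E3.
  apply Nat.compare_eq in E1, E2, E3; now subst.
Qed.

Lemma mcmp_eq m k : mcmp m k = Eq -> m = k.
Proof.
  revert k; induction m as [|v m IH]; intros [|w k]; simpl; try easy.
  destruct (vcmp v w) eqn:E; try discriminate.
  intros H; apply vcmp_eq in E; apply IH in H; now subst.
Qed.

Section Evaluation.
Variable rho : jet -> R.

Lemma evm_vins v m : evm rho (vins v m) = rho v * evm rho m.
Proof.
  induction m as [|w m IH]; simpl; [easy|].
  destruct (vcmp v w); simpl; try easy.
  rewrite IH; ring.
Qed.

Lemma evm_merge m k : evm rho (fold_right vins k m) = evm rho m * evm rho k.
Proof.
  induction m as [|v m IH]; simpl; [ring|].
  rewrite evm_vins, IH; ring.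
Qed.

Lemma Q2R_Qred q : Q2R (Qred q) = Q2R q.
Proof. apply Qeq_eqR, Qred_correct. Qed.

Lemma ev_cons c m p : ev rho ((c, m) :: p) = Q2R c * evm rho m + ev rho p.
Proof. easy. Qed.

Lemma ev_padd p q : ev rho (padd p q) = ev rho p + ev rho q.
Proof.
  revert q; induction p as [|[c m] p IH]; intros q; [simpl; ring|].
  induction q as [|[d k] q IHq]; [simpl; ring|].
  cbn [padd]; destruct (mcmp m k) eqn:E; cbv zeta.
  - apply mcmp_eq in E; subst k.
    assert (Hs : Q2R (Qred (c + d)) = Q2R c + Q2R d)
      by (rewrite Q2R_Qred; apply Q2R_plus).
    destruct (Qeq_bool (Qred (c + d)) 0) eqn:E0.
    + apply Qeq_bool_eq, Qeq_eqR in E0; rewrite Hs, RMicromega.Q2R_0 in E0.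
      rewrite IH, !ev_cons.
      replace (Q2R d) with (- Q2R c) by lra; ring.
    + rewrite !ev_cons, IH, Hs; ring.
  (* The inner fixpoint is [padd ((c, m) :: p)]; refolding it exposes the inner induction
     hypothesis. *)
  - rewrite !ev_cons; fold (padd ((c, m) :: p)).
    change (ev rho _) with (ev rho (padd ((c, m) :: p) q)) at 1.
    rewrite IHq, ev_cons; ring.
  - rewrite ev_cons, IH, !ev_cons; ring.
Qed.

Lemma ev_pmulm c m q : ev rho (pmulm c m q) = Q2R c * evm rho m * ev rho q.
Proof.
  induction q as [|[d k] q IH]; simpl; [ring|].
  rewrite IH, Q2R_Qred, Q2R_mult, evm_merge; ring.
Qed.

Lemma ev_pmul p q : ev rho (pmul p q) = ev rho p * ev rho q.
Proof.
  induction p as [|[c m] p IH]; simpl; [ring|].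
  rewrite ev_padd, ev_pmulm, IH; ring.
Qed.

Lemma ev_pc c : ev rho (pc c) = Q2R c.
Proof.
  unfold pc; destruct (Qeq_bool c 0) eqn:E; simpl; [|ring].
  apply Qeq_bool_eq, Qeq_eqR in E; rewrite E, RMicromega.Q2R_0; easy.
Qed.

Lemma ev_pv v : ev rho (pv v) = rho v.
Proof. simpl; rewrite RMicromega.Q2R_1; ring. Qed.

Lemma ev_pscale c p : ev rho (pscale c p) = Q2R c * ev rho p.
Proof. unfold pscale; now rewrite ev_pmul, ev_pc. Qed.

Lemma ev_psub p q : ev rho (psub p q) = ev rho p - ev rho q.
Proof.
  unfold psub; rewrite ev_padd, ev_pscale.
  replace (Q2R (-1)) with (-1) by (unfold Q2R; simpl; lra); ring.
Qed.

Lemma ev_ppow p n : ev rho (ppow p n) = ev rho p ^ n.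
Proof.
  induction n as [|n IH]; simpl; [rewrite RMicromega.Q2R_1; ring|].
  now rewrite ev_pmul, IH.
Qed.

Lemma ev_mbind s m :
  ev rho (mbind s m) = evm (fun v => ev rho (s v)) m.
Proof.
  induction m as [|v m IH]; [simpl; rewrite RMicromega.Q2R_1; ring|].
  simpl; now rewrite ev_pmul, IH.
Qed.

Lemma ev_pbind s p : ev rho (pbind s p) = ev (fun v => ev rho (s v)) p.
Proof.
  induction p as [|[c m] p IH]; simpl; [easy|].
  now rewrite ev_padd, ev_pscale, ev_mbind, IH.
Qed.
End Evaluation.

Lemma ev_ext rho rho' p : (forall v, rho v = rho' v) -> ev rho p = ev rho' p.
Proof.
  intros H; induction p as [|[c m] p IH]; simpl; [easy|].
  rewrite IH; do 2 f_equal.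
  induction m as [|v m IHm]; simpl; [easy|]; now rewrite H, IHm.
Qed.

Lemma is_derive_ev (rho : R -> jet -> R) (d : jet -> pol) (t : R) (p : pol) :
  (forall v, is_derive (fun s => rho s v) t (ev (rho t) (d v))) ->
  is_derive (fun s => ev (rho s) p) t (ev (rho t) (pder d p)).
Proof.
  intros H.
  assert (Hm : forall m, is_derive (fun s => evm (rho s) m) t
                           (ev (rho t) (mder d m))).
  { induction m as [|v m IH].
    - apply (is_derive_const (V := R_NormedModule) 1).
    - cbn [mder]; rewrite ev_padd, !ev_pmul, ev_pv.
      replace (ev (rho t) [(1%Q, m)]) with (evm (rho t) m)
        by (simpl; rewrite RMicromega.Q2R_1; ring).
      apply (is_derive_mult (fun s => rho s v) (fun s => evm (rho s) m));
        [apply H | apply IH | intros; apply Rmult_comm]. }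
  induction p as [|[c m] p IH].
  - apply (is_derive_const (V := R_NormedModule) 0).
  - change (pder d ((c, m) :: p)) with (padd (pscale c (mder d m)) (pder d p)).
    rewrite ev_padd, ev_pscale.
    apply @is_derive_plus; [|exact IH].
    apply (is_derive_scal (fun s => evm (rho s) m)), Hm.
Qed.

(** * Smooth functions of two variables *)

Lemma open2_locally V x y : open2 V -> V x y -> locally_2d V x y.
Proof. intros HV Hxy; apply locally_2d_locally; exact (HV (x, y) Hxy). Qed.

Lemma locally_2d_open2 V :
  (forall x y, V x y -> locally_2d V x y) -> open2 V.
Proof.
  intros H [x y] Hxy; apply (locally_2d_locally V x y); now apply H.
Qed.

Lemma locally_2d_slice_x P x y : locally_2d P x y -> locally x (fun u => P u y).
Proof.
  intros [d Hd]; exists d; intros u Hu; apply Hd; [exact Hu|].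
  replace (y - y) with 0 by ring; rewrite Rabs_R0; apply cond_pos.
Qed.

Lemma locally_2d_slice_y P x y : locally_2d P x y -> locally y (fun v => P x v).
Proof.
  intros [d Hd]; exists d; intros v Hv; apply Hd; [|exact Hv].
  replace (x - x) with 0 by ring; rewrite Rabs_R0; apply cond_pos.
Qed.

Lemma disc_locally_2d (first : bool) c e x y :
  Rabs ((if first then x else y) - c) < e ->
  locally_2d (fun u v => Rabs ((if first then u else v) - c) < e) x y.
Proof.
  intros H.
  assert (Hp : 0 < e - Rabs ((if first then x else y) - c)) by lra.
  exists (mkposreal _ Hp); intros u v Hu Hv; simpl in Hu, Hv; destruct first.
  - replace (u - c) with ((u - x) + (x - c)) by ring.
    eapply Rle_lt_trans; [apply Rabs_triang | lra].
  - replace (v - c) with ((v - y) + (y - c)) by ring.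
    eapply Rle_lt_trans; [apply Rabs_triang | lra].
Qed.

Lemma dX_local f g x y :
  locally_2d (fun u v => f u v = g u v) x y -> dX f x y = dX g x y.
Proof. intros H; apply Derive_ext_loc, (locally_2d_slice_x _ _ _ H). Qed.

Lemma dY_local f g x y :
  locally_2d (fun u v => f u v = g u v) x y -> dY f x y = dY g x y.
Proof. intros H; apply Derive_ext_loc, (locally_2d_slice_y _ _ _ H). Qed.

Definition C1_at (f : R -> R -> R) (x y : R) : Prop :=
  ex_derive (fun t => f t y) x /\ ex_derive (fun t => f x t) y /\
  continuity_2d_pt f x y.

Lemma C1_at_local f g x y :
  locally_2d (fun u v => f u v = g u v) x y -> C1_at f x y -> C1_at g x y.
Proof.
  intros H (Hx & Hy & Hc); split; [|split].
  - eapply ex_derive_ext_loc; [|exact Hx]; apply (locally_2d_slice_x _ _ _ H).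
  - eapply ex_derive_ext_loc; [|exact Hy]; apply (locally_2d_slice_y _ _ _ H).
  - eapply continuity_2d_pt_ext_loc; eassumption.
Qed.

(** Smoothness graded by order. The words of partial derivatives in [smooth_on] give no induction
    for products and inverses, whereas the derivatives of a product are sums of products that need
    one order less. *)
Fixpoint smooth_upto (n : nat) (V : R -> R -> Prop) (f : R -> R -> R) : Prop :=
  (forall x y, V x y -> C1_at f x y) /\
  match n with
  | O => True
  | S k => smooth_upto k V (dX f) /\ smooth_upto k V (dY f)
  end.

Lemma iter_pd_app l d f : iter_pd (l ++ [d]) f = iter_pd l (pd d f).
Proof. unfold iter_pd; now rewrite fold_right_app. Qed.

Lemma smooth_on_pd V f d : smooth_on V f -> smooth_on V (pd d f).
Proof. intros H l x y Hxy; rewrite <- iter_pd_app; now apply H. Qed.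

Lemma smooth_on_dX V f : smooth_on V f -> smooth_on V (dX f).
Proof. apply (smooth_on_pd V f true). Qed.

Lemma smooth_on_dY V f : smooth_on V f -> smooth_on V (dY f).
Proof. apply (smooth_on_pd V f false). Qed.

Lemma smooth_on_C1 V f x y : smooth_on V f -> V x y -> C1_at f x y.
Proof.
  intros H Hxy; destruct (H [] x y Hxy) as (Hx & Hy & Hc).
  repeat split; [exact Hx | exact Hy |].
  now apply continuity_2d_pt_filterlim.
Qed.

Lemma smooth_on_upto V f : smooth_on V f <-> forall n, smooth_upto n V f.
Proof.
  split.
  - intros H n; revert f H; induction n as [|n IH]; intros f H; split.
    + intros x y Hxy; now apply smooth_on_C1 with V.
    + exact I.
    + intros x y Hxy; now apply smooth_on_C1 with V.
    + split; apply IH; [now apply smooth_on_dX | now apply smooth_on_dY].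
  (* [iter_pd] applies the last letter first, so the word is peeled from its end to agree with
     [smooth_upto], which differentiates innermost first. *)
  - intros H l; revert f H; induction l as [|d l IH] using rev_ind;
      intros f H x y Hxy.
    + destruct (H O) as [H0 _]; destruct (H0 x y Hxy) as (Hx & Hy & Hc).
      repeat split; [exact Hx | exact Hy |].
      now apply continuity_2d_pt_filterlim.
    + rewrite iter_pd_app; apply IH; [|exact Hxy].
      intros n; destruct (H (S n)) as (_ & HX & HY); now destruct d.
Qed.

Lemma smooth_on_sub V W f :
  (forall x y, W x y -> V x y) -> smooth_on V f -> smooth_on W f.
Proof. intros HWV H l x y Hxy; apply H, HWV, Hxy. Qed.

Section Smooth.
Variable V : R -> R -> Prop.
Hypothesis HV : open2 V.

Lemma eq_on_local (f g : R -> R -> R) x y :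
  (forall u v, V u v -> f u v = g u v) -> V x y ->
  locally_2d (fun u v => f u v = g u v) x y.
Proof.
  intros H Hxy; apply locally_2d_impl with V; [|now apply open2_locally].
  apply locally_2d_forall, H.
Qed.

Lemma dX_eq_on f g x y :
  (forall u v, V u v -> f u v = g u v) -> V x y -> dX f x y = dX g x y.
Proof. intros H Hxy; apply dX_local; now apply eq_on_local. Qed.

Lemma dY_eq_on f g x y :
  (forall u v, V u v -> f u v = g u v) -> V x y -> dY f x y = dY g x y.
Proof. intros H Hxy; apply dY_local; now apply eq_on_local. Qed.

Lemma smooth_upto_ext n f g :
  (forall x y, V x y -> f x y = g x y) -> smooth_upto n V f -> smooth_upto n V g.
Proof.
  revert f g; induction n as [|n IH]; intros f g H [H1 H2].
  - split; [|exact I].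
    intros x y Hxy; apply C1_at_local with f; [now apply eq_on_local | auto].
  - split.
    + intros x y Hxy; apply C1_at_local with f; [now apply eq_on_local | auto].
    + destruct H2 as [HX HY]; split.
      * apply IH with (dX f); [|exact HX]; intros; now apply dX_eq_on.
      * apply IH with (dY f); [|exact HY]; intros; now apply dY_eq_on.
Qed.

Lemma smooth_on_ext f g :
  (forall x y, V x y -> f x y = g x y) -> smooth_on V f -> smooth_on V g.
Proof.
  intros H Hf; apply smooth_on_upto; intros n.
  apply smooth_upto_ext with f; [exact H | now apply smooth_on_upto].
Qed.

Lemma smooth_upto_pred n f : smooth_upto (S n) V f -> smooth_upto n V f.
Proof.
  revert f; induction n as [|n IH]; intros f (H1 & HX & HY);
    (split; [exact H1 |]); [exact I | split; now apply IH].
Qed.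

Lemma smooth_upto_const n c : smooth_upto n V (fun _ _ => c).
Proof.
  revert c; induction n as [|n IH]; intros c;
    (assert (HC : forall x y, V x y -> C1_at (fun _ _ => c) x y);
     [ intros x y _; split; [|split];
       [ apply ex_derive_const | apply ex_derive_const
       | apply continuity_2d_pt_const ] |]); (split; [exact HC|]).
  - exact I.
  - split; apply smooth_upto_ext with (fun _ _ => 0); try apply IH;
      intros; unfold dX, dY; now rewrite Derive_const.
Qed.

Lemma smooth_upto_plus n f g :
  smooth_upto n V f -> smooth_upto n V g ->
  smooth_upto n V (fun x y => f x y + g x y).
Proof.
  revert f g; induction n as [|n IH]; intros f g [Hf Hf'] [Hg Hg'];
    (assert (H0 : forall x y, V x y -> C1_at (fun x y => f x y + g x y) x y);
     [ intros x y Hxy; destruct (Hf x y Hxy) as (a1 & a2 & a3),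
         (Hg x y Hxy) as (b1 & b2 & b3); split; [|split];
       [ now apply @ex_derive_plus | now apply @ex_derive_plus
       | now apply continuity_2d_pt_plus ] |]); (split; [exact H0|]); [exact I|].
  destruct Hf', Hg'; split.
  - apply smooth_upto_ext with (fun x y => dX f x y + dX g x y); [|now apply IH].
    intros x y Hxy; destruct (Hf x y Hxy) as (a1 & a2 & a3),
         (Hg x y Hxy) as (b1 & b2 & b3); unfold dX; symmetry.
    now apply (Derive_plus (fun t => f t y) (fun t => g t y)).
  - apply smooth_upto_ext with (fun x y => dY f x y + dY g x y); [|now apply IH].
    intros x y Hxy; destruct (Hf x y Hxy) as (a1 & a2 & a3),
         (Hg x y Hxy) as (b1 & b2 & b3); unfold dY; symmetry.
    now apply (Derive_plus (fun t => f x t) (fun t => g x t)).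
Qed.

Lemma smooth_upto_mult n f g :
  smooth_upto n V f -> smooth_upto n V g ->
  smooth_upto n V (fun x y => f x y * g x y).
Proof.
  revert f g; induction n as [|n IH]; intros f g Hf0 Hg0;
    pose proof Hf0 as [Hf Hf']; pose proof Hg0 as [Hg Hg'];
    (assert (H0 : forall x y, V x y -> C1_at (fun x y => f x y * g x y) x y);
     [ intros x y Hxy; destruct (Hf x y Hxy) as (a1 & a2 & a3),
         (Hg x y Hxy) as (b1 & b2 & b3); split; [|split];
       [ now apply ex_derive_mult | now apply ex_derive_mult
       | now apply continuity_2d_pt_mult ] |]); (split; [exact H0|]); [exact I|].
  destruct Hf', Hg'; split.
  - apply smooth_upto_ext with (fun x y => dX f x y * g x y + f x y * dX g x y).
    + intros x y Hxy; destruct (Hf x y Hxy) as (a1 & a2 & a3),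
         (Hg x y Hxy) as (b1 & b2 & b3); unfold dX; symmetry.
      now apply (Derive_mult (fun t => f t y) (fun t => g t y)).
    + apply smooth_upto_plus; apply IH; trivial; now apply smooth_upto_pred.
  - apply smooth_upto_ext with (fun x y => dY f x y * g x y + f x y * dY g x y).
    + intros x y Hxy; destruct (Hf x y Hxy) as (a1 & a2 & a3),
         (Hg x y Hxy) as (b1 & b2 & b3); unfold dY; symmetry.
      now apply (Derive_mult (fun t => f x t) (fun t => g x t)).
    + apply smooth_upto_plus; apply IH; trivial; now apply smooth_upto_pred.
Qed.

Lemma smooth_upto_inv n f :
  (forall x y, V x y -> f x y <> 0) -> smooth_upto n V f ->
  smooth_upto n V (fun x y => / f x y).
Proof.
  intros H0; revert f H0; induction n as [|n IH]; intros f H0 Hf0;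
    pose proof Hf0 as [Hf Hf'];
    (assert (HC : forall x y, V x y -> C1_at (fun x y => / f x y) x y);
     [ intros x y Hxy; destruct (Hf x y Hxy) as (a1 & a2 & a3); split; [|split];
       [ apply ex_derive_inv; auto | apply ex_derive_inv; auto
       | apply continuity_2d_pt_inv; auto ] |]); (split; [exact HC|]); [exact I|].
  assert (Hi : smooth_upto n V (fun x y => / f x y))
    by (apply IH; [exact H0 | now apply smooth_upto_pred]).
  destruct Hf'; split.
  - apply smooth_upto_ext with
      (fun x y => (-1) * (dX f x y * (/ f x y * / f x y))).
    + intros x y Hxy; destruct (Hf x y Hxy) as (a1 & a2 & a3).
      unfold dX; rewrite (Derive_inv (fun t => f t y)); auto.
      field; auto.
    + repeat apply smooth_upto_mult; trivial; apply smooth_upto_const.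
  - apply smooth_upto_ext with
      (fun x y => (-1) * (dY f x y * (/ f x y * / f x y))).
    + intros x y Hxy; destruct (Hf x y Hxy) as (a1 & a2 & a3).
      unfold dY; rewrite (Derive_inv (fun t => f x t)); auto.
      field; auto.
    + repeat apply smooth_upto_mult; trivial; apply smooth_upto_const.
Qed.

Lemma smooth_on_const c : smooth_on V (fun _ _ => c).
Proof. apply smooth_on_upto; intros n; apply smooth_upto_const. Qed.

Lemma smooth_on_plus f g :
  smooth_on V f -> smooth_on V g -> smooth_on V (fun x y => f x y + g x y).
Proof.
  intros Hf Hg; apply smooth_on_upto; intros n.
  apply smooth_upto_plus; now apply smooth_on_upto.
Qed.

Lemma smooth_on_mult f g :
  smooth_on V f -> smooth_on V g -> smooth_on V (fun x y => f x y * g x y).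
Proof.
  intros Hf Hg; apply smooth_on_upto; intros n.
  apply smooth_upto_mult; now apply smooth_on_upto.
Qed.

Lemma smooth_on_inv f :
  (forall x y, V x y -> f x y <> 0) -> smooth_on V f ->
  smooth_on V (fun x y => / f x y).
Proof.
  intros H0 Hf; apply smooth_on_upto; intros n.
  apply smooth_upto_inv; [exact H0 | now apply smooth_on_upto].
Qed.

Lemma smooth_on_opp f : smooth_on V f -> smooth_on V (fun x y => - f x y).
Proof.
  intros Hf; apply smooth_on_ext with (fun x y => (-1) * f x y).
  - intros; ring.
  - apply (smooth_on_mult (fun _ _ => -1)); [apply smooth_on_const | exact Hf].
Qed.

Lemma smooth_on_minus f g :
  smooth_on V f -> smooth_on V g -> smooth_on V (fun x y => f x y - g x y).
Proof.
  intros Hf Hg; apply (smooth_on_plus f (fun x y => - g x y)); trivial.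
  now apply smooth_on_opp.
Qed.

Lemma smooth_on_ev (rho : R -> R -> jet -> R) (p : pol) :
  (forall v, smooth_on V (fun x y => rho x y v)) ->
  smooth_on V (fun x y => ev (rho x y) p).
Proof.
  intros H; induction p as [|[c m] p IH]; [apply (smooth_on_const 0)|].
  apply (smooth_on_plus (fun x y => Q2R c * evm (rho x y) m)
           (fun x y => ev (rho x y) p)); [|exact IH].
  apply (smooth_on_mult (fun _ _ => Q2R c) (fun x y => evm (rho x y) m));
    [apply smooth_on_const|].
  clear IH; induction m as [|v m IHm]; [apply (smooth_on_const 1)|].
  apply (smooth_on_mult (fun x y => rho x y v) (fun x y => evm (rho x y) m));
    [apply H | exact IHm].
Qed.

Lemma is_derive_dX f x y :
  smooth_on V f -> V x y -> is_derive (fun t => f t y) x (dX f x y).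
Proof.
  intros Hf Hxy; apply Derive_correct, (smooth_on_C1 V f x y Hf Hxy).
Qed.

Lemma is_derive_dY f x y :
  smooth_on V f -> V x y -> is_derive (fun t => f x t) y (dY f x y).
Proof.
  intros Hf Hxy; apply Derive_correct, (smooth_on_C1 V f x y Hf Hxy).
Qed.

Lemma dX_dY_comm f x y :
  smooth_on V f -> V x y -> dX (dY f) x y = dY (dX f) x y.
Proof.
  intros Hf Hxy; unfold dX, dY; apply Schwarz.
  - apply locally_2d_impl with V; [|now apply open2_locally].
    apply locally_2d_forall; intros u v Huv.
    destruct (smooth_on_C1 V f u v Hf Huv) as (a1 & a2 & _).
    destruct (smooth_on_C1 V (dX f) u v (smooth_on_dX _ _ Hf) Huv)
      as (_ & b2 & _).
    destruct (smooth_on_C1 V (dY f) u v (smooth_on_dY _ _ Hf) Huv)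
      as (c1 & _ & _).
    repeat split; assumption.
  - apply (smooth_on_C1 V (dX (dY f)) x y); [|exact Hxy].
    now apply smooth_on_dX, smooth_on_dY.
  - apply (smooth_on_C1 V (dY (dX f)) x y); [|exact Hxy].
    now apply smooth_on_dY, smooth_on_dX.
Qed.

(** An x-derivative that exists nearby and is continuous at the point, together with a y-derivative
    at the point, gives total differentiability. *)
Lemma smooth_on_differentiable f x y :
  smooth_on V f -> V x y ->
  differentiable_pt_lim f x y (dX f x y) (dY f x y).
Proof.
  intros Hf Hxy; apply filterdiff_differentiable_pt_lim.
  apply (is_derive_filterdiff f x y (dX f) (dY f x y)).
  - apply (locally_2d_locally
             (fun u v => is_derive (fun z => f z v) u (dX f u v)) x y).
    apply locally_2d_impl with V; [|now apply open2_locally].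
    apply locally_2d_forall; intros u v Huv; now apply is_derive_dX.
  - now apply is_derive_dY.
  - apply continuity_2d_pt_filterlim.
    apply (smooth_on_C1 V (dX f) x y); [now apply smooth_on_dX | exact Hxy].
Qed.

Lemma is_derive_along f (g : R -> R) x l :
  smooth_on V f -> V x (g x) -> is_derive g x l ->
  is_derive (fun t => f t (g t)) x (dX f x (g x) + dY f x (g x) * l).
Proof.
  intros Hf Hxy Hg; apply is_derive_Reals.
  replace (dX f x (g x)) with (dX f x (g x) * 1) by ring.
  apply (derivable_pt_lim_comp_2d f (fun t => t) g).
  - now apply smooth_on_differentiable.
  - apply derivable_pt_lim_id.
  - now apply is_derive_Reals.
Qed.
End Smooth.

(** * Derivations on jets *)

Definition jv (f : nat) : pol := pv (f, 0%nat, 0%nat).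
Definition yraw (v : jet) : pol := let '(f, a, b) := v in pv (f, S a, b).

(* X (dY g) = dY (X g) + r_y dY g *)
Fixpoint xder (f a b : nat) : pol :=
  match a with
  | O => pv (f, O, S b)
  | S a' => padd (pder yraw (xder f a' b)) (pmul (pv (0, 1, 0)%nat) (pv (f, a, b)))
  end.
Definition xraw (v : jet) : pol := let '(f, a, b) := v in xder f a b.

Definition rules : Type := list (jet * pol).

Definition jeqb (v w : jet) : bool :=
  match vcmp v w with Eq => true | _ => false end.

Definition is_jet (v : jet) (p : pol) : bool :=
  match p with [(_, [w])] => jeqb v w | _ => false end.

(** Prolongation on demand: a rule for a jet also serves for its derivatives, since the lower jet is
    reduced and the result differentiated. The y-derivatives are peeled off before the X-derivatives
    because they are the outer ones. A jet whose lower jet is irreducible stays as it is. *)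
Fixpoint nf (k : nat) (rs : rules) (v : jet) : pol :=
  match k with
  | O => pv v
  | S k' =>
      match find (fun t => jeqb v (fst t)) rs with
      | Some t => pbind (nf k' rs) (snd t)
      | None =>
          let '(f, a, b) := v in
          match a, b with
          | S a', _ =>
              let e := nf k' rs (f, a', b) in
              if is_jet (f, a', b) e then pv v
              else pbind (nf k' rs) (pder yraw e)
          | O, S b' =>
              let e := nf k' rs (f, O, b') in
              if is_jet (f, O, b') e then pv v
              else pbind (nf k' rs) (pder xraw e)
          | O, O => pv v
          end
      end
  end.

(** The fuel 12 only bounds the depth of the reduction; soundness holds for any amount. *)
Definition normal (rs : rules) (p : pol) : pol := pbind (nf 12 rs) p.
Definition Dy (rs : rules) (p : pol) : pol := normal rs (pder yraw p).
Definition DX (rs : rules) (p : pol) : pol := normal rs (pder xraw p).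

Definition Xop (r f : R -> R -> R) : R -> R -> R :=
  fun x y => dX f x y - r x y * dY f x y.

Definition jets (fld : nat -> R -> R -> R) (x y : R) (v : jet) : R :=
  let '(f, a, b) := v in
  Nat.iter a dY (Nat.iter b (Xop (fld 0%nat)) (fld f)) x y.

Definition lin_coef (v : jet) (p : pol) : Q :=
  fold_right (fun t acc => if is_jet v [t] then fst t else acc) 0%Q p.
(** Where [p] vanishes, [v] equals [v - p / k] for any constant [k]; with [k] the coefficient of [v]
    in [p], the linear term in [v] cancels. *)
Definition solve_for (v : jet) (p : pol) : pol :=
  psub (pv v) (pscale (/ lin_coef v p) p).

Lemma jeqb_eq v w : jeqb v w = true -> v = w.
Proof.
  unfold jeqb; destruct (vcmp v w) eqn:E; try discriminate.
  intros _; now apply vcmp_eq.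
Qed.

(** Serves for [d/dx = X + r d/dy]: at a fixed point, [r] is a number. *)
Lemma ev_pder_comb rho (d d1 d2 : jet -> pol) (c : R) p :
  (forall v, ev rho (d v) = ev rho (d1 v) + c * ev rho (d2 v)) ->
  ev rho (pder d p) = ev rho (pder d1 p) + c * ev rho (pder d2 p).
Proof.
  intros H.
  assert (Hm : forall m, ev rho (mder d m) =
             ev rho (mder d1 m) + c * ev rho (mder d2 m)).
  { induction m as [|v m IH]; [simpl; ring|].
    cbn [mder]; rewrite !ev_padd, !ev_pmul, IH, H; ring. }
  induction p as [|[q m] p IH]; [simpl; ring|].
  cbn [pder fold_right fst snd]; rewrite !ev_padd, !ev_pscale, Hm.
  change (fold_right _ [] p) with (pder d p) at 1.
  rewrite IH; unfold pder; ring.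
Qed.

Section Context.
Variable V : R -> R -> Prop.
Hypothesis HV : open2 V.
Variable fld : nat -> R -> R -> R.
Hypothesis Hfld : forall f, smooth_on V (fld f).

Let r := fld 0%nat.

Lemma smooth_Xop g : smooth_on V g -> smooth_on V (Xop r g).
Proof.
  intros Hg; apply smooth_on_minus; [exact HV | now apply smooth_on_dX |].
  apply smooth_on_mult; [exact HV | apply Hfld | now apply smooth_on_dY].
Qed.

Lemma smooth_jets v : smooth_on V (fun x y => jets fld x y v).
Proof.
  destruct v as [[f a] b].
  assert (H : smooth_on V (Nat.iter b (Xop r) (fld f)))
    by (induction b; [apply Hfld | now apply smooth_Xop]).
  change (smooth_on V (Nat.iter a dY (Nat.iter b (Xop r) (fld f)))).
  induction a; [exact H | now apply smooth_on_dY].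
Qed.

Lemma smooth_ev p : smooth_on V (fun x y => ev (jets fld x y) p).
Proof. apply smooth_on_ev; [exact HV | apply smooth_jets]. Qed.

Lemma dY_ev p x y :
  V x y ->
  dY (fun x y => ev (jets fld x y) p) x y = ev (jets fld x y) (pder yraw p).
Proof.
  intros Hxy; apply is_derive_unique.
  apply (is_derive_ev (fun t => jets fld x t)).
  intros [[f a] b]; cbn [yraw]; rewrite ev_pv.
  apply (is_derive_dY V (fun x y => jets fld x y (f, a, b)));
    [apply smooth_jets | exact Hxy].
Qed.

Lemma X_dY g x y :
  smooth_on V g -> V x y ->
  Xop r (dY g) x y = dY (Xop r g) x y + dY r x y * dY g x y.
Proof.
  intros Hg Hxy.
  assert (H : dY (Xop r g) x y =
    dY (dX g) x y - (dY r x y * dY g x y + r x y * dY (dY g) x y)).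
  { apply is_derive_unique.
    apply (is_derive_minus (fun t => dX g x t) (fun t => r x t * dY g x t)).
    - apply (is_derive_dY V); [now apply smooth_on_dX | exact Hxy].
    - apply (is_derive_mult (fun t => r x t) (fun t => dY g x t)).
      + apply (is_derive_dY V); [apply Hfld | exact Hxy].
      + apply (is_derive_dY V); [now apply smooth_on_dY | exact Hxy].
      + intros; apply Rmult_comm. }
  rewrite H; unfold Xop.
  rewrite (dX_dY_comm V HV g x y Hg Hxy); ring.
Qed.

Lemma X_jets v x y :
  V x y ->
  Xop r (fun x y => jets fld x y v) x y = ev (jets fld x y) (xraw v).
Proof.
  destruct v as [[f a] b]; cbn [xraw]; revert x y.
  induction a as [|a IH]; intros x y Hxy; cbn [xder].
  - now rewrite ev_pv.
  - rewrite ev_padd, ev_pmul, !ev_pv, <- dY_ev by exact Hxy.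
    change (Xop r (dY (fun x y => jets fld x y (f, a, b))) x y =
            dY (fun x y => ev (jets fld x y) (xder f a b)) x y
            + dY r x y * dY (fun x y => jets fld x y (f, a, b)) x y).
    rewrite X_dY; [| apply smooth_jets | exact Hxy].
    f_equal; now apply (dY_eq_on V HV).
Qed.

Lemma X_ev p x y :
  V x y ->
  Xop r (fun x y => ev (jets fld x y) p) x y = ev (jets fld x y) (pder xraw p).
Proof.
  intros Hxy; unfold Xop; rewrite dY_ev by exact Hxy.
  set (d := fun v => padd (xraw v) (pmul (jv 0) (yraw v))).
  assert (H : dX (fun x y => ev (jets fld x y) p) x y
              = ev (jets fld x y) (pder d p)).
  { apply is_derive_unique.
    apply (is_derive_ev (fun t => jets fld t y)).
    intros v; unfold d; rewrite ev_padd, ev_pmul, <- X_jets by exact Hxy.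
    replace (_ + _) with (dX (fun x y => jets fld x y v) x y).
    - apply (is_derive_dX V (fun x y => jets fld x y v));
        [apply smooth_jets | exact Hxy].
    - unfold Xop, jv; rewrite ev_pv; destruct v as [[f a] b].
      cbn [yraw]; rewrite ev_pv; cbn [jets Nat.iter]; fold r.
      unfold dY; simpl; ring. }
  rewrite H, (ev_pder_comb _ d xraw yraw (r x y)); [ring|].
  intros v; unfold d, jv; now rewrite ev_padd, ev_pmul, ev_pv.
Qed.

Lemma ev_zero_derivatives p :
  (forall x y, V x y -> ev (jets fld x y) p = 0) -> forall x y, V x y ->
  ev (jets fld x y) (pder yraw p) = 0 /\ ev (jets fld x y) (pder xraw p) = 0.
Proof.
  intros Hp x y Hxy; rewrite <- dY_ev, <- X_ev by exact Hxy; unfold Xop.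
  rewrite (dX_eq_on V HV _ (fun _ _ => 0) x y Hp Hxy),
    (dY_eq_on V HV _ (fun _ _ => 0) x y Hp Hxy).
  unfold dX, dY; rewrite !Derive_const; split; ring.
Qed.

Definition valid (rs : rules) : Prop :=
  forall v e, In (v, e) rs ->
  forall x y, V x y -> jets fld x y v = ev (jets fld x y) e.

Lemma valid_nil : valid [].
Proof. intros v e []. Qed.

Lemma valid_app rs rs' : valid rs -> valid rs' -> valid (rs ++ rs').
Proof. intros H H' v e Hin; apply in_app_iff in Hin as []; auto. Qed.

Lemma valid_cons v e rs :
  (forall x y, V x y -> jets fld x y v = ev (jets fld x y) e) ->
  valid rs -> valid ((v, e) :: rs).
Proof. intros H Hrs w e' [E|Hin]; [now inversion E; subst | now apply Hrs]. Qed.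

Section Normalization.
Variable rs : rules.
Hypothesis Hrs : valid rs.

(** Induction on the fuel, for all points at once: the induction hypothesis is an identity on an
    open set, so its two sides have the same derivatives. *)
Lemma nf_sound k v x y :
  V x y -> ev (jets fld x y) (nf k rs v) = jets fld x y v.
Proof.
  revert v x y; induction k as [|k IH]; intros v x y Hxy; [apply ev_pv|].
  assert (Hb : forall p, ev (jets fld x y) (pbind (nf k rs) p)
                         = ev (jets fld x y) p)
    by (intros p; rewrite ev_pbind; apply ev_ext; intros w; now apply IH).
  cbn [nf]; destruct (find (fun t => jeqb v (fst t)) rs) as [[w e]|] eqn:E.
  - apply find_some in E as [Hin E]; apply jeqb_eq in E; simpl in E; subst w.
    rewrite Hb; symmetry; now apply Hrs.
  - destruct v as [[f a] b]; destruct a as [|a], b as [|b]; [apply ev_pv | | |].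
    + destruct (is_jet _ _); [apply ev_pv|].
      rewrite Hb, <- X_ev by exact Hxy; unfold Xop.
      rewrite (dX_eq_on V HV _ (fun x y => jets fld x y (f, 0, b)%nat)),
        (dY_eq_on V HV _ (fun x y => jets fld x y (f, 0, b)%nat));
        [easy | | exact Hxy | | exact Hxy]; intros; now apply IH.
    + destruct (is_jet _ _); [apply ev_pv|].
      rewrite Hb, <- dY_ev by exact Hxy.
      rewrite (dY_eq_on V HV _ (fun x y => jets fld x y (f, a, 0)%nat));
        [easy | | exact Hxy]; intros; now apply IH.
    + destruct (is_jet _ _); [apply ev_pv|].
      rewrite Hb, <- dY_ev by exact Hxy.
      rewrite (dY_eq_on V HV _ (fun x y => jets fld x y (f, a, S b)));
        [easy | | exact Hxy]; intros; now apply IH.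
Qed.

Lemma normal_sound p x y :
  V x y -> ev (jets fld x y) (normal rs p) = ev (jets fld x y) p.
Proof.
  intros Hxy; unfold normal; rewrite ev_pbind.
  apply ev_ext; intros v; now apply nf_sound.
Qed.

Lemma Dy_sound p x y :
  V x y ->
  ev (jets fld x y) (Dy rs p) = dY (fun x y => ev (jets fld x y) p) x y.
Proof. intros Hxy; unfold Dy; now rewrite normal_sound, dY_ev. Qed.

Lemma DX_sound p x y :
  V x y ->
  ev (jets fld x y) (DX rs p) = Xop r (fun x y => ev (jets fld x y) p) x y.
Proof. intros Hxy; unfold DX; now rewrite normal_sound, X_ev. Qed.

Lemma valid_solve v p :
  (forall x y, V x y -> ev (jets fld x y) p = 0) ->
  valid (rs ++ [(v, solve_for v p)]).
Proof.
  intros Hp; apply valid_app; [exact Hrs|].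
  apply valid_cons; [|apply valid_nil].
  intros x y Hxy; unfold solve_for.
  rewrite ev_psub, ev_pv, ev_pscale, Hp by exact Hxy; ring.
Qed.

(** The integrability condition at [v]: differentiating the reduced jet and reducing the
    differentiated jet must agree. Where the two polynomials differ, a new relation is found. *)
Definition compat (v : jet) : pol :=
  psub (DX rs (nf 12 rs v)) (normal rs (xraw v)).

Lemma compat_sound v x y :
  V x y -> ev (jets fld x y) (compat v) = 0.
Proof.
  intros Hxy; unfold compat.
  rewrite ev_psub, DX_sound, normal_sound, <- X_jets by exact Hxy.
  unfold Xop.
  rewrite (dX_eq_on V HV _ (fun x y => jets fld x y v)),
    (dY_eq_on V HV _ (fun x y => jets fld x y v));
    [ring | | exact Hxy | | exact Hxy]; intros; now apply nf_sound.
Qed.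
End Normalization.
End Context.

(** The reflection principle; the last premise is discharged by computation. *)
Lemma normal_zero V fld rs p q x y :
  open2 V -> (forall f, smooth_on V (fld f)) -> valid V fld rs -> V x y ->
  normal rs (psub p q) = [] -> ev (jets fld x y) p = ev (jets fld x y) q.
Proof.
  intros HV Hf Hrs Hxy H.
  assert (E : ev (jets fld x y) (psub p q) = 0)
    by (rewrite <- (normal_sound V HV fld Hf rs Hrs), H by exact Hxy; easy).
  rewrite ev_psub in E; lra.
Qed.

(** * Linear systems of total differential equations *)

Fixpoint rsum (n : nat) (f : nat -> R) : R :=
  match n with O => 0 | S k => rsum k f + f k end.

Lemma rsum_ext n f g : (forall i, (i < n)%nat -> f i = g i) -> rsum n f = rsum n g.
Proof.
  intros H; induction n as [|n IH]; simpl; [easy|].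
  rewrite IH, H; [easy | lia | intros; apply H; lia].
Qed.

Lemma rsum_plus n f g : rsum n (fun i => f i + g i) = rsum n f + rsum n g.
Proof. induction n as [|n IH]; simpl; [ring | rewrite IH; ring]. Qed.

Lemma rsum_scal n c f : rsum n (fun i => c * f i) = c * rsum n f.
Proof. induction n as [|n IH]; simpl; [ring | rewrite IH; ring]. Qed.

Lemma rsum_minus n f g : rsum n (fun i => f i - g i) = rsum n f - rsum n g.
Proof. induction n as [|n IH]; simpl; [ring | rewrite IH; ring]. Qed.

Lemma rsum_exchange n m (f : nat -> nat -> R) :
  rsum n (fun i => rsum m (f i)) = rsum m (fun j => rsum n (fun i => f i j)).
Proof.
  induction n as [|n IH]; simpl.
  - induction m as [|m IHm]; simpl; [easy | rewrite <- IHm; ring].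
  - now rewrite IH, rsum_plus.
Qed.

Lemma rsum_le n f g :
  (forall i, (i < n)%nat -> f i <= g i) -> rsum n f <= rsum n g.
Proof.
  intros H; induction n as [|n IH]; simpl; [lra|].
  apply Rplus_le_compat; [apply IH; intros; apply H; lia | apply H; lia].
Qed.

Lemma rsum_const n c : rsum n (fun _ => c) = INR n * c.
Proof.
  induction n as [|n IH]; [simpl; ring|].
  rewrite S_INR; simpl; rewrite IH; ring.
Qed.

Lemma rsum_nonneg n f : (forall i, (i < n)%nat -> 0 <= f i) -> 0 <= rsum n f.
Proof.
  intros H; replace 0 with (rsum n (fun _ => 0)) by (rewrite rsum_const; ring).
  now apply rsum_le.
Qed.

Lemma rsum_term n f i :
  (forall j, (j < n)%nat -> 0 <= f j) -> (i < n)%nat -> f i <= rsum n f.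
Proof.
  intros H Hi; induction n as [|n IH]; [lia|]; simpl.
  destruct (Nat.eq_dec i n) as [->|Hne].
  - assert (0 <= rsum n f) by (apply rsum_nonneg; intros; apply H; lia); lra.
  - assert (f i <= rsum n f) by (apply IH; [intros; apply H; lia | lia]).
    assert (0 <= f n) by (apply H; lia); lra.
Qed.

Lemma rsum_Rabs n f : Rabs (rsum n f) <= rsum n (fun i => Rabs (f i)).
Proof.
  induction n as [|n IH]; simpl; [rewrite Rabs_R0; lra|].
  eapply Rle_trans; [apply Rabs_triang | lra].
Qed.

(* |sum a_j b_j| <= K sum |b_j| when |a_j| <= K *)
Lemma rsum_Rabs_mult n a b K :
  (forall j, (j < n)%nat -> Rabs (a j) <= K) ->
  Rabs (rsum n (fun j => a j * b j)) <= K * rsum n (fun j => Rabs (b j)).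
Proof.
  intros H; eapply Rle_trans; [apply rsum_Rabs|].
  rewrite <- rsum_scal; apply rsum_le; intros j Hj.
  rewrite Rabs_mult; apply Rmult_le_compat_r; [apply Rabs_pos | auto].
Qed.

Lemma is_derive_rsum n (f : nat -> R -> R) (df : nat -> R) t :
  (forall i, (i < n)%nat -> is_derive (f i) t (df i)) ->
  is_derive (fun s => rsum n (fun i => f i s)) t (rsum n df).
Proof.
  intros H; induction n as [|n IH]; simpl.
  - apply (is_derive_const (V := R_NormedModule) 0).
  - apply (is_derive_plus (fun s => rsum n (fun i => f i s)) (f n));
      [apply IH; intros; apply H; lia | apply H; lia].
Qed.

Lemma continuity_pt_rsum n (f : nat -> R -> R) t :
  (forall i, (i < n)%nat -> continuity_pt (f i) t) ->
  continuity_pt (fun s => rsum n (fun i => f i s)) t.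
Proof.
  intros H; induction n as [|n IH]; simpl.
  - apply (continuity_pt_const (fun _ => 0)); intros ? ?; easy.
  - apply (continuity_pt_plus (fun s => rsum n (fun i => f i s)) (f n));
      [apply IH; intros; apply H; lia | apply H; lia].
Qed.

Lemma is_lim_seq_rsum n (u : nat -> nat -> R) (l : nat -> R) :
  (forall i, (i < n)%nat -> is_lim_seq (u i) (l i)) ->
  is_lim_seq (fun k => rsum n (fun i => u i k)) (rsum n l).
Proof.
  intros H; induction n as [|n IH]; simpl.
  - apply is_lim_seq_const.
  - apply (is_lim_seq_plus' (fun k => rsum n (fun i => u i k)) (u n));
      [apply IH; intros; apply H; lia | apply H; lia].
Qed.

Lemma is_derive_continuity_pt f t l : is_derive f t l -> continuity_pt f t.
Proof.
  intros H; apply continuity_pt_filterlim.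
  apply (ex_derive_continuous (K := R_AbsRing) (V := R_NormedModule)).
  now exists l.
Qed.

(** * Linear ordinary systems by Picard iteration *)

Section LinearODE.
Variables (N : nat) (C : nat -> nat -> R -> R) (a : R) (z0 : nat -> R).

Fixpoint picard (n : nat) (i : nat) (t : R) : R :=
  match n with
  | O => z0 i
  | S k => z0 i + RInt (fun s => rsum N (fun j => C i j s * picard k j s)) a t
  end.

(** The shift by one makes every member of the sequence a primitive, so that termwise derivatives
    have a closed form. *)
Definition ode_sol (i : nat) (t : R) : R :=
  Lim_seq (fun n => picard (S n) i t).

Variables (d K : R).
Hypothesis Hd : 0 < d.
Hypothesis HC : forall i j t, (i < N)%nat -> (j < N)%nat -> Rabs (t - a) < d ->
  continuity_pt (C i j) t.
Hypothesis HK : forall i j t, (i < N)%nat -> (j < N)%nat -> Rabs (t - a) < d ->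
  Rabs (C i j t) <= K.
Hypothesis HNK : INR N * K * d <= 1 / 2.

Let D (t : R) := Rabs (t - a) < d.

Lemma segment_in_disc s t :
  D t -> Rmin a t <= s <= Rmax a t -> D s.
Proof.
  unfold D, Rmin, Rmax; destruct (Rle_dec a t); intros Ht Hs;
    apply Rabs_def2 in Ht; apply Rabs_def1; lra.
Qed.

Lemma primitive_derive (f : R -> R) c t :
  (forall s, D s -> continuity_pt f s) -> D t ->
  is_derive (fun t => c + RInt f a t) t (f t).
Proof.
  intros Hf Ht.
  replace (f t) with (0 + f t) by ring.
  apply (is_derive_plus (V := R_NormedModule) (fun _ => c)).
  { apply (is_derive_const (V := R_NormedModule)). }
  apply (is_derive_RInt (V := R_NormedModule) f (fun s => RInt f a s) a).
  - assert (Hp : 0 < d - Rabs (t - a)) by (unfold D in Ht; lra).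
    exists (mkposreal _ Hp); intros s Hs.
    change (Rabs (s - t) < d - Rabs (t - a)) in Hs.
    assert (Hs' : D s).
    { unfold D; replace (s - a) with ((s - t) + (t - a)) by ring.
      eapply Rle_lt_trans; [apply Rabs_triang | lra]. }
    apply (RInt_correct (V := R_CompleteNormedModule)).
    apply (ex_RInt_continuous (V := R_CompleteNormedModule)).
    intros u Hu; apply continuity_pt_filterlim, Hf.
    now apply segment_in_disc with s.
  - now apply continuity_pt_filterlim, Hf.
Qed.

Lemma picard_continuous n i t :
  (i < N)%nat -> D t -> continuity_pt (picard n i) t.
Proof.
  revert i t; induction n as [|n IH]; intros i t Hi Ht.
  - apply continuity_pt_const; intros ? ?; easy.
  - eapply is_derive_continuity_pt.
    apply (primitive_derive (fun s => rsum N (fun j => C i j s * picard n j s)));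
      [|exact Ht].
    intros s Hs; apply continuity_pt_rsum; intros j Hj.
    apply continuity_pt_mult; [now apply HC | now apply IH].
Qed.

Lemma picard_derive n i t :
  (i < N)%nat -> D t ->
  is_derive (picard (S n) i) t (rsum N (fun j => C i j t * picard n j t)).
Proof.
  intros Hi Ht.
  apply (primitive_derive (fun s => rsum N (fun j => C i j s * picard n j s)));
    [|exact Ht].
  intros s Hs; apply continuity_pt_rsum; intros j Hj.
  apply continuity_pt_mult; [now apply HC | now apply picard_continuous].
Qed.

Lemma picard_init n i : picard n i a = z0 i.
Proof.
  destruct n; simpl; [easy|].
  rewrite RInt_point; unfold zero; simpl; ring.
Qed.

Let M := K * rsum N (fun j => Rabs (z0 j)) * d.

Lemma D_center t s : D t -> Rabs (s - a) <= Rabs (t - a) -> D s.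
Proof. unfold D; lra. Qed.

(** The increment vanishes at [a], and its derivative is at most [N K] times the preceding bound;
    over a distance below [d] this gains the factor [N K d], at most one half. *)
Lemma picard_step n i t :
  (i < N)%nat -> D t ->
  Rabs (picard (S n) i t - picard n i t) <= M * (1 / 2) ^ n.
Proof.
  intros Hi; revert i t Hi; induction n as [|n IH]; intros i t Hi Ht.
  - assert (HK0 : 0 <= K)
      by (apply Rle_trans with (2 := HK i i t Hi Hi Ht), Rabs_pos).
    (* The zeroth iterate is constant, so the first difference is an increment of the first
       iterate. *)
    replace (picard 0 i t) with (picard 1 i a) by apply picard_init.
    assert (HS : 0 <= rsum N (fun j => Rabs (z0 j)))
      by (apply rsum_nonneg; intros; apply Rabs_pos).
    eapply Rle_trans.
    + apply (bounded_variation (picard 1 i)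
        (fun s => rsum N (fun j => C i j s * picard 0 j s))
        (K * rsum N (fun j => Rabs (z0 j)))).
      intros s Hs; pose proof (D_center t s Ht Hs) as Hs'.
      split; [now apply picard_derive|].
      apply (rsum_Rabs_mult N (fun j => C i j s)); intros; now apply HK.
    + unfold M; rewrite pow_O, Rmult_1_r.
      apply Rmult_le_compat_l; [now apply Rmult_le_pos | unfold D in Ht; lra].
  - assert (HK0 : 0 <= K)
      by (apply Rle_trans with (2 := HK i i t Hi Hi Ht), Rabs_pos).
    assert (HM : 0 <= M * (1 / 2) ^ n)
      by (eapply Rle_trans; [apply Rabs_pos | apply (IH i a Hi)];
          unfold D; rewrite Rminus_diag, Rabs_R0; lra).
    replace (picard (S (S n)) i t - picard (S n) i t) with
      ((picard (S (S n)) i t - picard (S n) i t)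
       - (picard (S (S n)) i a - picard (S n) i a))
      by (rewrite !picard_init; ring).
    eapply Rle_trans.
    + apply (bounded_variation
        (fun s => picard (S (S n)) i s - picard (S n) i s)
        (fun s => rsum N (fun j => C i j s * picard (S n) j s)
                  - rsum N (fun j => C i j s * picard n j s))
        (K * (INR N * (M * (1 / 2) ^ n)))).
      intros s Hs; pose proof (D_center t s Ht Hs) as Hs'.
      split.
      * apply (is_derive_minus (V := R_NormedModule)); now apply picard_derive.
      * rewrite <- rsum_minus.
        rewrite (rsum_ext _ _ (fun j => C i j s * (picard (S n) j s - picard n j s)))
          by (intros; ring).
        eapply Rle_trans; [apply rsum_Rabs_mult; intros; now apply HK|].
        apply Rmult_le_compat_l; [exact HK0|].
        rewrite <- rsum_const; apply rsum_le; intros j Hj; now apply IH.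
    + simpl pow.
      apply Rle_trans with (K * (INR N * (M * (1 / 2) ^ n)) * d).
      * apply Rmult_le_compat_l; [|unfold D in Ht; lra].
        apply Rmult_le_pos; [exact HK0|].
        apply Rmult_le_pos; [apply pos_INR | exact HM].
      * replace (K * (INR N * (M * (1 / 2) ^ n)) * d) with
          (INR N * K * d * (M * (1 / 2) ^ n)) by ring.
        replace (M * (1 / 2 * (1 / 2) ^ n)) with (1 / 2 * (M * (1 / 2) ^ n))
          by ring.
        now apply Rmult_le_compat_r.
Qed.

Lemma picard_tail n p i t :
  (i < N)%nat -> D t ->
  Rabs (picard (n + p) i t - picard n i t) <= 2 * Rabs M * (1 / 2) ^ n.
Proof.
  intros Hi Ht.
  (* The partial geometric sum, rather than its limit, is what induction on [p] preserves. [Rabs M]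
     appears because [K] carries no sign in this section. *)
  assert (H : Rabs (picard (n + p) i t - picard n i t)
              <= 2 * Rabs M * ((1 / 2) ^ n - (1 / 2) ^ (n + p))).
  { induction p as [|p IH].
    - rewrite Nat.add_0_r, Rminus_diag, Rabs_R0; lra.
    - replace (picard (n + S p) i t - picard n i t) with
        ((picard (S (n + p)) i t - picard (n + p) i t)
         + (picard (n + p) i t - picard n i t))
        by (rewrite Nat.add_succ_r; ring).
      eapply Rle_trans; [apply Rabs_triang|].
      pose proof (picard_step (n + p) i t Hi Ht) as Hs.
      assert (M * (1 / 2) ^ (n + p) <= Rabs M * (1 / 2) ^ (n + p))
        by (apply Rmult_le_compat_r; [apply pow_le; lra | apply Rle_abs]).
      rewrite Nat.add_succ_r; simpl pow; lra. }
  assert (0 <= Rabs M * (1 / 2) ^ (n + p))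
    by (apply Rmult_le_pos; [apply Rabs_pos | apply pow_le; lra]).
  lra.
Qed.

Lemma geometric_small c (eps : posreal) :
  exists n0, forall n, (n0 <= n)%nat -> Rabs c * (1 / 2) ^ n < eps.
Proof.
  assert (Hc : 0 < Rabs c + 1) by (pose proof (Rabs_pos c); lra).
  destruct (pow_lt_1_zero (1 / 2)) with (y := eps / (Rabs c + 1)) as [n0 Hn0].
  - rewrite Rabs_pos_eq; lra.
  - apply Rdiv_lt_0_compat; [apply cond_pos | exact Hc].
  - exists n0; intros n Hn; specialize (Hn0 n Hn).
    assert (Hp : 0 <= (1 / 2) ^ n) by (apply pow_le; lra).
    rewrite Rabs_pos_eq in Hn0 by exact Hp.
    apply Rle_lt_trans with ((Rabs c + 1) * (1 / 2) ^ n); [nra|].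
    apply (Rmult_lt_compat_l (Rabs c + 1)) in Hn0; [|exact Hc].
    replace ((Rabs c + 1) * (eps / (Rabs c + 1))) with (pos eps) in Hn0
      by (field; lra).
    exact Hn0.
Qed.

Lemma picard_cauchy i (eps : posreal) :
  (i < N)%nat -> exists n0, forall n m t, D t -> (n0 <= n)%nat -> (n0 <= m)%nat ->
  Rabs (picard n i t - picard m i t) < eps.
Proof.
  intros Hi; destruct (geometric_small (4 * Rabs M) eps) as [n0 Hn0].
  exists n0; intros n m t Ht Hn Hm.
  specialize (Hn0 n0 (le_n _)).
  rewrite Rabs_pos_eq in Hn0 by (pose proof (Rabs_pos M); lra).
  pose proof (picard_tail n0 (n - n0) i t Hi Ht) as H1.
  pose proof (picard_tail n0 (m - n0) i t Hi Ht) as H2.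
  replace (n0 + (n - n0))%nat with n in H1 by lia.
  replace (n0 + (m - n0))%nat with m in H2 by lia.
  replace (picard n i t - picard m i t) with
    ((picard n i t - picard n0 i t) - (picard m i t - picard n0 i t)) by ring.
  eapply Rle_lt_trans; [apply Rabs_triang|]; rewrite Rabs_Ropp; lra.
Qed.

Lemma ode_sol_lim i t :
  (i < N)%nat -> D t -> is_lim_seq (fun n => picard n i t) (ode_sol i t).
Proof.
  intros Hi Ht; unfold ode_sol.
  assert (H : ex_finite_lim_seq (fun n => picard n i t)).
  { apply ex_lim_seq_cauchy_corr; intros eps.
    destruct (picard_cauchy i eps Hi) as [n0 Hn0]; exists n0.
    intros n m Hn Hm; now apply Hn0. }
  destruct H as [l Hl].
  replace (Lim_seq (fun n => picard (S n) i t)) with (Finite l); [exact Hl|].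
  symmetry; apply is_lim_seq_unique.
  now apply (is_lim_seq_incr_1 (fun n => picard n i t)).
Qed.

Lemma ode_sol_init i : (i < N)%nat -> ode_sol i a = z0 i.
Proof.
  intros Hi; unfold ode_sol.
  rewrite (Lim_seq_ext _ (fun _ => z0 i)) by (intros; apply picard_init).
  now rewrite Lim_seq_const.
Qed.

(** Termwise differentiation: the geometric tail bound makes both the iterates and their derivatives
    converge uniformly. *)
Lemma ode_sol_derive i t :
  (i < N)%nat -> D t ->
  is_derive (ode_sol i) t (rsum N (fun j => C i j t * ode_sol j t)).
Proof.
  intros Hi Ht.
  assert (HDer : forall n s, D s -> Derive (picard (S n) i) s
                  = rsum N (fun j => C i j s * picard n j s))
    by (intros; apply is_derive_unique; now apply picard_derive).
  assert (HD : open D).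
  { intros s Hs; assert (Hp : 0 < d - Rabs (s - a)) by (unfold D in Hs; lra).
    exists (mkposreal _ Hp); intros u Hu.
    change (Rabs (u - s) < d - Rabs (s - a)) in Hu.
    unfold D; replace (u - a) with ((u - s) + (s - a)) by ring.
    eapply Rle_lt_trans; [apply Rabs_triang | lra]. }
  assert (HL : Lim_seq (fun n => Derive (picard (S n) i) t)
               = rsum N (fun j => C i j t * ode_sol j t)).
  { rewrite (Lim_seq_ext _ (fun n => rsum N (fun j => C i j t * picard n j t)))
      by (intros; now apply HDer).
    apply is_lim_seq_unique.
    apply (is_lim_seq_rsum N (fun j n => C i j t * picard n j t)).
    intros j Hj.
    apply (is_lim_seq_scal_l (fun n => picard n j t) (C i j t) (ode_sol j t)).
    now apply ode_sol_lim. }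
  replace (rsum N (fun j => C i j t * ode_sol j t))
    with (real (Lim_seq (fun n => Derive (picard (S n) i) t))) by now rewrite HL.
  apply (CVU_Derive (fun n => picard (S n) i) D); [exact HD | | | | | | exact Ht].
  - intros u v w Hu Hv Huvw; unfold D in *.
    apply Rabs_def2 in Hu; apply Rabs_def2 in Hv; apply Rabs_def1; lra.
  - apply CVU_dom_cauchy; intros eps.
    destruct (picard_cauchy i eps Hi) as [n0 Hn0]; exists n0.
    intros n m s Hs Hn Hm; apply Hn0; [exact Hs | lia | lia].
  - intros n s Hs; eexists; now apply picard_derive.
  - intros n s Hs.
    apply continuity_pt_ext_loc with
      (fun s => rsum N (fun j => C i j s * picard n j s)).
    + destruct (HD s Hs) as [e He]; exists e; intros u Hu.
      symmetry; apply HDer, He, Hu.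
    + apply continuity_pt_rsum; intros j Hj.
      apply continuity_pt_mult; [now apply HC | now apply picard_continuous].
  - apply CVU_dom_cauchy; intros eps.
    destruct (geometric_small (4 * K * INR N * Rabs M) eps) as [n0 Hn0].
    exists n0; intros n m s Hs Hn Hm.
    rewrite !HDer, <- rsum_minus by exact Hs.
    rewrite (rsum_ext _ _ (fun j => C i j s * (picard n j s - picard m j s)))
      by (intros; ring).
    assert (HK0 : 0 <= K)
      by (apply Rle_trans with (2 := HK i i t Hi Hi Ht), Rabs_pos).
    eapply Rle_lt_trans; [apply rsum_Rabs_mult; intros; now apply HK|].
    eapply Rle_lt_trans; [|apply (Hn0 n0 (le_n _))].
    assert (HP : 0 <= (1 / 2) ^ n0) by (apply pow_le; lra).
    assert (HX : 0 <= 4 * K * INR N * Rabs M).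
    { repeat apply Rmult_le_pos; try lra; [apply pos_INR | apply Rabs_pos]. }
    rewrite (Rabs_pos_eq _ HX).
    replace (4 * K * INR N * Rabs M * (1 / 2) ^ n0) with
      (K * (INR N * (4 * Rabs M * (1 / 2) ^ n0))) by ring.
    apply Rmult_le_compat_l; [exact HK0|].
    rewrite <- rsum_const; apply rsum_le; intros j Hj.
    pose proof (picard_tail n0 (n - n0) j s Hj Hs) as H1.
    pose proof (picard_tail n0 (m - n0) j s Hj Hs) as H2.
    replace (n0 + (n - n0))%nat with n in H1 by lia.
    replace (n0 + (m - n0))%nat with m in H2 by lia.
    replace (picard n j s - picard m j s) with
      ((picard n j s - picard n0 j s) - (picard m j s - picard n0 j s)) by ring.
    eapply Rle_trans; [apply Rabs_triang|]; rewrite Rabs_Ropp; lra.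
Qed.
End LinearODE.

(* Gronwall's inequality on an interval so short that the maximum of
   sum |D_i| absorbs the term it generates. *)
Lemma gronwall_short N (D D' : nat -> R -> R) a b K e e' :
  0 <= K -> 0 <= e ->
  INR N * K * Rabs (b - a) <= 1 / 2 ->
  (forall i t, (i < N)%nat -> Rabs (t - a) <= Rabs (b - a) ->
     is_derive (D i) t (D' i t) /\
     Rabs (D' i t) <= K * rsum N (fun j => Rabs (D j t)) + e) ->
  (forall i, (i < N)%nat -> Rabs (D i a) <= e') ->
  rsum N (fun i => Rabs (D i b)) <= 2 * INR N * (e' + Rabs (b - a) * e).
Proof.
  intros HK He HNK HD Ha.
  set (L := Rabs (b - a)) in *.
  assert (HL : 0 <= L) by apply Rabs_pos.
  set (f := fun t => rsum N (fun i => Rabs (D i t))).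
  destruct (continuity_ab_maj f (a - L) (a + L)) as (T & HT & HT1); [lra| |].
  { intros t Ht; apply continuity_pt_rsum; intros i Hi.
    apply (continuity_pt_comp (D i) Rabs); [|apply Rcontinuity_abs].
    eapply is_derive_continuity_pt; apply HD; [exact Hi|].
    apply Rabs_le; lra. }
  assert (HTL : Rabs (T - a) <= L) by (apply Rabs_le; lra).
  assert (Hf0 : forall t, 0 <= f t)
    by (intros; apply rsum_nonneg; intros; apply Rabs_pos).
  assert (Hi : forall i, (i < N)%nat ->
    Rabs (D i T) <= e' + L * (K * f T + e)).
  { intros i Hi.
    replace (D i T) with (D i a + (D i T - D i a)) by ring.
    eapply Rle_trans; [apply Rabs_triang|].
    apply Rplus_le_compat; [now apply Ha|].
    apply Rle_trans with ((K * f T + e) * Rabs (T - a)).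
    - apply (bounded_variation (D i) (D' i)); intros t Ht.
      assert (Ht' : Rabs (t - a) <= L) by lra.
      destruct (HD i t Hi Ht') as [H1 H2]; split; [exact H1|].
      eapply Rle_trans; [exact H2|].
      apply Rplus_le_compat_r, Rmult_le_compat_l; [exact HK|].
      apply Rabs_le_between in Ht'; apply HT; lra.
    - rewrite Rmult_comm; apply Rmult_le_compat_r; [|exact HTL].
      assert (0 <= K * f T) by (apply Rmult_le_pos; auto); lra. }
  assert (HfT : f T <= INR N * (e' + L * (K * f T + e)))
    by (rewrite <- rsum_const; apply rsum_le; exact Hi).
  assert (Hb : f b <= f T).
  { apply HT; assert (Rabs (b - a) <= L) by apply Rle_refl.
    apply Rabs_le_between in H; lra. }
  assert (HX : INR N * L * K * f T <= 1 / 2 * f T).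
  { apply Rmult_le_compat_r; [apply Hf0 | lra]. }
  change (f b <= 2 * INR N * (e' + L * e)); nra.
Qed.

(** This is how the y-derivative of the solution below is obtained: its existence is not known
    beforehand, but a remainder of second order can be estimated directly. *)
Lemma is_derive_quadratic (f : R -> R) x l C (d : posreal) :
  (forall h, Rabs h < d -> Rabs (f (x + h) - f x - h * l) <= C * (h * h)) ->
  is_derive f x l.
Proof.
  intros H; apply is_derive_Reals; intros eps Heps.
  assert (HC : 0 < Rabs C + 1) by (pose proof (Rabs_pos C); lra).
  assert (Hp : 0 < Rmin d (eps / (Rabs C + 1)))
    by (apply Rmin_pos; [apply cond_pos | now apply Rdiv_lt_0_compat]).
  exists (mkposreal _ Hp); intros h Hh0 Hh; simpl in Hh.
  specialize (H h (Rlt_le_trans _ _ _ Hh (Rmin_l _ _))).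
  assert (Hh2 : Rabs h < eps / (Rabs C + 1))
    by (eapply Rlt_le_trans; [exact Hh | apply Rmin_r]).
  pose proof (Rabs_pos_lt h Hh0) as Hpos.
  replace ((f (x + h) - f x) / h - l) with ((f (x + h) - f x - h * l) / h)
    by (field; exact Hh0).
  unfold Rdiv; rewrite Rabs_mult, Rabs_inv.
  apply (Rmult_lt_reg_r (Rabs h)); [exact Hpos|].
  rewrite Rmult_assoc, Rinv_l, Rmult_1_r by lra.
  eapply Rle_lt_trans; [exact H|].
  assert (HhE : h * h = Rabs h * Rabs h)
    by (rewrite <- Rabs_mult, Rabs_pos_eq; [easy | apply Rle_0_sqr]).
  apply (Rmult_lt_compat_l (Rabs C + 1)) in Hh2; [|exact HC].
  replace ((Rabs C + 1) * (eps / (Rabs C + 1))) with eps in Hh2 by (field; lra).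
  rewrite HhE; pose proof (Rle_abs C); nra.
Qed.

Lemma locally_2d_bounded (f : R -> R -> R) x y :
  continuity_2d_pt f x y ->
  exists K, locally_2d (fun u v => Rabs (f u v) <= K) x y.
Proof.
  intros H; destruct (H (mkposreal 1 Rlt_0_1)) as [d Hd].
  exists (Rabs (f x y) + 1), d; intros u v Hu Hv.
  specialize (Hd u v Hu Hv); simpl in Hd.
  replace (f u v) with (f x y + (f u v - f x y)) by ring.
  eapply Rle_trans; [apply Rabs_triang | lra].
Qed.

Lemma locally_2d_bounded_matrix (F : nat -> nat -> R -> R -> R) N x y :
  (forall i j, continuity_2d_pt (F i j) x y) ->
  exists K, locally_2d (fun u v => forall i j, (i < N)%nat -> (j < N)%nat ->
    Rabs (F i j u v) <= K) x y.
Proof.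
  intros H.
  assert (Hrow : forall i n, exists K, locally_2d (fun u v => forall j,
            (j < n)%nat -> Rabs (F i j u v) <= K) x y).
  { intros i n; induction n as [|n [K HK]].
    - exists 0; apply locally_2d_forall; intros; lia.
    - destruct (locally_2d_bounded (F i n) x y (H i n)) as [K' HK'].
      exists (Rmax K K').
      eapply locally_2d_impl; [|exact (locally_2d_and _ _ _ _ HK HK')].
      apply locally_2d_forall; intros u v [H1 H2] j Hj.
      destruct (Nat.eq_dec j n) as [->|].
      + eapply Rle_trans; [exact H2 | apply Rmax_r].
      + eapply Rle_trans; [apply H1; lia | apply Rmax_l]. }
  enough (Hall : forall n, exists K, locally_2d (fun u v => forall i j,
            (i < n)%nat -> (j < N)%nat -> Rabs (F i j u v) <= K) x y)
    by (destruct (Hall N) as [K HK]; now exists K).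
  induction n as [|n [K HK]].
  - exists 0; apply locally_2d_forall; intros; lia.
  - destruct (Hrow n N) as [K' HK'].
    exists (Rmax K K').
    eapply locally_2d_impl; [|exact (locally_2d_and _ _ _ _ HK HK')].
    apply locally_2d_forall; intros u v [H1 H2] i j Hi Hj.
    destruct (Nat.eq_dec i n) as [->|].
    + eapply Rle_trans; [now apply H2 | apply Rmax_r].
    + eapply Rle_trans; [apply H1; [lia | exact Hj] | apply Rmax_l].
Qed.

(** * Flat linear systems in two variables *)

Section Frobenius.
Variables (V : R -> R -> Prop) (x0 y0 : R) (N : nat).
Variables (A B : nat -> nat -> R -> R -> R) (z0 : nat -> R).
Hypothesis HV : open2 V.
Hypothesis HA : forall i j, smooth_on V (A i j).
Hypothesis HB : forall i j, smooth_on V (B i j).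
Hypothesis Hflat : forall i j x y, (i < N)%nat -> (j < N)%nat -> V x y ->
  dY (A i j) x y + rsum N (fun k => A i k x y * B k j x y)
  = dX (B i j) x y + rsum N (fun k => B i k x y * A k j x y).

(** Initial values are carried along the vertical line through [x0] by [B], then along horizontal
    lines by [A]. The x-equation holds by construction; the y-equation is known on that line only,
    and flatness has to propagate it. *)
Definition frob_axis (i : nat) (y : R) : R :=
  ode_sol N (fun i j s => B i j x0 s) y0 z0 i y.
Definition frob_sol (i : nat) (x y : R) : R :=
  ode_sol N (fun i j s => A i j s y) x0 (fun k => frob_axis k y) i x.

Variables (d K : R).
Hypothesis Hd : 0 < d.
Hypothesis HK0 : 0 <= K.
Let W (x y : R) := Rabs (x - x0) < d /\ Rabs (y - y0) < d.
Hypothesis HWV : forall x y, W x y -> V x y.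
Hypothesis HNK : INR N * K * d <= 1 / 2.
Hypothesis bdA : forall i j x y, (i < N)%nat -> (j < N)%nat -> W x y ->
  Rabs (A i j x y) <= K.
Hypothesis bdB : forall i j x y, (i < N)%nat -> (j < N)%nat -> W x y ->
  Rabs (B i j x y) <= K.
Hypothesis bdAy : forall i j x y, (i < N)%nat -> (j < N)%nat -> W x y ->
  Rabs (dY (A i j) x y) <= K.
Hypothesis bdAyy : forall i j x y, (i < N)%nat -> (j < N)%nat -> W x y ->
  Rabs (dY (dY (A i j)) x y) <= K.
Hypothesis bdBy : forall i j x y, (i < N)%nat -> (j < N)%nat -> W x y ->
  Rabs (dY (B i j) x y) <= K.

Let Z := frob_sol.
Let Z0 := frob_axis.

Lemma W_axis y : Rabs (y - y0) < d -> W x0 y.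
Proof. intros Hy; split; [rewrite Rminus_diag, Rabs_R0|]; assumption. Qed.

Lemma axis_derive i y :
  (i < N)%nat -> Rabs (y - y0) < d ->
  is_derive (Z0 i) y (rsum N (fun j => B i j x0 y * Z0 j y)).
Proof.
  intros Hi Hy.
  apply (ode_sol_derive N (fun i j s => B i j x0 s) y0 z0 d K); trivial.
  - intros k j t Hk Hj Ht; eapply is_derive_continuity_pt.
    apply (is_derive_dY V (B k j)); [apply HB | now apply HWV, W_axis].
  - intros; apply bdB; trivial; now apply W_axis.
Qed.

Lemma sol_derive_x i x y :
  (i < N)%nat -> W x y ->
  is_derive (fun s => Z i s y) x (rsum N (fun j => A i j x y * Z j x y)).
Proof.
  intros Hi [Hx Hy].
  apply (ode_sol_derive N (fun i j s => A i j s y) x0 (fun k => Z0 k y) d K);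
    trivial.
  - intros k j t Hk Hj Ht; eapply is_derive_continuity_pt.
    apply (is_derive_dX V (A k j)); [apply HA | apply HWV; now split].
  - intros; apply bdA; trivial; now split.
Qed.

Lemma sol_axis i y : (i < N)%nat -> Rabs (y - y0) < d -> Z i x0 y = Z0 i y.
Proof.
  intros Hi Hy.
  apply (ode_sol_init N (fun i j s => A i j s y) x0 (fun k => Z0 k y)); trivial.
Qed.

Lemma segment_W x y s : W x y -> Rabs (s - x0) <= Rabs (x - x0) -> W s y.
Proof. intros [Hx Hy] Hs; split; lra. Qed.

Lemma short_x x y : W x y -> INR N * K * Rabs (x - x0) <= 1 / 2.
Proof.
  intros [Hx _]; eapply Rle_trans; [|apply HNK].
  apply Rmult_le_compat_l; [|lra].
  apply Rmult_le_pos; [apply pos_INR | exact HK0].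
Qed.

Let M0 := 2 * INR N * rsum N (fun i => Rabs (z0 i)).
Let M := 2 * INR N * M0.

Lemma M0_nonneg : 0 <= M0.
Proof.
  unfold M0; repeat apply Rmult_le_pos; try lra; [apply pos_INR|].
  apply rsum_nonneg; intros; apply Rabs_pos.
Qed.

Lemma axis_bound y : Rabs (y - y0) < d -> rsum N (fun i => Rabs (Z0 i y)) <= M0.
Proof.
  intros Hy; eapply Rle_trans.
  - apply (gronwall_short N Z0 (fun i t => rsum N (fun j => B i j x0 t * Z0 j t))
             y0 y K 0 (rsum N (fun i => Rabs (z0 i)))); trivial; try lra.
    + eapply Rle_trans; [|apply HNK].
      apply Rmult_le_compat_l; [|lra].
      apply Rmult_le_pos; [apply pos_INR | exact HK0].
    + intros i t Hi Ht; assert (Ht' : Rabs (t - y0) < d) by lra.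
      split; [now apply axis_derive|]; rewrite Rplus_0_r.
      apply (rsum_Rabs_mult N (fun j => B i j x0 t)); intros.
      apply bdB; trivial; now apply W_axis.
    + intros i Hi; unfold Z0, frob_axis; rewrite ode_sol_init by exact Hi.
      apply (rsum_term N (fun i => Rabs (z0 i))); [|exact Hi].
      intros; apply Rabs_pos.
  - unfold M0; lra.
Qed.

Lemma sol_bound x y : W x y -> rsum N (fun i => Rabs (Z i x y)) <= M.
Proof.
  intros Hxy; pose proof Hxy as [Hx Hy]; eapply Rle_trans.
  - apply (gronwall_short N (fun i t => Z i t y)
             (fun i t => rsum N (fun j => A i j t y * Z j t y)) x0 x K 0 M0);
      trivial; try lra.
    + now apply short_x with y.
    + intros i t Hi Ht; pose proof (segment_W x y t Hxy Ht) as Hty.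
      split; [now apply sol_derive_x|]; rewrite Rplus_0_r.
      apply (rsum_Rabs_mult N (fun j => A i j t y)); intros; now apply bdA.
    + intros i Hi; rewrite sol_axis by trivial.
      eapply Rle_trans; [|now apply (axis_bound y)].
      apply (rsum_term N (fun i => Rabs (Z0 i y))); [|exact Hi].
      intros; apply Rabs_pos.
  - unfold M; lra.
Qed.

Lemma between_disc y y1 s :
  Rabs (y - y0) < d -> Rabs (y1 - y0) < d -> Rmin y y1 <= s <= Rmax y y1 ->
  Rabs (s - y0) < d.
Proof.
  intros H1 H2 Hs; apply Rabs_def2 in H1; apply Rabs_def2 in H2.
  unfold Rmin, Rmax in Hs; destruct (Rle_dec y y1); apply Rabs_def1; lra.
Qed.

(* Mean value inequality between two points of an interval, without the
   symmetric neighbourhood that [bounded_variation] asks for. *)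
Lemma mean_value_le (f df : R -> R) (D a b : R) :
  (forall t, Rmin a b <= t <= Rmax a b ->
     is_derive f t (df t) /\ Rabs (df t) <= D) ->
  Rabs (f b - f a) <= D * Rabs (b - a).
Proof.
  intros H; destruct (MVT_gen f a b df) as (c & Hc & E).
  - intros t Ht; apply H; lra.
  - intros t Ht; eapply is_derive_continuity_pt; now apply H.
  - rewrite E, Rabs_mult; apply Rmult_le_compat_r; [apply Rabs_pos|].
    now apply H.
Qed.

Lemma axis_lipschitz i y y1 :
  (i < N)%nat -> Rabs (y - y0) < d -> Rabs (y1 - y0) < d ->
  Rabs (Z0 i y1 - Z0 i y) <= K * M0 * Rabs (y1 - y).
Proof.
  intros Hi H0 H1.
  apply (mean_value_le (Z0 i) (fun t => rsum N (fun j => B i j x0 t * Z0 j t))).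
  intros t Ht; assert (Htd : Rabs (t - y0) < d) by now apply between_disc with y y1.
  split; [now apply axis_derive|].
  eapply Rle_trans.
  - apply (rsum_Rabs_mult N (fun j => B i j x0 t) (fun j => Z0 j t) K).
    intros; apply bdB; trivial; now apply W_axis.
  - apply Rmult_le_compat_l; [exact HK0 | now apply axis_bound].
Qed.

Lemma entry_lipschitz (F : nat -> nat -> R -> R -> R) i j x y y1 :
  (forall i j, smooth_on V (F i j)) ->
  (forall x y, W x y -> Rabs (dY (F i j) x y) <= K) ->
  W x y -> W x y1 -> Rabs (F i j x y1 - F i j x y) <= K * Rabs (y1 - y).
Proof.
  intros HF Hb [Hx H0] [_ H1].
  apply (mean_value_le (F i j x) (dY (F i j) x)).
  intros t Ht.
  assert (Hxt : W x t) by (split; [exact Hx | now apply between_disc with y y1]).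
  split; [|now apply Hb].
  apply (is_derive_dY V (F i j)); [apply HF | now apply HWV].
Qed.

Lemma entry_quadratic i j x y y1 :
  (i < N)%nat -> (j < N)%nat -> W x y -> W x y1 ->
  Rabs (A i j x y1 - A i j x y - (y1 - y) * dY (A i j) x y)
  <= K * ((y1 - y) * (y1 - y)).
Proof.
  intros Hi Hj H0 H1.
  replace (A i j x y1 - A i j x y - (y1 - y) * dY (A i j) x y) with
    ((A i j x y1 - y1 * dY (A i j) x y) - (A i j x y - y * dY (A i j) x y))
    by ring.
  replace (K * ((y1 - y) * (y1 - y))) with ((K * Rabs (y1 - y)) * Rabs (y1 - y)).
  2: { rewrite Rmult_assoc, <- Rabs_mult, (Rabs_pos_eq ((y1 - y) * (y1 - y)));
         [easy | apply Rle_0_sqr]. }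
  apply (mean_value_le (fun t => A i j x t - t * dY (A i j) x y)
           (fun t => dY (A i j) x t - dY (A i j) x y)).
  intros t Ht; destruct H0 as [Hx Hy], H1 as [_ Hy1].
  assert (Hxt : W x t) by (split; [exact Hx | now apply between_disc with y y1]).
  split.
  - apply (is_derive_minus (V := R_NormedModule) (A i j x)
             (fun t => t * dY (A i j) x y)).
    + apply (is_derive_dY V (A i j)); [apply HA | now apply HWV].
    + auto_derive; [easy | ring].
  - eapply Rle_trans.
    + apply (entry_lipschitz (fun i j => dY (A i j)) i j x y t).
      * intros; now apply smooth_on_dY.
      * intros; now apply bdAyy.
      * now split.
      * exact Hxt.
    + apply Rmult_le_compat_l; [exact HK0|].
      unfold Rmin, Rmax in Ht; unfold Rabs.
      destruct (Rle_dec y y1), (Rcase_abs (t - y)), (Rcase_abs (y1 - y)); lra.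
Qed.

Let L := 2 * INR N * (K * M0 + d * (K * M)).

Lemma M_nonneg : 0 <= M.
Proof.
  apply Rmult_le_pos; [pose proof (pos_INR N); lra | apply M0_nonneg].
Qed.

Lemma L_nonneg : 0 <= L.
Proof.
  pose proof M0_nonneg; pose proof M_nonneg.
  apply Rmult_le_pos; [pose proof (pos_INR N); lra|].
  apply Rplus_le_le_0_compat; [now apply Rmult_le_pos|].
  apply Rmult_le_pos; [lra | now apply Rmult_le_pos].
Qed.

(** Gronwall for the difference of the solutions on two horizontal lines: it starts from the
    difference on the axis and is driven by the variation of [A] in y. *)
Lemma sol_lipschitz x y y1 :
  W x y -> W x y1 ->
  rsum N (fun i => Rabs (Z i x y1 - Z i x y)) <= L * Rabs (y1 - y).
Proof.
  intros H0 H1; set (h := Rabs (y1 - y)).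
  assert (Hh : 0 <= h) by apply Rabs_pos.
  pose proof M_nonneg; pose proof M0_nonneg.
  eapply Rle_trans.
  - apply (gronwall_short N (fun i t => Z i t y1 - Z i t y)
      (fun i t => rsum N (fun j => A i j t y1 * Z j t y1)
                  - rsum N (fun j => A i j t y * Z j t y))
      x0 x K (K * h * M) (K * M0 * h)); trivial.
    + apply Rmult_le_pos; [now apply Rmult_le_pos | easy].
    + now apply short_x with y.
    + intros i t Hi Ht.
      pose proof (segment_W x y t H0 Ht) as Ht0.
      pose proof (segment_W x y1 t H1 Ht) as Ht1.
      split.
      * apply (is_derive_minus (V := R_NormedModule)); now apply sol_derive_x.
      * rewrite <- rsum_minus.
        rewrite (rsum_ext _ _ (fun j => A i j t y1 * (Z j t y1 - Z j t y)
          + (A i j t y1 - A i j t y) * Z j t y)) by (intros; ring).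
        rewrite rsum_plus.
        eapply Rle_trans; [apply Rabs_triang|]; apply Rplus_le_compat.
        -- apply (rsum_Rabs_mult N (fun j => A i j t y1)); intros; now apply bdA.
        -- eapply Rle_trans.
           ++ apply (rsum_Rabs_mult N (fun j => A i j t y1 - A i j t y)
                       (fun j => Z j t y) (K * h)).
              intros; apply entry_lipschitz; trivial; intros; now apply bdAy.
           ++ apply Rmult_le_compat_l; [now apply Rmult_le_pos|].
              now apply sol_bound.
    + intros i Hi; rewrite !sol_axis by (trivial; apply H0 || apply H1).
      apply axis_lipschitz; [exact Hi | apply H0 | apply H1].
  - assert (Hx : Rabs (x - x0) <= d) by (destruct H0; lra).
    unfold L.
    replace (2 * INR N * (K * M0 + d * (K * M)) * h) with
      (2 * INR N * (K * M0 * h + d * (K * h * M))) by ring.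
    apply Rmult_le_compat_l; [pose proof (pos_INR N); lra|].
    apply Rplus_le_compat_l, Rmult_le_compat_r; [|exact Hx].
    apply Rmult_le_pos; [now apply Rmult_le_pos | easy].
Qed.

(** Supplies the initial value at [x0] for the Gronwall estimate of the defect. The remainder is
    uniform because [B] and the axis solution are Lipschitz. *)
Lemma axis_quadratic i y y1 :
  (i < N)%nat -> Rabs (y - y0) < d -> Rabs (y1 - y0) < d ->
  Rabs (Z0 i y1 - Z0 i y - (y1 - y) * rsum N (fun j => B i j x0 y * Z0 j y))
  <= (K * M0 + K * (INR N * (K * M0))) * ((y1 - y) * (y1 - y)).
Proof.
  intros Hi H0 H1.
  set (l := rsum N (fun j => B i j x0 y * Z0 j y)).
  set (c := K * M0 + K * (INR N * (K * M0))).
  pose proof M0_nonneg as HM0.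
  assert (Hc : 0 <= c).
  { unfold c; apply Rplus_le_le_0_compat; [now apply Rmult_le_pos|].
    apply Rmult_le_pos; [exact HK0|].
    apply Rmult_le_pos; [apply pos_INR | now apply Rmult_le_pos]. }
  replace (Z0 i y1 - Z0 i y - (y1 - y) * l) with
    ((Z0 i y1 - y1 * l) - (Z0 i y - y * l)) by ring.
  replace (c * ((y1 - y) * (y1 - y))) with ((c * Rabs (y1 - y)) * Rabs (y1 - y)).
  2: { rewrite Rmult_assoc, <- Rabs_mult, (Rabs_pos_eq ((y1 - y) * (y1 - y)));
         [easy | apply Rle_0_sqr]. }
  apply (mean_value_le (fun t => Z0 i t - t * l)
           (fun t => rsum N (fun j => B i j x0 t * Z0 j t) - l)).
  intros t Ht; assert (Htd : Rabs (t - y0) < d) by now apply between_disc with y y1.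
  split.
  - apply (is_derive_minus (V := R_NormedModule) (Z0 i) (fun t => t * l)).
    + now apply axis_derive.
    + auto_derive; [easy | ring].
  - unfold l; rewrite <- rsum_minus.
    rewrite (rsum_ext _ _ (fun j => (B i j x0 t - B i j x0 y) * Z0 j t
      + B i j x0 y * (Z0 j t - Z0 j y))) by (intros; ring).
    rewrite rsum_plus.
    apply Rle_trans with (c * Rabs (t - y)).
    + eapply Rle_trans; [apply Rabs_triang|].
      unfold c; rewrite Rmult_plus_distr_r; apply Rplus_le_compat.
      * eapply Rle_trans.
        -- apply (rsum_Rabs_mult N (fun j => B i j x0 t - B i j x0 y)
                    (fun j => Z0 j t) (K * Rabs (t - y))).
           intros; apply entry_lipschitz; trivial;
             [intros; now apply bdBy | now apply W_axis | now apply W_axis].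
        -- replace (K * M0 * Rabs (t - y)) with (K * Rabs (t - y) * M0) by ring.
           apply Rmult_le_compat_l; [|now apply axis_bound].
           apply Rmult_le_pos; [exact HK0 | apply Rabs_pos].
      * eapply Rle_trans.
        -- apply (rsum_Rabs_mult N (fun j => B i j x0 y)
                    (fun j => Z0 j t - Z0 j y) K).
           intros; apply bdB; trivial; now apply W_axis.
        -- rewrite !Rmult_assoc; apply Rmult_le_compat_l; [exact HK0|].
           rewrite <- rsum_const; apply rsum_le; intros j Hj.
           rewrite <- Rmult_assoc; now apply axis_lipschitz.
    + apply Rmult_le_compat_l; [exact Hc|].
      unfold Rmin, Rmax in Ht; unfold Rabs.
      destruct (Rle_dec y y1), (Rcase_abs (t - y)), (Rcase_abs (y1 - y)); lra.
Qed.

(* The defect Z(x,y1) - Z(x,y) - (y1-y) B Z is O((y1-y)^2): flatness makes it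
   satisfy the x-equation up to a quadratic error. *)
Lemma sol_quadratic : exists C, forall x y y1, W x y -> W x y1 ->
  rsum N (fun i => Rabs (Z i x y1 - Z i x y
    - (y1 - y) * rsum N (fun j => B i j x y * Z j x y)))
  <= C * ((y1 - y) * (y1 - y)).
Proof.
  set (c := K * M0 + K * (INR N * (K * M0))).
  pose proof M0_nonneg as HM0; pose proof M_nonneg as HM; pose proof L_nonneg as HL.
  exists (2 * INR N * (c + d * (K * M + K * L))); intros x y y1 H0 H1.
  set (h := y1 - y).
  assert (Hhh : 0 <= h * h) by apply Rle_0_sqr.
  assert (HKM : 0 <= K * M) by (apply Rmult_le_pos; lra).
  assert (HKL : 0 <= K * L) by (apply Rmult_le_pos; lra).
  eapply Rle_trans.
  - apply (gronwall_short N
      (fun i t => Z i t y1 - Z i t y - h * rsum N (fun j => B i j t y * Z j t y))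
      (fun i t => rsum N (fun j => A i j t y1 * Z j t y1)
         - rsum N (fun j => A i j t y * Z j t y)
         - h * rsum N (fun j => dX (B i j) t y * Z j t y
               + B i j t y * rsum N (fun k => A j k t y * Z k t y)))
      x0 x K ((K * M + K * L) * (h * h)) (c * (h * h))); trivial.
    + apply Rmult_le_pos; lra.
    + now apply short_x with y.
    + intros i t Hi Ht.
      pose proof (segment_W x y t H0 Ht) as Ht0.
      pose proof (segment_W x y1 t H1 Ht) as Ht1.
      split.
      * apply (is_derive_minus (V := R_NormedModule)
                 (fun t => Z i t y1 - Z i t y)).
        -- apply (is_derive_minus (V := R_NormedModule)); now apply sol_derive_x.
        -- apply (is_derive_scal (fun t => rsum N (fun j => B i j t y * Z j t y))).
           apply (is_derive_rsum N (fun j t => B i j t y * Z j t y)).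
           intros j Hj.
           apply (is_derive_mult (fun t => B i j t y) (fun t => Z j t y)).
           ++ apply (is_derive_dX V (B i j)); [apply HB | now apply HWV].
           ++ now apply sol_derive_x.
           ++ intros; apply Rmult_comm.
      (* Flatness enters here: the x-derivative of [B Z] becomes [A_y Z + A B Z]. Each term of the
         derivative of the defect is then [A] times the defect or of second order in [h]. *)
      * assert (E : rsum N (fun j => dX (B i j) t y * Z j t y
               + B i j t y * rsum N (fun k => A j k t y * Z k t y))
             = rsum N (fun j => dY (A i j) t y * Z j t y
               + A i j t y * rsum N (fun k => B j k t y * Z k t y))).
        { rewrite !rsum_plus.
          assert (Hx : forall F G : nat -> nat -> R -> R -> R,
            rsum N (fun j => F i j t y * rsum N (fun k => G j k t y * Z k t y))
            = rsum N (fun k => rsum N (fun j => F i j t y * G j k t y) * Z k t y)).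
          { intros F G.
            rewrite (rsum_ext _ _ (fun j => rsum N (fun k =>
              F i j t y * G j k t y * Z k t y))).
            - rewrite rsum_exchange; apply rsum_ext; intros k Hk.
              rewrite (Rmult_comm (rsum _ _)), <- rsum_scal.
              apply rsum_ext; intros; ring.
            - intros j Hj; rewrite <- rsum_scal; apply rsum_ext; intros; ring. }
          rewrite !Hx, <- !rsum_plus; apply rsum_ext; intros j Hj.
          rewrite <- !Rmult_plus_distr_r; f_equal.
          symmetry; apply Hflat; trivial; now apply HWV. }
        rewrite E, <- rsum_scal, <- !rsum_minus.
        rewrite (rsum_ext _ _ (fun j =>
          A i j t y * (Z j t y1 - Z j t y - h * rsum N (fun k => B j k t y * Z k t y))
          + ((A i j t y1 - A i j t y - h * dY (A i j) t y) * Z j t y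
             + (A i j t y1 - A i j t y) * (Z j t y1 - Z j t y))))
          by (intros; ring).
        rewrite !rsum_plus.
        eapply Rle_trans; [apply Rabs_triang|]; apply Rplus_le_compat.
        { apply (rsum_Rabs_mult N (fun j => A i j t y)); intros; now apply bdA. }
        eapply Rle_trans; [apply Rabs_triang|].
        rewrite Rmult_plus_distr_r; apply Rplus_le_compat.
        -- eapply Rle_trans.
           ++ apply (rsum_Rabs_mult N
                (fun j => A i j t y1 - A i j t y - h * dY (A i j) t y)
                (fun j => Z j t y) (K * (h * h))).
              intros; now apply entry_quadratic.
           ++ replace (K * M * (h * h)) with (K * (h * h) * M) by ring.
              apply Rmult_le_compat_l; [now apply Rmult_le_pos|].
              now apply sol_bound.
        -- eapply Rle_trans.
           ++ apply (rsum_Rabs_mult N (fun j => A i j t y1 - A i j t y)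
                (fun j => Z j t y1 - Z j t y) (K * Rabs h)).
              intros; apply entry_lipschitz; trivial; intros; now apply bdAy.
           ++ replace (K * L * (h * h)) with (K * Rabs h * (L * Rabs h)).
              ** apply Rmult_le_compat_l;
                   [apply Rmult_le_pos; [easy | apply Rabs_pos]|].
                 now apply sol_lipschitz.
              ** transitivity (K * L * (Rabs h * Rabs h)); [ring|].
                 now rewrite <- Rabs_mult, (Rabs_pos_eq (h * h)).
    + intros i Hi.
      rewrite (rsum_ext _ _ (fun j => B i j x0 y * Z0 j y))
        by (intros; rewrite sol_axis by (trivial; apply H0); easy).
      rewrite !sol_axis by (trivial; apply H0 || apply H1).
      apply axis_quadratic; [exact Hi | apply H0 | apply H1].
  - assert (Hx : Rabs (x - x0) <= d) by (destruct H0; lra).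
    replace (2 * INR N * (c + d * (K * M + K * L)) * (h * h)) with
      (2 * INR N * (c * (h * h) + d * ((K * M + K * L) * (h * h)))) by ring.
    apply Rmult_le_compat_l; [pose proof (pos_INR N); lra|].
    apply Rplus_le_compat_l, Rmult_le_compat_r; [|exact Hx].
    apply Rmult_le_pos; lra.
Qed.

Lemma W_open : open2 W.
Proof.
  apply locally_2d_open2; intros x y [Hx Hy]; apply locally_2d_and;
    [now apply (disc_locally_2d true) | now apply (disc_locally_2d false)].
Qed.

Lemma sol_derive_y i x y :
  (i < N)%nat -> W x y ->
  is_derive (Z i x) y (rsum N (fun j => B i j x y * Z j x y)).
Proof.
  intros Hi Hxy; destruct sol_quadratic as [C HC].
  destruct (open2_locally W x y W_open Hxy) as [e He].
  apply is_derive_quadratic with C e; intros h Hh.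
  assert (H1 : W x (y + h)).
  { apply He; [rewrite Rminus_diag, Rabs_R0; apply cond_pos|].
    replace (y + h - y) with h by ring; exact Hh. }
  specialize (HC x y (y + h) Hxy H1).
  replace (y + h - y) with h in HC by ring.
  eapply Rle_trans; [|exact HC].
  apply (rsum_term N (fun i => Rabs (Z i x (y + h) - Z i x y
    - h * rsum N (fun j => B i j x y * Z j x y)))); [|exact Hi].
  intros; apply Rabs_pos.
Qed.

Lemma sol_continuous i x y : (i < N)%nat -> W x y -> continuity_2d_pt (Z i) x y.
Proof.
  intros Hi Hxy eps.
  destruct (open2_locally W x y W_open Hxy) as [e He].
  assert (Hc : continuity_pt (fun s => Z i s y) x)
    by (eapply is_derive_continuity_pt; now apply sol_derive_x).
  destruct (Hc (eps / 2)) as (a & Ha & Hxa); [apply is_pos_div_2|].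
  pose proof L_nonneg as HL.
  assert (Hb : 0 < eps / 2 / (L + 1))
    by (apply Rdiv_lt_0_compat; [apply is_pos_div_2 | lra]).
  assert (Hp : 0 < Rmin e (Rmin a (eps / 2 / (L + 1))))
    by (repeat apply Rmin_pos; trivial; apply cond_pos).
  exists (mkposreal _ Hp); intros u v Hu Hv; simpl in Hu, Hv.
  assert (Hue : Rabs (u - x) < e) by (eapply Rlt_le_trans; [exact Hu | apply Rmin_l]).
  assert (Hve : Rabs (v - y) < e) by (eapply Rlt_le_trans; [exact Hv | apply Rmin_l]).
  assert (Hua : Rabs (u - x) < a).
  { eapply Rlt_le_trans; [exact Hu|].
    eapply Rle_trans; [apply Rmin_r | apply Rmin_l]. }
  assert (Hvb : Rabs (v - y) < eps / 2 / (L + 1)).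
  { eapply Rlt_le_trans; [exact Hv|].
    eapply Rle_trans; [apply Rmin_r | apply Rmin_r]. }
  assert (Huv : W u v) by now apply He.
  assert (Huy : W u y)
    by (apply He; [exact Hue | rewrite Rminus_diag, Rabs_R0; apply cond_pos]).
  replace (Z i u v - Z i x y) with ((Z i u v - Z i u y) + (Z i u y - Z i x y))
    by ring.
  eapply Rle_lt_trans; [apply Rabs_triang|].
  assert (H1 : Rabs (Z i u v - Z i u y) <= L * Rabs (v - y)).
  { eapply Rle_trans; [|now apply (sol_lipschitz u y v)].
    apply (rsum_term N (fun i => Rabs (Z i u v - Z i u y))); [|exact Hi].
    intros; apply Rabs_pos. }
  assert (H2 : Rabs (Z i u y - Z i x y) < eps / 2).
  { destruct (Req_dec u x) as [->|Hne].
    - rewrite Rminus_diag, Rabs_R0; apply is_pos_div_2.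
    - apply (Hxa u); split; [split; [exact I | auto] | exact Hua]. }
  assert (H3 : L * Rabs (v - y) <= (L + 1) * Rabs (v - y))
    by (pose proof (Rabs_pos (v - y)); lra).
  apply (Rmult_lt_compat_l (L + 1)) in Hvb; [|lra].
  replace ((L + 1) * (eps / 2 / (L + 1))) with (eps / 2) in Hvb by (field; lra).
  lra.
Qed.

Lemma sol_dX i x y :
  (i < N)%nat -> W x y -> dX (Z i) x y = rsum N (fun j => A i j x y * Z j x y).
Proof. intros; apply is_derive_unique; now apply sol_derive_x. Qed.

Lemma sol_dY i x y :
  (i < N)%nat -> W x y -> dY (Z i) x y = rsum N (fun j => B i j x y * Z j x y).
Proof. intros; apply is_derive_unique; now apply sol_derive_y. Qed.

Lemma smooth_upto_rsum n k (f : nat -> R -> R -> R) :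
  (forall i, (i < k)%nat -> smooth_upto n W (f i)) ->
  smooth_upto n W (fun x y => rsum k (fun i => f i x y)).
Proof.
  intros H; induction k as [|k IH]; simpl.
  - apply smooth_upto_const, W_open.
  - apply (smooth_upto_plus W W_open n (fun x y => rsum k (fun i => f i x y)));
      [apply IH; intros; apply H; lia | apply H; lia].
Qed.

(** Bootstrapping: the derivatives [A Z] and [B Z] are as smooth as [Z], so each order yields the
    next. *)
Lemma sol_smooth i : (i < N)%nat -> smooth_on W (Z i).
Proof.
  intros Hi; apply smooth_on_upto; intros n; revert i Hi.
  induction n as [|n IH]; intros i Hi;
    (assert (HC : forall x y, W x y -> C1_at (Z i) x y);
     [ intros x y Hxy; split; [|split];
       [ eexists; now apply sol_derive_x | eexists; now apply sol_derive_y
       | now apply sol_continuous ] |]); (split; [exact HC|]); [exact I|].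
  split.
  - apply (smooth_upto_ext W W_open) with
      (fun x y => rsum N (fun j => A i j x y * Z j x y)).
    { intros; symmetry; now apply sol_dX. }
    apply (smooth_upto_rsum n N (fun j x y => A i j x y * Z j x y)).
    intros j Hj; apply (smooth_upto_mult W W_open); [|now apply IH].
    apply smooth_on_upto; now apply smooth_on_sub with V.
  - apply (smooth_upto_ext W W_open) with
      (fun x y => rsum N (fun j => B i j x y * Z j x y)).
    { intros; symmetry; now apply sol_dY. }
    apply (smooth_upto_rsum n N (fun j x y => B i j x y * Z j x y)).
    intros j Hj; apply (smooth_upto_mult W W_open); [|now apply IH].
    apply smooth_on_upto; now apply smooth_on_sub with V.
Qed.

Lemma sol_start i : (i < N)%nat -> Z i x0 y0 = z0 i.
Proof.
  intros Hi.
  rewrite sol_axis by (trivial; rewrite Rminus_diag, Rabs_R0; exact Hd).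
  now apply (ode_sol_init N (fun i j s => B i j x0 s)).
Qed.
End Frobenius.

(** The last hypothesis is the equality of mixed derivatives for [Z_x = A Z], [Z_y = B Z]. By
    linearity the size of [W] depends on the coefficients and not on [z0]. *)
Theorem frobenius_linear V x0 y0 N (A B : nat -> nat -> R -> R -> R) z0 :
  open2 V -> V x0 y0 ->
  (forall i j, smooth_on V (A i j)) -> (forall i j, smooth_on V (B i j)) ->
  (forall i j x y, (i < N)%nat -> (j < N)%nat -> V x y ->
     dY (A i j) x y + rsum N (fun k => A i k x y * B k j x y)
     = dX (B i j) x y + rsum N (fun k => B i k x y * A k j x y)) ->
  exists (W : R -> R -> Prop) (Z : nat -> R -> R -> R),
    open2 W /\ W x0 y0 /\ (forall x y, W x y -> V x y) /\
    forall i, (i < N)%nat ->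
      smooth_on W (Z i) /\ Z i x0 y0 = z0 i /\
      forall x y, W x y ->
        dX (Z i) x y = rsum N (fun j => A i j x y * Z j x y) /\
        dY (Z i) x y = rsum N (fun j => B i j x y * Z j x y).
Proof.
  intros HV H0 HA HB Hflat.
  assert (Hbd : forall F : nat -> nat -> R -> R -> R,
    (forall i j, smooth_on V (F i j)) ->
    exists K, locally_2d (fun u v => forall i j, (i < N)%nat -> (j < N)%nat ->
      Rabs (F i j u v) <= K) x0 y0).
  { intros F HF; apply locally_2d_bounded_matrix.
    intros i j; now apply (smooth_on_C1 V (F i j)). }
  destruct (Hbd A HA) as [K1 L1].
  destruct (Hbd B HB) as [K2 L2].
  destruct (Hbd (fun i j => dY (A i j))) as [K3 L3];
    [intros; now apply smooth_on_dY|].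
  destruct (Hbd (fun i j => dY (dY (A i j)))) as [K4 L4];
    [intros; now apply smooth_on_dY, smooth_on_dY|].
  destruct (Hbd (fun i j => dY (B i j))) as [K5 L5];
    [intros; now apply smooth_on_dY|].
  set (K := Rabs K1 + Rabs K2 + Rabs K3 + Rabs K4 + Rabs K5).
  pose proof (Rabs_pos K1); pose proof (Rabs_pos K2); pose proof (Rabs_pos K3);
    pose proof (Rabs_pos K4); pose proof (Rabs_pos K5).
  pose proof (Rle_abs K1); pose proof (Rle_abs K2); pose proof (Rle_abs K3);
    pose proof (Rle_abs K4); pose proof (Rle_abs K5).
  assert (HK0 : 0 <= K) by (unfold K; lra).
  destruct (locally_2d_and _ _ _ _ (open2_locally V x0 y0 HV H0)
    (locally_2d_and _ _ _ _ L1 (locally_2d_and _ _ _ _ L2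
      (locally_2d_and _ _ _ _ L3 (locally_2d_and _ _ _ _ L4 L5)))))
    as [d0 Hd0].
  (* The added 1 avoids a zero denominator; this bound gives [N K d <= 1/2]. *)
  set (d := Rmin d0 (/ (2 * (INR N * K + 1)))).
  assert (HNK0 : 0 <= INR N * K) by (apply Rmult_le_pos; [apply pos_INR | easy]).
  assert (Hd : 0 < d).
  { apply Rmin_pos; [apply cond_pos | apply Rinv_0_lt_compat; lra]. }
  assert (HNK : INR N * K * d <= 1 / 2).
  { apply Rle_trans with ((INR N * K + 1) * / (2 * (INR N * K + 1))).
    - apply Rmult_le_compat; [easy | lra | lra | apply Rmin_r].
    - right; field; lra. }
  set (W := fun x y => Rabs (x - x0) < d /\ Rabs (y - y0) < d).
  assert (HU : forall x y, W x y ->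
    Rabs (x - x0) < d0 /\ Rabs (y - y0) < d0).
  { intros x y [Hx Hy].
    assert (d <= d0) by apply Rmin_l; lra. }
  assert (HWV : forall x y, W x y -> V x y)
    by (intros x y Hxy; destruct (HU x y Hxy); now apply Hd0).
  exists W, (frob_sol x0 y0 N A B z0).
  split; [|split; [|split]].
  - exact (W_open x0 y0 d).
  - unfold W; rewrite !Rminus_diag, Rabs_R0; now split.
  - exact HWV.
  - assert (Hb : forall (F : nat -> nat -> R -> R -> R) K', K' <= K ->
      (forall x y, Rabs (x - x0) < d0 -> Rabs (y - y0) < d0 ->
        forall i j, (i < N)%nat -> (j < N)%nat -> Rabs (F i j x y) <= K') ->
      forall i j x y, (i < N)%nat -> (j < N)%nat -> W x y -> Rabs (F i j x y) <= K).
    { intros F K' HK' HF i j x y Hi Hj Hxy; destruct (HU x y Hxy).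
      eapply Rle_trans; [now apply HF | exact HK']. }
    assert (b1 := Hb A K1 ltac:(unfold K; lra) ltac:(intros; now apply Hd0)).
    assert (b2 := Hb B K2 ltac:(unfold K; lra) ltac:(intros; now apply Hd0)).
    assert (b3 := Hb (fun i j => dY (A i j)) K3 ltac:(unfold K; lra)
                    ltac:(intros; now apply Hd0)).
    assert (b4 := Hb (fun i j => dY (dY (A i j))) K4 ltac:(unfold K; lra)
                    ltac:(intros; now apply Hd0)).
    assert (b5 := Hb (fun i j => dY (B i j)) K5 ltac:(unfold K; lra)
                    ltac:(intros; now apply Hd0)).
    intros i Hi; split; [|split].
    + eapply sol_smooth with (V := V) (K := K); eassumption.
    + eapply sol_start; eassumption.
    + intros x y Hxy; split.
      * eapply sol_dX with (V := V) (K := K); eassumption.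
      * eapply sol_dY with (V := V) (K := K); eassumption.
Qed.

(** * Level curves *)

(** An implicit function theorem uniform in the level: all levels near [phi x0 y0] have a curve over
    the same x-interval, so every point can be slid to the line through [x0]. *)
Definition level_curves (V : R -> R -> Prop) (phi : R -> R -> R) (x0 y0 : R)
    (delta d eps : R) (gam : R -> R -> R) : Prop :=
  0 < delta /\ 0 < d /\ 0 < eps /\
  (forall x y, Rabs (x - x0) < delta -> Rabs (y - y0) < d -> V x y) /\
  (forall tau x, Rabs (tau - phi x0 y0) < eps -> Rabs (x - x0) < delta ->
     Rabs (gam tau x - y0) < d /\ phi x (gam tau x) = tau /\
     is_derive (gam tau) x
       (- dX phi x (gam tau x) / dY phi x (gam tau x))) /\
  (forall tau x y, Rabs (tau - phi x0 y0) < eps -> Rabs (x - x0) < delta ->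
     Rabs (y - y0) < d -> phi x y = tau -> y = gam tau x).

(** Where [phi] grows in y with slope at least [c], intermediate values give existence and
    monotonicity gives uniqueness. Comparing [c] with a bound on [phi_x] makes the curve Lipschitz,
    and differentiability of [phi] then yields its derivative. *)
Lemma level_curves_pos V phi x0 y0 :
  open2 V -> smooth_on V phi -> V x0 y0 -> 0 < dY phi x0 y0 ->
  exists delta d eps gam, level_curves V phi x0 y0 delta d eps gam.
Proof.
  intros HV Hphi H0 Hpos.
  set (c := dY phi x0 y0 / 2).
  assert (Hc : 0 < c) by (unfold c; lra).
  destruct (locally_2d_bounded (dX phi) x0 y0) as [K HK].
  { now apply (smooth_on_C1 V (dX phi)); [apply smooth_on_dX|]. }
  assert (Hcl : locally_2d (fun u v => c <= dY phi u v) x0 y0).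
  { destruct (smooth_on_C1 V (dY phi) x0 y0 (smooth_on_dY _ _ Hphi) H0)
      as (_ & _ & Hcont).
    destruct (Hcont (mkposreal c Hc)) as [e He]; exists e; intros u v Hu Hv.
    specialize (He u v Hu Hv); simpl in He; apply Rabs_def2 in He.
    unfold c in *; lra. }
  destruct (locally_2d_and _ _ _ _ (open2_locally V x0 y0 HV H0)
              (locally_2d_and _ _ _ _ HK Hcl)) as [d1 Hd1].
  assert (Hd1p := cond_pos d1).
  set (d := d1 / 2).
  assert (Hin : forall x y, Rabs (x - x0) < d1 -> y0 - d <= y <= y0 + d ->
    V x y /\ Rabs (dX phi x y) <= K /\ c <= dY phi x y).
  { intros x y Hx Hy; apply Hd1; [exact Hx | apply Rabs_def1; unfold d in *; lra]. }
  assert (Hgrow : forall x y y', Rabs (x - x0) < d1 ->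
    y0 - d <= y <= y0 + d -> y0 - d <= y' <= y0 + d -> y <= y' ->
    c * (y' - y) <= phi x y' - phi x y).
  { intros x y y' Hx Hy Hy' Hle.
    destruct (MVT_gen (phi x) y y' (dY phi x)) as (t & Ht & E).
    - intros t Ht; rewrite Rmin_left, Rmax_right in Ht by exact Hle.
      apply (is_derive_dY V phi); [exact Hphi | apply Hin; lra].
    - intros t Ht; rewrite Rmin_left, Rmax_right in Ht by exact Hle.
      eapply is_derive_continuity_pt.
      apply (is_derive_dY V phi); [exact Hphi | apply Hin; lra].
    - rewrite Rmin_left, Rmax_right in Ht by exact Hle.
      rewrite E; apply Rmult_le_compat_r; [lra | apply Hin; lra]. }
  assert (Hx00 : Rabs (x0 - x0) < d1) by (rewrite Rminus_diag, Rabs_R0; lra).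
  (* At height [d] above or below [y0], [phi x0] has moved by at least [c d]: one half absorbs the
     change of x, the other the change of level. *)
  set (eps := c * d / 2).
  assert (Heps : 0 < eps) by (unfold eps, d; nra).
  assert (Hedge : forall y, y0 - d <= y <= y0 + d -> exists e, 0 < e /\
    forall x, Rabs (x - x0) < e -> Rabs (phi x y - phi x0 y) < eps).
  { intros y Hy.
    assert (Hcy : continuity_pt (fun x => phi x y) x0).
    { eapply is_derive_continuity_pt.
      apply (is_derive_dX V phi); [exact Hphi | now apply Hin]. }
    destruct (Hcy eps Heps) as (e & He & Hxe); exists e; split; [exact He|].
    intros x Hx; destruct (Req_dec x x0) as [->|Hne].
    - rewrite Rminus_diag, Rabs_R0; exact Heps.
    - apply (Hxe x); split; [split; [exact I | auto] | exact Hx]. }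
  destruct (Hedge (y0 - d)) as (e1 & He1 & Hlow); [unfold d; lra|].
  destruct (Hedge (y0 + d)) as (e2 & He2 & Hup); [unfold d; lra|].
  set (delta := Rmin d1 (Rmin e1 e2)).
  assert (Hdelta : 0 < delta) by (repeat apply Rmin_pos; trivial).
  assert (Hdl : forall x, Rabs (x - x0) < delta ->
    Rabs (x - x0) < d1 /\ Rabs (x - x0) < e1 /\ Rabs (x - x0) < e2).
  { intros x Hx; pose proof (Rmin_l d1 (Rmin e1 e2)).
    pose proof (Rmin_r d1 (Rmin e1 e2)).
    pose proof (Rmin_l e1 e2); pose proof (Rmin_r e1 e2).
    unfold delta in Hx; lra. }
  assert (Hex : forall tau x, Rabs (tau - phi x0 y0) < eps ->
    Rabs (x - x0) < delta -> exists y, Rabs (y - y0) < d /\ phi x y = tau).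
  { intros tau x Ht Hx; destruct (Hdl x Hx) as (Hx1 & Hx2 & Hx3).
    assert (G1 := Hgrow x0 (y0 - d) y0 Hx00 ltac:(unfold d; lra)
                    ltac:(unfold d; lra) ltac:(unfold d; lra)).
    assert (G2 := Hgrow x0 y0 (y0 + d) Hx00 ltac:(unfold d; lra)
                    ltac:(unfold d; lra) ltac:(unfold d; lra)).
    specialize (Hlow x Hx2); specialize (Hup x Hx3).
    apply Rabs_def2 in Ht; apply Rabs_def2 in Hlow; apply Rabs_def2 in Hup.
    assert (E1 : phi x (y0 - d) - tau < 0) by (unfold eps in *; nra).
    assert (E2 : 0 < phi x (y0 + d) - tau) by (unfold eps in *; nra).
    destruct (IVT_interv (fun y => phi x y - tau) (y0 - d) (y0 + d))
      as (y & Hy & E); [| unfold d; lra | exact E1 | exact E2 |].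
    - intros y Hy; apply continuity_pt_minus;
        [| apply continuity_pt_const; intros ? ?; easy].
      eapply is_derive_continuity_pt.
      apply (is_derive_dY V phi); [exact Hphi | now apply Hin].
    - exists y; split; [|lra].
      assert (y <> y0 - d) by (intros ->; lra).
      assert (y <> y0 + d) by (intros ->; lra).
      apply Rabs_def1; lra. }
  (* The choice is harmless, since [Huniq] shows that the point is unique. *)
  set (gam := fun tau x => epsilon (inhabits 0)
                (fun y => Rabs (y - y0) < d /\ phi x y = tau)).
  assert (Hgam : forall tau x, Rabs (tau - phi x0 y0) < eps ->
    Rabs (x - x0) < delta -> Rabs (gam tau x - y0) < d /\ phi x (gam tau x) = tau).
  { intros tau x Ht Hx; apply (epsilon_spec (inhabits 0)
      (fun y => Rabs (y - y0) < d /\ phi x y = tau)); now apply Hex. }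
  assert (Huniq : forall tau x y, Rabs (tau - phi x0 y0) < eps ->
    Rabs (x - x0) < delta -> Rabs (y - y0) < d -> phi x y = tau ->
    y = gam tau x).
  { intros tau x y Ht Hx Hy E; destruct (Hgam tau x Ht Hx) as [Hg Eg].
    apply Rabs_def2 in Hy; apply Rabs_def2 in Hg; destruct (Hdl x Hx).
    destruct (Rle_dec y (gam tau x)) as [Hle|Hgt].
    - assert (G := Hgrow x y (gam tau x) ltac:(trivial) ltac:(lra) ltac:(lra) Hle).
      nra.
    - assert (G := Hgrow x (gam tau x) y ltac:(trivial) ltac:(lra) ltac:(lra)
                     ltac:(lra)).
      nra. }
  exists delta, d, eps, gam.
  split; [exact Hdelta|]; split; [unfold d; lra|]; split; [exact Heps|].
  split; [|split; [|exact Huniq]].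
  { intros x y Hx Hy; apply Rabs_def2 in Hy; destruct (Hdl x Hx).
    apply Hin; [trivial | lra]. }
  intros tau x1 Ht Hx1; destruct (Hgam tau x1 Ht Hx1) as [Hg Eg].
  split; [exact Hg|]; split; [exact Eg|].
  set (y1 := gam tau x1) in *.
  assert (Hy1 : y0 - d <= y1 <= y0 + d) by (apply Rabs_def2 in Hg; lra).
  assert (HK0 : 0 <= K)
    by (destruct (Hdl x1 Hx1); eapply Rle_trans; [apply Rabs_pos | now apply (Hin x1 y1)]).
  assert (Hlip : forall x, Rabs (x - x0) < delta ->
    c * Rabs (gam tau x - y1) <= K * Rabs (x - x1)).
  { intros x Hx; destruct (Hgam tau x Ht Hx) as [Hgx Egx].
    destruct (Hdl x Hx), (Hdl x1 Hx1).
    assert (Hgx' : y0 - d <= gam tau x <= y0 + d) by (apply Rabs_def2 in Hgx; lra).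
    apply Rle_trans with (Rabs (phi x (gam tau x) - phi x y1)).
    - destruct (Rle_dec y1 (gam tau x)) as [Hle|Hgt].
      + rewrite (Rabs_pos_eq (gam tau x - y1)) by lra.
        eapply Rle_trans; [apply (Hgrow x); lra | apply Rle_abs].
      + rewrite Rabs_minus_sym, (Rabs_pos_eq (y1 - gam tau x)) by lra.
        rewrite Rabs_minus_sym.
        eapply Rle_trans; [apply (Hgrow x); lra | apply Rle_abs].
    - rewrite Egx, <- Eg, Rabs_minus_sym.
      apply (mean_value_le (fun x => phi x y1) (fun x => dX phi x y1)).
      intros t Htt.
      assert (Rabs (t - x0) < d1).
      { apply (between_disc x0 d1 x1 x); trivial. }
      split; [|now apply Hin].
      apply (is_derive_dX V phi); [exact Hphi | now apply Hin]. }
  destruct (Hdl x1 Hx1) as [Hx1d _].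
  destruct (Hin x1 y1 Hx1d Hy1) as (HV1 & _ & Hm).
  set (m := dY phi x1 y1) in *.
  apply is_derive_Reals; intros e He.
  (* An increment [(h, k)] along the curve satisfies [max(|h|, |k|) <= Q |h|]; [Q] converts the
     tolerance for [phi] into one in [h]. *)
  set (Q := 1 + K / c).
  assert (HQ : 1 <= Q) by (unfold Q; pose proof (Rdiv_le_0_compat K c HK0 Hc); lra).
  assert (He' : 0 < e * m / (2 * Q)) by (apply Rdiv_lt_0_compat; nra).
  destruct (smooth_on_differentiable V HV phi x1 y1 Hphi HV1
              (mkposreal _ He')) as [b Hb]; simpl in Hb.
  assert (Hbp := cond_pos b).
  assert (Hsmall : 0 < Rmin (b / Q) (delta - Rabs (x1 - x0)))
    by (apply Rmin_pos; [apply Rdiv_lt_0_compat; lra | lra]).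
  exists (mkposreal _ Hsmall); intros h Hh0 Hh; simpl in Hh.
  assert (Hh1 : Rabs h < b / Q) by (eapply Rlt_le_trans; [exact Hh | apply Rmin_l]).
  assert (Hh2 : Rabs h < delta - Rabs (x1 - x0))
    by (eapply Rlt_le_trans; [exact Hh | apply Rmin_r]).
  assert (Hhp := Rabs_pos_lt h Hh0).
  assert (Hxh : Rabs (x1 + h - x0) < delta).
  { replace (x1 + h - x0) with ((x1 - x0) + h) by ring.
    eapply Rle_lt_trans; [apply Rabs_triang | lra]. }
  destruct (Hgam tau (x1 + h) Ht Hxh) as [_ Egh].
  specialize (Hlip (x1 + h) Hxh).
  set (k := gam tau (x1 + h) - y1) in *.
  replace (x1 + h - x1) with h in Hlip by ring.
  assert (Hk : Rabs k <= K / c * Rabs h).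
  { apply (Rmult_le_reg_l c); [exact Hc|].
    replace (c * (K / c * Rabs h)) with (K * Rabs h) by (field; lra); exact Hlip. }
  assert (HQh : Q * Rabs h < b).
  { apply (Rmult_lt_compat_l Q) in Hh1; [|lra].
    replace (Q * (b / Q)) with (pos b) in Hh1 by (field; lra); exact Hh1. }
  assert (HKc := Rdiv_le_0_compat K c HK0 Hc).
  assert (Hdiff := Hb (x1 + h) (gam tau (x1 + h))).
  fold k in Hdiff; replace (x1 + h - x1) with h in Hdiff by ring.
  rewrite Egh, <- Eg in Hdiff.
  (* [phi] is equal at the two points of the curve, so its differential on [(h, k)] is entirely an
     error of linear approximation. *)
  assert (Hd2 : Rabs (- (dX phi x1 y1 * h + m * k))
                <= e * m / (2 * Q) * (Q * Rabs h)).
  { eapply Rle_trans.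
    - replace (- (dX phi x1 y1 * h + m * k)) with
        (phi x1 y1 - phi x1 y1 - (dX phi x1 y1 * h + m * k)) by ring.
      apply Hdiff; unfold Q in HQh; nra.
    - apply Rmult_le_compat_l; [lra|].
      apply Rmax_lub; unfold Q; nra. }
  replace ((gam tau (x1 + h) - gam tau x1) / h - - dX phi x1 y1 / m) with
    ((dX phi x1 y1 * h + m * k) / (m * h)) by (unfold k, y1; field; split; lra).
  unfold Rdiv; rewrite Rabs_mult, Rabs_inv, Rabs_mult, (Rabs_pos_eq m) by lra.
  apply (Rmult_lt_reg_r (m * Rabs h)); [nra|].
  rewrite Rmult_assoc, Rinv_l, Rmult_1_r by nra.
  rewrite Rabs_Ropp in Hd2.
  eapply Rle_lt_trans; [exact Hd2|].
  replace (e * m / (2 * Q) * (Q * Rabs h)) with (e * (m * Rabs h) / 2)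
    by (field; lra).
  assert (0 < e * (m * Rabs h)) by (repeat apply Rmult_lt_0_compat; lra); lra.
Qed.

Lemma level_curves_exist V phi x0 y0 :
  open2 V -> smooth_on V phi -> V x0 y0 -> dY phi x0 y0 <> 0 ->
  exists delta d eps gam, level_curves V phi x0 y0 delta d eps gam.
Proof.
  intros HV Hphi H0 Hne.
  destruct (Rlt_dec 0 (dY phi x0 y0)) as [Hpos|Hneg];
    [now apply level_curves_pos|].
  assert (EX : forall x y, dX (fun x y => - phi x y) x y = - dX phi x y)
    by (intros; apply Derive_opp).
  assert (EY : forall x y, dY (fun x y => - phi x y) x y = - dY phi x y)
    by (intros; apply Derive_opp).
  destruct (level_curves_pos V (fun x y => - phi x y) x0 y0)
    as (delta & d & eps & gam & H1 & H2 & H3 & HR & HG & HU);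
    [exact HV | now apply smooth_on_opp | exact H0 | rewrite EY; lra |].
  exists delta, d, eps, (fun tau => gam (- tau)).
  assert (Ht : forall tau, Rabs (tau - phi x0 y0) < eps ->
    Rabs (- tau - - phi x0 y0) < eps).
  { intros tau Ht; replace (- tau - - phi x0 y0) with (- (tau - phi x0 y0)) by ring.
    now rewrite Rabs_Ropp. }
  split; [exact H1|]; split; [exact H2|]; split; [exact H3|].
  split; [exact HR|]; split.
  - intros tau x Htau Hx.
    destruct (HG (- tau) x (Ht tau Htau) Hx) as (G1 & G2 & G3).
    split; [exact G1|]; split; [lra|].
    rewrite EX, EY in G3.
    replace (- dX phi x (gam (- tau) x) / dY phi x (gam (- tau) x)) with
      (- - dX phi x (gam (- tau) x) / - dY phi x (gam (- tau) x)); [exact G3|].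
    unfold Rdiv; rewrite Rinv_opp; ring.
  - intros tau x y Htau Hx Hy E; apply HU; [now apply Ht | exact Hx | exact Hy | lra].
Qed.

(* A function of [phi] alone is constant along the level curves of [phi]; so a
   relation a = (f o phi) b may be differentiated along them although nothing
   is known about the regularity of [f]. *)
Lemma X_through_level V phi r a b (f : R -> R) x y :
  open2 V -> smooth_on V phi -> smooth_on V a -> smooth_on V b ->
  (forall u v, V u v -> dY phi u v <> 0 /\ dX phi u v = r u v * dY phi u v) ->
  (forall u v, V u v -> a u v = f (phi u v) * b u v) ->
  V x y -> Xop r a x y = f (phi x y) * Xop r b x y.
Proof.
  intros HV Hphi Ha Hb Hlev Hab Hxy.
  destruct (Hlev x y Hxy) as [Hne Hchar].
  destruct (level_curves_exist V phi x y HV Hphi Hxy Hne)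
    as (delta & d & eps & gam & H1 & H2 & H3 & HR & HG & HU).
  set (tau := phi x y).
  assert (Ht : Rabs (tau - phi x y) < eps)
    by (unfold tau; rewrite Rminus_diag, Rabs_R0; exact H3).
  assert (Hx : Rabs (x - x) < delta) by (rewrite Rminus_diag, Rabs_R0; exact H1).
  assert (Ey : y = gam tau x).
  { apply HU; trivial; rewrite Rminus_diag, Rabs_R0; exact H2. }
  destruct (HG tau x Ht Hx) as (_ & _ & Hder); rewrite <- Ey, Hchar in Hder.
  replace (- (r x y * dY phi x y) / dY phi x y) with (- r x y) in Hder
    by (field; exact Hne).
  assert (Hal : forall g, smooth_on V g ->
    is_derive (fun t => g t (gam tau t)) x (Xop r g x y)).
  { intros g Hg.
    replace (Xop r g x y) with (dX g x (gam tau x) + dY g x (gam tau x) * - r x y)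
      by (rewrite <- Ey; unfold Xop; ring).
    apply (is_derive_along V HV); [exact Hg | now rewrite <- Ey | exact Hder]. }
  rewrite <- (is_derive_unique _ _ _ (Hal a Ha)).
  apply is_derive_unique.
  apply is_derive_ext_loc with (fun t => f tau * b t (gam tau t)).
  - exists (mkposreal _ H1); intros t Htd.
    change (Rabs (t - x) < delta) in Htd.
    destruct (HG tau t Ht Htd) as (G1 & G2 & _).
    rewrite Hab by (now apply HR); now rewrite G2.
  - apply (is_derive_scal (fun t => b t (gam tau t))), Hal, Hb.
Qed.

(** [f] is the value of [a] where the level curve meets the line through [x0]; along the curve, [a]
    has derivative [X a = 0]. [W] is chosen before [a], so that one neighbourhood serves [alpha] and
    [beta] together. *)
Lemma function_of_level V phi r x0 y0 :
  open2 V -> smooth_on V phi -> V x0 y0 ->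
  (forall u v, V u v -> dY phi u v <> 0 /\ dX phi u v = r u v * dY phi u v) ->
  exists W : R -> R -> Prop,
    open2 W /\ W x0 y0 /\ (forall x y, W x y -> V x y) /\
    forall a, smooth_on V a -> (forall x y, V x y -> Xop r a x y = 0) ->
      exists f : R -> R, forall x y, W x y -> a x y = f (phi x y).
Proof.
  intros HV Hphi H0 Hlev.
  destruct (level_curves_exist V phi x0 y0 HV Hphi H0 (proj1 (Hlev _ _ H0)))
    as (delta & d & eps & gam & H1 & H2 & H3 & HR & HG & HU).
  exists (fun x y => (Rabs (x - x0) < delta /\ Rabs (y - y0) < d) /\
                     Rabs (phi x y - phi x0 y0) < eps).
  split; [|split; [|split]].
  - apply locally_2d_open2; intros x y [Hxy Hp].
    apply locally_2d_and.
    + apply locally_2d_and; [apply (disc_locally_2d true) | apply (disc_locally_2d false)];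
        apply Hxy.
    + assert (HVxy : V x y) by (apply HR; apply Hxy).
      destruct (smooth_on_C1 V phi x y Hphi HVxy) as (_ & _ & Hc).
      assert (He : 0 < eps - Rabs (phi x y - phi x0 y0)) by lra.
      destruct (Hc (mkposreal _ He)) as [e Hce]; exists e; intros u v Hu Hv.
      specialize (Hce u v Hu Hv); simpl in Hce.
      replace (phi u v - phi x0 y0) with
        ((phi u v - phi x y) + (phi x y - phi x0 y0)) by ring.
      eapply Rle_lt_trans; [apply Rabs_triang | lra].
  - rewrite !Rminus_diag, Rabs_R0; repeat split; assumption.
  - intros x y [[Hx Hy] _]; now apply HR.
  - intros a Ha Hza; exists (fun tau => a x0 (gam tau x0)).
    intros x y [[Hx Hy] Ht]; set (tau := phi x y) in *.
    assert (Ey : y = gam tau x) by now apply HU.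
    rewrite Ey at 1.
    enough (E : Rabs (a x (gam tau x) - a x0 (gam tau x0)) <= 0 * Rabs (x - x0)).
    { rewrite Rmult_0_l in E.
      pose proof (Rabs_pos (a x (gam tau x) - a x0 (gam tau x0))).
      apply Rminus_diag_uniq.
      destruct (Req_dec (a x (gam tau x) - a x0 (gam tau x0)) 0); [easy|].
      pose proof (Rabs_pos_lt _ H4); lra. }
    apply (mean_value_le (fun t => a t (gam tau t)) (fun _ => 0)).
    intros t Htt.
    assert (Hx0 : Rabs (x0 - x0) < delta)
      by (rewrite Rminus_diag, Rabs_R0; exact H1).
    assert (Htd : Rabs (t - x0) < delta) by now apply (between_disc x0 delta x0 x).
    destruct (HG tau t Ht Htd) as (G1 & _ & G3).
    assert (HVt : V t (gam tau t)) by now apply HR.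
    destruct (Hlev _ _ HVt) as [Hne Hchar].
    rewrite Hchar in G3.
    split; [|rewrite Rabs_R0; lra].
    replace 0 with (dX a t (gam tau t) + dY a t (gam tau t) *
      (- (r t (gam tau t) * dY phi t (gam tau t)) / dY phi t (gam tau t))).
    + now apply (is_derive_along V HV).
    + rewrite <- (Hza t (gam tau t) HVt); unfold Xop; field; exact Hne.
Qed.

(** * Derivatives along a curve *)

Definition pz (k : nat) : pol := pc (inject_Z (Z.of_nat k)).

Lemma ev_pz rho k : ev rho (pz k) = INR k.
Proof.
  unfold pz; rewrite ev_pc, INR_IZR_INZ; unfold Q2R, inject_Z.
  cbn [Qnum Qden]; field.
Qed.

(* Along a curve y = y(x) the jets of "field" 50 stand for the derivatives of
   y, and "field" 51 for P = y' + r. *)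
Definition y_jet (k : nat) : jet := (50, 0, k)%nat.
Definition P_jet : jet := (51, 0, 0)%nat.

(** Along the curve [d/dx + y' d/dy = X + P d/dy], which is the reason for the variable
    [P = y' + r]; in particular [P' = y'' + X r + P r_y]. *)
Definition cder (v : jet) : pol :=
  let '(f, a, b) := v in
  if Nat.eqb f 50 then pv (50%nat, a, S b)
  else if Nat.eqb f 51 then
    padd (pv (y_jet 2))
      (padd (pv (0, 0, 1)%nat) (pmul (pv P_jet) (pv (0, 1, 0)%nat)))
  else padd (xraw v) (pmul (pv P_jet) (yraw v)).

Definition field_only (p : pol) : bool :=
  forallb (fun t => forallb (fun v : jet => Nat.ltb (fst (fst v)) 50) (snd t)) p.

(** Rules are valid for [jets], whereas numbers 50 and 51 have another meaning in [cjets]. A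
    reduction is accepted only if neither its source nor its result involves them. *)
Definition cnf (rs : rules) (v : jet) : pol :=
  let e := nf 12 rs v in
  if Nat.ltb (fst (fst v)) 50 && field_only e then e else pv v.

Definition Dc (rs : rules) (p : pol) : pol := pbind (cnf rs) (pder cder p).

(* The numerator of the (k+1)-st derivative of U with respect to T, whose
   denominator is T'^(2k+1). *)
Fixpoint tder_num (rs : rules) (ft fu k : nat) : pol :=
  match k with
  | O => Dc rs (jv fu)
  | S k' =>
      psub (pmul (Dc rs (tder_num rs ft fu k')) (Dc rs (jv ft)))
        (pmul (pz (2 * k' + 1)) (pmul (tder_num rs ft fu k') (Dc rs (Dc rs (jv ft)))))
  end.

Definition cjets (fld : nat -> R -> R -> R) (y : R -> R) (x : R) (v : jet) : R :=
  let '(f, a, b) := v in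
  if Nat.eqb f 50 then Derive_n y b x
  else if Nat.eqb f 51 then Derive_n y 1 x + fld 0%nat x (y x)
  else jets fld x (y x) v.

Section JetsIn.
Variable S : jet -> Prop.

Definition jets_in (p : pol) : Prop := List.Forall (fun t => List.Forall S (snd t)) p.

Lemma jets_in_padd p q : jets_in p -> jets_in q -> jets_in (padd p q).
Proof.
  revert q; induction p as [|[c m] p IH]; intros q Hp Hq; [exact Hq|].
  inversion Hp as [|? ? Hm Hp']; subst.
  induction q as [|[d k] q IHq]; [exact Hp|].
  inversion Hq as [|? ? Hk Hq']; subst.
  cbn [padd]; destruct (mcmp m k); cbv zeta.
  - destruct (Qeq_bool _ 0); [now apply IH|].
    constructor; [exact Hm | now apply IH].
  - constructor; [exact Hk | now apply IHq].
  - constructor; [exact Hm | now apply IH].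
Qed.

Lemma jets_in_pmul p q : jets_in p -> jets_in q -> jets_in (pmul p q).
Proof.
  intros Hp Hq; induction Hp as [|[c m] p Hm Hp IH]; [constructor|].
  apply jets_in_padd; [|exact IH].
  unfold pmulm; apply Forall_map, (Forall_impl _ (P := fun t => List.Forall S (snd t)));
    [|exact Hq].
  intros [d k] Hk; cbn [fst snd] in *.
  assert (Hins : forall v m, S v -> List.Forall S m -> List.Forall S (vins v m)).
  { intros v l Hv Hl; induction Hl as [|w l Hw Hl IHl]; [now constructor|].
    simpl; destruct (vcmp v w); repeat (constructor; trivial). }
  clear -Hins Hm Hk; induction Hm; simpl; [exact Hk | now apply Hins].
Qed.

Lemma jets_in_pder d p :
  (forall v, S v -> jets_in (d v)) -> jets_in p -> jets_in (pder d p).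
Proof.
  intros Hd Hp; induction Hp as [|[c m] p Hm Hp IH]; [constructor|].
  apply jets_in_padd; [|exact IH].
  apply jets_in_pmul; [unfold jets_in, pc; cbn [fst]; destruct (Qeq_bool c 0); repeat constructor|].
  cbn [fst snd] in *; clear -Hd Hm.
  induction Hm as [|v m Hv Hm IH]; [constructor|].
  apply jets_in_padd; apply jets_in_pmul; auto; now repeat constructor.
Qed.

Lemma jets_in_xder f a b :
  (forall a b, S (f, a, b)) -> (forall a b, S (0%nat, a, b)) ->
  (forall v, S v -> jets_in (yraw v)) -> jets_in (xder f a b).
Proof.
  intros Hf H0 HS; induction a as [|a IH]; cbn [xder].
  - repeat constructor; apply Hf.
  - apply jets_in_padd; [now apply jets_in_pder|].
    apply jets_in_pmul; repeat constructor; [apply H0 | apply Hf].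
Qed.
End JetsIn.

Definition on_fields (v : jet) : Prop :=
  fst (fst v) <> 50%nat /\ fst (fst v) <> 51%nat.

Lemma ev_cjets_field fld y x p :
  jets_in on_fields p -> ev (cjets fld y x) p = ev (jets fld x (y x)) p.
Proof.
  induction p as [|[c m] p IH]; [easy|]; intros Hp.
  inversion Hp as [|? ? Hm Hp']; subst.
  rewrite !ev_cons, IH by exact Hp'; f_equal; f_equal.
  cbn [snd] in Hm; clear -Hm; induction Hm as [|[[f a] b] m [H1 H2] Hm IH]; [easy|].
  simpl; rewrite IH; f_equal; cbn [fst] in H1, H2.
  apply Nat.eqb_neq in H1, H2; now rewrite H1, H2.
Qed.

Lemma on_fields_yraw v : on_fields v -> jets_in on_fields (yraw v).
Proof.
  destruct v as [[f a] b]; intros [H1 H2].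
  constructor; [|constructor]; constructor; [now split | constructor].
Qed.

Lemma field_only_on_fields p : field_only p = true -> jets_in on_fields p.
Proof.
  intros H; apply Forall_forall; intros t Ht.
  unfold field_only in H; rewrite forallb_forall in H; specialize (H t Ht).
  apply Forall_forall; intros v Hv; rewrite forallb_forall in H.
  apply H, Nat.ltb_lt in Hv; split; lia.
Qed.

Section Curve.
Variable V : R -> R -> Prop.
Hypothesis HV : open2 V.
Variable fld : nat -> R -> R -> R.
Hypothesis Hfld : forall f, smooth_on V (fld f).
Variable rs : rules.
Hypothesis Hrs : valid V fld rs.
Variable y : R -> R.

Definition curve_in (x : R) : Prop :=
  V x (y x) /\ forall k, ex_derive (Derive_n y k) x.

Lemma cjets_derive v x :
  curve_in x -> is_derive (fun t => cjets fld y t v) x (ev (cjets fld y x) (cder v)).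
Proof.
  intros [HVx Hy].
  assert (Hal : forall g, smooth_on V g -> is_derive (fun t => g t (y t)) x
      (Xop (fld 0%nat) g x (y x) +
       (Derive_n y 1 x + fld 0%nat x (y x)) * dY g x (y x))).
  { intros g Hg; change (Derive_n y 1 x) with (Derive y x).
    replace (Xop _ g x (y x) + _) with (dX g x (y x) + dY g x (y x) * Derive y x)
      by (unfold Xop; ring).
    apply (is_derive_along V HV g y x (Derive y x)); trivial.
    apply Derive_correct, (Hy 0%nat). }
  destruct v as [[f a] b]; unfold cjets at 1, cder.
  destruct (Nat.eqb f 50) eqn:E50.
  - rewrite ev_pv; simpl; apply Derive_correct, (Hy b).
  - destruct (Nat.eqb f 51) eqn:E51.
    + rewrite !ev_padd, ev_pmul, !ev_pv; simpl.
      change (Derive (fun x => Derive (fun t => y t) x) x) with (Derive_n y 2 x).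
      apply (is_derive_plus (V := R_NormedModule) (fun t => Derive_n y 1 t)).
      * apply Derive_correct, (Hy 1%nat).
      * apply (Hal (fld 0%nat)), Hfld.
    + rewrite ev_padd, ev_pmul, ev_pv.
      apply Nat.eqb_neq in E50, E51.
      assert (HS : on_fields (f, a, b)) by (split; assumption).
      rewrite (ev_cjets_field _ _ _ (xraw (f, a, b))).
      2: { apply jets_in_xder; intros; [split; assumption | split; discriminate |].
           now apply on_fields_yraw. }
      rewrite (ev_cjets_field _ _ _ (yraw (f, a, b))) by now apply on_fields_yraw.
      rewrite <- (X_jets V HV fld Hfld) by exact HVx; cbn [yraw]; rewrite ev_pv.
      apply (Hal (fun x y => jets fld x y (f, a, b))).
      now apply (smooth_jets V HV).
Qed.

Lemma Dc_derive p x :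
  curve_in x ->
  is_derive (fun t => ev (cjets fld y t) p) x (ev (cjets fld y x) (Dc rs p)).
Proof.
  intros Hx; unfold Dc; rewrite ev_pbind.
  rewrite (ev_ext _ (cjets fld y x)).
  - apply (is_derive_ev (fun t => cjets fld y t)).
    intros v; now apply cjets_derive.
  - intros [[f a] b]; unfold cnf; cbn [fst].
    destruct (Nat.ltb f 50) eqn:E; [|apply ev_pv].
    destruct (field_only _) eqn:Ef; [|apply ev_pv]; cbn [andb].
    rewrite ev_cjets_field by now apply field_only_on_fields.
    rewrite (nf_sound V HV fld Hfld rs Hrs) by apply Hx.
    apply Nat.ltb_lt in E; unfold cjets.
    destruct (Nat.eqb_spec f 50); [lia|].
    destruct (Nat.eqb_spec f 51); [lia | easy].
Qed.

Lemma curve_in_near x0 :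
  V x0 (y x0) -> curve_smooth_near y x0 -> locally x0 curve_in.
Proof.
  intros HVx (e & He & Hy).
  assert (Hx0 : Rabs (x0 - x0) < e) by (rewrite Rminus_diag, Rabs_R0; exact He).
  assert (Hc : continuous y x0)
    by (apply (ex_derive_continuous (V := R_NormedModule)), (Hy 0%nat), Hx0).
  destruct (open2_locally V _ _ HV HVx) as [d Hd].
  destruct (Hc (ball (y x0) d) (locally_ball _ d)) as [d' Hd'].
  assert (Hp : 0 < Rmin e (Rmin d d'))
    by (repeat apply Rmin_pos; trivial; apply cond_pos).
  exists (mkposreal _ Hp); intros x Hx.
  change (Rabs (x - x0) < Rmin e (Rmin d d')) in Hx.
  assert (Rmin e (Rmin d d') <= e) by apply Rmin_l.
  assert (Rmin e (Rmin d d') <= Rmin d d') by apply Rmin_r.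
  assert (Rmin d d' <= d) by apply Rmin_l.
  assert (Rmin d d' <= d') by apply Rmin_r.
  split.
  - apply Hd; [lra|]; apply Hd'; change (Rabs (x - x0) < d'); lra.
  - intros k; apply Hy; lra.
Qed.

(** Iterated quotient rule: [(N / T'^(2k+1))' / T' = (N' T' - (2k+1) N T'') / T'^(2k+3)]. *)
Lemma lin_expr_num ft fu alpha beta x0 :
  (ft < 50)%nat -> (fu < 50)%nat ->
  V x0 (y x0) -> curve_smooth_near y x0 ->
  let E p := ev (cjets fld y x0) p in
  let t1 := E (Dc rs (jv ft)) in
  Derive (fun x => fld ft x (y x)) x0 = t1 /\
  (t1 <> 0 ->
   lin_expr (fld ft) (fld fu) alpha beta y x0
   = E (tder_num rs ft fu 3) / t1 ^ 7 + alpha (fld ft x0 (y x0)) * (E (tder_num rs ft fu 0) / t1)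
     + beta (fld ft x0 (y x0)) * fld fu x0 (y x0)).
Proof.
  intros Hft Hfu HVx Hsm E t1.
  assert (Hfield : forall f x, (f < 50)%nat ->
    ev (cjets fld y x) (jv f) = fld f x (y x)).
  { intros f x Hf; unfold jv; rewrite ev_pv; unfold cjets.
    destruct (Nat.eqb_spec f 50); [lia|].
    destruct (Nat.eqb_spec f 51); [lia | easy]. }
  assert (Hder : forall f x, (f < 50)%nat -> curve_in x ->
    Derive (fun t => fld f t (y t)) x = ev (cjets fld y x) (Dc rs (jv f))).
  { intros f x Hf Hx.
    rewrite <- (is_derive_unique _ _ _ (Dc_derive (jv f) x Hx)).
    apply Derive_ext; intros t; symmetry; now apply Hfield. }
  pose proof (curve_in_near x0 HVx Hsm) as Hnear.
  assert (Hx0 : curve_in x0) by (destruct Hnear as [e He]; apply He, ball_center).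
  split; [now apply Hder|]; intros Ht1.
  set (T1 := fun x => ev (cjets fld y x) (Dc rs (jv ft))).
  assert (Hgood : locally x0 (fun x => curve_in x /\ T1 x <> 0)).
  { apply filter_and; [exact Hnear|].
    assert (Hc : continuous T1 x0)
      by (apply (ex_derive_continuous (V := R_NormedModule)); eexists;
          now apply Dc_derive).
    apply (Hc (fun z => z <> 0)).
    apply open_neq; exact Ht1. }
  destruct Hgood as [d Hd].
  set (N := fun k x => ev (cjets fld y x) (tder_num rs ft fu k)).
  set (u1 := fun x => Derive (fun x => fld fu x (y x)) x
                      / Derive (fun x => fld ft x (y x)) x).
  set (step := fun (u : R -> R) x => Derive u x
                      / Derive (fun x => fld ft x (y x)) x).
  (* The formula is proved on a neighbourhood, because the next step differentiates it. *)
  assert (Hk : forall k x, ball x0 d x ->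
    Nat.iter k step u1 x = N k x / T1 x ^ (2 * k + 1)).
  { induction k as [|k IH]; intros x Hx; destruct (Hd x Hx) as [Hin Hne].
    - change (Nat.iter 0 step u1 x) with (u1 x); unfold u1; rewrite !(Hder _ x) by trivial.
      unfold N, T1; simpl; field; exact Hne.
    - change (Nat.iter (S k) step u1 x) with (step (Nat.iter k step u1) x).
      unfold step at 1; rewrite (Hder ft x) by trivial.
      assert (HD : Derive (Nat.iter k step u1) x =
        (ev (cjets fld y x) (Dc rs (tder_num rs ft fu k)) * T1 x ^ (2 * k + 1)
         - N k x * (INR (2 * k + 1) * ev (cjets fld y x) (Dc rs (Dc rs (jv ft)))
                    * T1 x ^ (2 * k))) / (T1 x ^ (2 * k + 1)) ^ 2).
      { apply is_derive_unique.
        apply is_derive_ext_loc with (fun t => N k t / T1 t ^ (2 * k + 1)).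
        - assert (Hp : 0 < d - Rabs (x - x0))
            by (change (Rabs (x - x0) < d) in Hx; lra).
          exists (mkposreal _ Hp); intros t Ht; symmetry; apply IH.
          change (Rabs (t - x) < d - Rabs (x - x0)) in Ht.
          change (Rabs (t - x0) < d).
          replace (t - x0) with ((t - x) + (x - x0)) by ring.
          eapply Rle_lt_trans; [apply Rabs_triang | lra].
        - apply is_derive_div; [now apply Dc_derive | | now apply pow_nonzero].
          replace (T1 x ^ (2 * k)) with (T1 x ^ pred (2 * k + 1)) by (f_equal; lia).
          apply (is_derive_pow T1); now apply Dc_derive. }
      rewrite HD; fold (T1 x); unfold N; cbn [tder_num].
      rewrite ev_psub, !ev_pmul, ev_pz; fold (T1 x).
      replace (2 * S k + 1)%nat with (2 * k + 1 + 2)%nat by lia.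
      rewrite (pow_add _ (2 * k + 1) 2), (pow_add _ (2 * k) 1).
      field; split; [exact Hne | now apply pow_nonzero]. }
  unfold lin_expr.
  change (Derive _ x0 / _ + _ + _) with
    (Nat.iter 3 step u1 x0 + alpha (fld ft x0 (y x0)) * Nat.iter 0 step u1 x0
     + beta (fld ft x0 (y x0)) * fld fu x0 (y x0)).
  rewrite !Hk by apply ball_center.
  change (2 * 3 + 1)%nat with 7%nat; change (2 * 0 + 1)%nat with 1%nat.
  now rewrite pow_1.
Qed.
End Curve.

(** * Curves with a prescribed jet, and the foliation they detect *)

Definition taylor (x0 : R) (a : nat -> R) (x : R) : R :=
  a 0%nat + a 1%nat * (x - x0) + a 2%nat * (x - x0) ^ 2 / 2
  + a 3%nat * (x - x0) ^ 3 / 6 + a 4%nat * (x - x0) ^ 4 / 24.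

(** With coefficients vanishing from index 5 on, differentiation is a shift of the coefficients. *)
Lemma taylor_derive x0 a k x :
  (forall i, (5 <= i)%nat -> a i = 0) ->
  is_derive (Derive_n (taylor x0 a) k) x (taylor x0 (fun i => a (S k + i)%nat) x)
  /\ Derive_n (taylor x0 a) k x = taylor x0 (fun i => a (k + i)%nat) x.
Proof.
  intros Ha.
  assert (H1 : forall k x, is_derive (taylor x0 (fun i => a (k + i)%nat)) x
                 (taylor x0 (fun i => a (S k + i)%nat) x)).
  { intros l t; unfold taylor; auto_derive; [easy|].
    rewrite (Ha (S l + 4)%nat) by lia.
    replace (l + 1)%nat with (S l + 0)%nat by lia.
    replace (l + 2)%nat with (S l + 1)%nat by lia.
    replace (l + 3)%nat with (S l + 2)%nat by lia.
    replace (l + 4)%nat with (S l + 3)%nat by lia.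
    simpl; field. }
  assert (H2 : forall k x,
    Derive_n (taylor x0 a) k x = taylor x0 (fun i => a (k + i)%nat) x).
  { induction k0 as [|l IH]; intros t; [easy|].
    simpl; rewrite (Derive_ext _ _ _ IH).
    now apply is_derive_unique, H1. }
  split; [|apply H2].
  eapply is_derive_ext; [intros t; symmetry; apply H2 | apply H1].
Qed.

Definition curve (x0 y0 p q s w : R) : R -> R :=
  taylor x0 (fun i => nth i [y0; p; q; s; w] 0).

Lemma curve_jet x0 y0 p q s w k :
  Derive_n (curve x0 y0 p q s w) k x0 = nth k [y0; p; q; s; w] 0.
Proof.
  unfold curve.
  rewrite (proj2 (taylor_derive x0 _ k x0
    (fun i Hi => nth_overflow [y0; p; q; s; w] 0 Hi))).
  unfold taylor; rewrite Rminus_diag, Nat.add_0_r.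
  generalize (fun i => nth i [y0; p; q; s; w] 0); intros a; field.
Qed.

Lemma curve_start x0 y0 p q s w : curve x0 y0 p q s w x0 = y0.
Proof. exact (curve_jet x0 y0 p q s w 0). Qed.

Lemma curve_smooth x0 y0 p q s w : curve_smooth_near (curve x0 y0 p q s w) x0.
Proof.
  exists 1; split; [lra|]; intros k x _; eexists.
  apply (taylor_derive x0 (fun i => nth i [y0; p; q; s; w] 0)).
  intros i Hi; now apply nth_overflow.
Qed.

Definition subst_y (q s w : pol) : pol -> pol :=
  pbind (fun v => let '(f, a, b) := v in
    if Nat.eqb f 50 then
      match b with 2%nat => q | 3%nat => s | 4%nat => w | _ => pv v end
    else pv v).

(** Substituting values for the higher derivatives amounts to changing the curve; this isolates the
    dependence of a numerator on each of them. *)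
Lemma ev_subst_y fld x0 y0 p q s w q' s' w' e1 e2 e3 P :
  ev (cjets fld (curve x0 y0 p q s w) x0) e1 = q' ->
  ev (cjets fld (curve x0 y0 p q s w) x0) e2 = s' ->
  ev (cjets fld (curve x0 y0 p q s w) x0) e3 = w' ->
  ev (cjets fld (curve x0 y0 p q s w) x0) (subst_y e1 e2 e3 P)
  = ev (cjets fld (curve x0 y0 p q' s' w') x0) P.
Proof.
  intros H1 H2 H3; unfold subst_y; rewrite ev_pbind; apply ev_ext.
  intros [[f a] b]; destruct (Nat.eqb f 50) eqn:E.
  - destruct b as [|[|[|[|[|b]]]]]; rewrite ?ev_pv, ?H1, ?H2, ?H3;
      unfold cjets; rewrite E, ?curve_jet; easy.
  - rewrite ev_pv; unfold cjets; rewrite E, !curve_jet, !curve_start; easy.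
Qed.

(** Field 0 is zero here, so that X is [d/dx] and no rule is assumed: at this stage [phi] is not yet
    known to be constant along [d/dx - r d/dy]. *)
Definition raw_fld (phi psi : R -> R -> R) (f : nat) : R -> R -> R :=
  match f with 1%nat => phi | 2%nat => psi | _ => fun _ _ => 0 end.

Definition raw_jac : pol :=
  psub (pmul (pv (1, 0, 1)%nat) (pv (2, 1, 0)%nat))
       (pmul (pv (1, 1, 0)%nat) (pv (2, 0, 1)%nat)).

Lemma raw_num_w :
  let N := tder_num [] 1 2 3 in
  psub N (padd (pmul (pmul (ppow (Dc [] (jv 1)) 2) raw_jac) (pv (y_jet 4)))
            (subst_y (pv (y_jet 2)) (pv (y_jet 3)) [] N)) = [].
Proof. vm_compute; reflexivity. Qed.

(** The mixed second difference in [y''] and [y'''] isolates their product; the terms with [alpha]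
    and [beta] contain neither and drop out. *)
Lemma raw_num_qs :
  let N q s := subst_y (pc q) (pc s) [] (tder_num [] 1 2 3) in
  psub (psub (padd (N 1%Q 1%Q) (N 0%Q 0%Q)) (padd (N 1%Q 0%Q) (N 0%Q 1%Q)))
    (pscale (-10) (pmul (pv (1, 1, 0)%nat) (pmul (Dc [] (jv 1)) raw_jac))) = [].
Proof. vm_compute; reflexivity. Qed.

(** Compare the coefficients of [y'' y'''] after normalizing that of [y'''']: the given equation has
    [-10 / (p + r)], the transformed one [-10 phi_y / (phi_x + p phi_y)]. One admissible slope [p]
    is enough. *)
Lemma linearizes_foliation c V phi psi alpha beta x y :
  open2 V -> linearizes c V phi psi alpha beta -> V x y ->
  dY phi x y <> 0 /\ dX phi x y = cr c x y * dY phi x y.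
Proof.
  intros HV (Hphi & Hpsi & HJ & Hlin) Hxy.
  set (a := dX phi x y); set (b := dY phi x y); set (r := cr c x y).
  assert (HD : a * dY psi x y - b * dX psi x y <> 0) by exact (HJ x y Hxy).
  (* If [a + p b] vanished at both candidates, then [a = b = 0] and the Jacobian would be zero. *)
  assert (Hp : exists p, p + r <> 0 /\ a + p * b <> 0).
  { destruct (Req_dec (a + (1 - r) * b) 0) as [E1|]; [|exists (1 - r); lra].
    destruct (Req_dec (a + (2 - r) * b) 0) as [E2|]; [|exists (2 - r); lra].
    exfalso; apply HD.
    assert (b = 0) by lra; assert (a = 0) by (subst b; nra).
    rewrite H, H0; ring. }
  destruct Hp as (p & HP & HT).
  set (fld := raw_fld phi psi).
  assert (Hfld : forall f, smooth_on V (fld f)).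
  { intros [|[|[|f]]]; simpl; trivial; apply smooth_on_const; exact HV. }
  set (E := fun q s w P => ev (cjets fld (curve x y p q s w) x) P).
  set (N := tder_num [] 1 2 3).
  assert (HX : forall g, Xop (fun _ _ => 0) g x y = dX g x y)
    by (intros; unfold Xop; ring).
  assert (EJ : forall q s w, E q s w raw_jac = a * dY psi x y - b * dX psi x y).
  { intros; unfold E, raw_jac; rewrite ev_psub, !ev_pmul, !ev_pv.
    unfold cjets; cbn [Nat.eqb]; rewrite curve_start.
    cbn [jets Nat.iter]; simpl.
    change (raw_fld phi psi 0) with (fun _ _ : R => 0).
    now rewrite !HX. }
  assert (ET : forall q s w, E q s w (Dc [] (jv 1)) = a + p * b).
  { intros; unfold E.
    change (Dc [] (jv 1)) with (padd (pv (1, 0, 1)%nat)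
      (pmul (pv P_jet) (pv (1, 1, 0)%nat))).
    rewrite ev_padd, ev_pmul, !ev_pv.
    unfold cjets; cbn [Nat.eqb P_jet]; rewrite curve_start, curve_jet.
    simpl; unfold fld; simpl.
    change (raw_fld phi psi 0) with (fun _ _ : R => 0).
    rewrite HX; unfold a, b; ring. }
  set (cc := alpha (phi x y) * (E 0 0 0 (tder_num [] 1 2 0) / (a + p * b))
             + beta (phi x y) * psi x y).
  assert (HE0 : forall q s w, E q s w (tder_num [] 1 2 0) = E 0 0 0 (tder_num [] 1 2 0)).
  { intros; unfold E.
    change (tder_num [] 1 2 0) with (padd (pv (2, 0, 1)%nat)
      (pmul (pv P_jet) (pv (2, 1, 0)%nat))).
    rewrite !ev_padd, !ev_pmul, !ev_pv.
    unfold cjets; cbn [Nat.eqb P_jet]; now rewrite !curve_start, !curve_jet. }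
  set (D := a * dY psi x y - b * dX psi x y) in *.
  set (M := fun q s => E q s 0 N).
  assert (HN : forall q s w, E q s w N = (a + p * b) ^ 2 * D * w + M q s).
  { intros q s w.
    assert (H0 := f_equal (fun P => ev (cjets fld (curve x y p q s w) x) P) raw_num_w).
    cbv zeta in H0.
    rewrite ev_psub, ev_padd, !ev_pmul, ev_ppow, ev_pv in H0.
    rewrite (ev_subst_y fld x y p q s w q s 0) in H0;
      [| rewrite ev_pv; apply (curve_jet x y p q s w 2)
       | rewrite ev_pv; apply (curve_jet x y p q s w 3) | easy].
    fold N in H0; fold (E q s w N) in H0; fold (M q s) in H0.
    fold (E q s w (Dc [] (jv 1))) in H0; fold (E q s w raw_jac) in H0.
    rewrite ET, EJ in H0.
    replace (cjets fld (curve x y p q s w) x (y_jet 4)) with w in H0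
      by (symmetry; apply (curve_jet x y p q s w 4)).
    change (ev _ []) with 0 in H0; fold D in H0; unfold M, E in *; lra. }
  assert (HM : M 1 1 + M 0 0 - (M 1 0 + M 0 1) = -10 * (b * ((a + p * b) * D))).
  { assert (H0 := f_equal (fun P => ev (cjets fld (curve x y p 0 0 0) x) P) raw_num_qs).
    cbv zeta in H0.
    rewrite !ev_psub, !ev_padd, ev_pscale, !ev_pmul, ev_pv in H0.
    assert (Hsub : forall q s q' s', Q2R q = q' -> Q2R s = s' ->
      ev (cjets fld (curve x y p 0 0 0) x) (subst_y (pc q) (pc s) [] (tder_num [] 1 2 3))
      = M q' s').
    { intros q s q' s' Hq Hs; apply ev_subst_y; rewrite ?ev_pc; easy. }
    pose proof RMicromega.Q2R_0 as Q0; pose proof RMicromega.Q2R_1 as Q1.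
    rewrite (Hsub _ _ _ _ Q1 Q1), (Hsub _ _ _ _ Q0 Q0), (Hsub _ _ _ _ Q1 Q0),
      (Hsub _ _ _ _ Q0 Q1) in H0.
    fold (E 0 0 0 (Dc [] (jv 1))) in H0; fold (E 0 0 0 raw_jac) in H0.
    rewrite ET, EJ in H0; fold D in H0.
    replace (cjets fld (curve x y p 0 0 0) x (1, 1, 0)%nat) with b in H0
      by (unfold cjets; cbn [Nat.eqb]; rewrite curve_start; reflexivity).
    replace (Q2R (-10)) with (-10) in H0 by (unfold Q2R; simpl; lra).
    change (ev _ []) with 0 in H0; lra. }
  set (ode := fun q s => ode_expr c x y p q s 0).
  (* The fourth derivative is chosen so that the curve satisfies the given equation at [x]; hence
     the linear expression vanishes there. *)
  assert (Hw : forall q s, (a + p * b) ^ 2 * D * (- ode q s) + M q s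
                           + cc * (a + p * b) ^ 7 = 0).
  { intros q s; set (w := - ode q s).
    assert (Hode : ode_expr c x y p q s w = 0).
    { transitivity (w + ode q s); [|unfold w; ring].
      unfold ode, ode_expr; ring. }
    destruct (lin_expr_num V HV fld Hfld [] (valid_nil V fld)
      (curve x y p q s w) 1 2 alpha beta x) as [HTd HL].
    - lia.
    - lia.
    - now rewrite curve_start.
    - apply curve_smooth.
    - fold (E q s w (Dc [] (jv 1))) in HTd, HL; rewrite ET in HTd, HL.
      specialize (HL HT).
      fold (E q s w (tder_num [] 1 2 3)) in HL; fold N in HL.
      fold (E q s w (tder_num [] 1 2 0)) in HL.
      rewrite HN, HE0, curve_start in HL.
      change (fld 1%nat) with phi in HL, HTd; change (fld 2%nat) with psi in HL.
      assert (HL0 : lin_expr phi psi alpha beta (curve x y p q s w) x = 0).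
      { apply (Hlin (curve x y p q s w) x).
        - now rewrite curve_start.
        - apply curve_smooth.
        - rewrite curve_jet, curve_start; exact HP.
        - rewrite HTd; exact HT.
        - rewrite curve_start, !curve_jet; exact Hode. }
      rewrite HL0, Rplus_assoc in HL; fold cc in HL.
      revert HL; generalize (M q s) as v, cc as z; intros v z HL.
      transitivity ((((a + p * b) ^ 2 * D * w + v) / (a + p * b) ^ 7 + z)
                    * (a + p * b) ^ 7); [field; exact HT | rewrite <- HL; ring]. }
  assert (Hmix : ode 1 1 + ode 0 0 - (ode 1 0 + ode 0 1) = -10 / (p + r)).
  { unfold ode, ode_expr; fold r; field; exact HP. }
  pose proof (Hw 1 1); pose proof (Hw 0 0); pose proof (Hw 1 0); pose proof (Hw 0 1).
  assert (Hkey : (a + p * b) ^ 2 * D * (-10 / (p + r))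
                 = -10 * (b * ((a + p * b) * D))).
  { rewrite <- Hmix, <- HM; lra. }
  assert (Hfin : a + p * b = b * (p + r)).
  { apply (Rmult_eq_reg_l (-10 * ((a + p * b) * D))).
    - transitivity ((p + r) * ((a + p * b) ^ 2 * D * (-10 / (p + r))));
        [field; exact HP | rewrite Hkey; ring].
    - repeat apply Rmult_integral_contrapositive_currified; trivial; lra. }
  split; [intros Hb; apply HT; rewrite Hfin, Hb; ring | lra].
Qed.

(** * The linear equation in the jets of the transformation *)

Fixpoint ladd {A : Type} (add : A -> A -> A) (a b : list A) : list A :=
  match a, b with
  | [], _ => b
  | _, [] => a
  | x :: a', y :: b' => add x y :: ladd add a' b'
  end.

(* Coefficients of sum l_i (P + r)^i. *)
Fixpoint tshift {A : Type} (add mul : A -> A -> A) (r : A) (l : list A) : list A :=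
  match l with
  | [] => []
  | c :: l' =>
      let s := tshift add mul r l' in ladd add (c :: s) (map (mul r) s)
  end.

(* The coefficients of the equation rewritten in powers of P = y' + r; "fields"
   0 to 19 are r, F0-F2, J0-J4, K0-K7, H0-H2 after this change. *)
Definition low_list (c : coefs) (x y : R) : list R :=
  let sh := tshift Rplus Rmult (- cr c x y) in
  cr c x y :: sh [cF0 c x y; cF1 c x y; cF2 c x y]
  ++ sh [cJ0 c x y; cJ1 c x y; cJ2 c x y; cJ3 c x y; cJ4 c x y]
  ++ sh [cK0 c x y; cK1 c x y; cK2 c x y; cK3 c x y;
         cK4 c x y; cK5 c x y; cK6 c x y; cK7 c x y]
  ++ sh [cH0 c x y; cH1 c x y; cH2 c x y].

Definition low (c : coefs) (i : nat) (x y : R) : R := nth i (low_list c x y) 0.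

Definition ode_P (l : nat -> R) (P q s w : R) : R :=
  P ^ 2 * w + P * (-10 * q + l 3%nat * P ^ 2 + l 2%nat * P + l 1%nat) * s
  + (15 * q ^ 3 + (l 19%nat * P ^ 2 + l 18%nat * P + l 17%nat) * q ^ 2
     + (l 8%nat * P ^ 4 + l 7%nat * P ^ 3 + l 6%nat * P ^ 2 + l 5%nat * P + l 4%nat) * q
     + l 16%nat * P ^ 7 + l 15%nat * P ^ 6 + l 14%nat * P ^ 5 + l 13%nat * P ^ 4
     + l 12%nat * P ^ 3 + l 11%nat * P ^ 2 + l 10%nat * P + l 9%nat).

Lemma ode_expr_P c x y p q s w :
  p + cr c x y <> 0 ->
  ode_expr c x y p q s w
  = ode_P (fun i => low c i x y) (p + cr c x y) q s w / (p + cr c x y) ^ 2.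
Proof.
  intros HP; unfold ode_P, low, low_list.
  cbn [tshift ladd map app nth]; unfold ode_expr; field; exact HP.
Qed.

Lemma ode_P_inj l l' :
  (forall P q s, P <> 0 -> ode_P l P q s 0 = ode_P l' P q s 0) ->
  forall i, (1 <= i < 20)%nat -> l i = l' i.
Proof.
  intros H.
  assert (HP : forall P, P <> 0 ->
    (l 3%nat * P ^ 2 + l 2%nat * P + l 1%nat
     = l' 3%nat * P ^ 2 + l' 2%nat * P + l' 1%nat) /\
    (l 19%nat * P ^ 2 + l 18%nat * P + l 17%nat
     = l' 19%nat * P ^ 2 + l' 18%nat * P + l' 17%nat) /\
    (l 8%nat * P ^ 4 + l 7%nat * P ^ 3 + l 6%nat * P ^ 2 + l 5%nat * P + l 4%nat
     = l' 8%nat * P ^ 4 + l' 7%nat * P ^ 3 + l' 6%nat * P ^ 2 + l' 5%nat * P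
       + l' 4%nat) /\
    (l 16%nat * P ^ 7 + l 15%nat * P ^ 6 + l 14%nat * P ^ 5 + l 13%nat * P ^ 4
     + l 12%nat * P ^ 3 + l 11%nat * P ^ 2 + l 10%nat * P + l 9%nat
     = l' 16%nat * P ^ 7 + l' 15%nat * P ^ 6 + l' 14%nat * P ^ 5
       + l' 13%nat * P ^ 4 + l' 12%nat * P ^ 3 + l' 11%nat * P ^ 2
       + l' 10%nat * P + l' 9%nat)).
  { intros P HP.
    pose proof (H P 0 0 HP) as H0; pose proof (H P 0 1 HP) as H1.
    pose proof (H P 1 0 HP) as H2; pose proof (H P (-1) 0 HP) as H3.
    unfold ode_P in H0, H1, H2, H3; repeat split; try lra.
    apply (Rmult_eq_reg_l P); [lra | exact HP]. }
  (* The degree in [P] is at most seven, so eight nonzero nodes determine all coefficients by linear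
     arithmetic. *)
  destruct (HP 1) as (a1 & b1 & c1 & d1); [lra|].
  destruct (HP (-1)) as (a2 & b2 & c2 & d2); [lra|].
  destruct (HP 2) as (a3 & b3 & c3 & d3); [lra|].
  destruct (HP (-2)) as (a4 & b4 & c4 & d4); [lra|].
  destruct (HP 3) as (a5 & b5 & c5 & d5); [lra|].
  destruct (HP (-3)) as (a6 & b6 & c6 & d6); [lra|].
  destruct (HP 4) as (a7 & b7 & c7 & d7); [lra|].
  destruct (HP (-4)) as (a8 & b8 & c8 & d8); [lra|].
  clear H HP; intros i Hi.
  do 20 (destruct i as [|i]; [try lia; lra|]); lia.
Qed.

Definition ode_mono (i : nat) : mono :=
  if Nat.ltb i 4 then y_jet 3 :: repeat P_jet i
  else if Nat.ltb i 9 then y_jet 2 :: repeat P_jet (i - 4)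
  else if Nat.ltb i 17 then repeat P_jet (i - 9)
  else y_jet 2 :: y_jet 2 :: repeat P_jet (i - 17).

Definition ode_pol (e : nat -> pol) : pol :=
  fold_right (fun i acc => padd (pmul (e i) [(1%Q, ode_mono i)]) acc)
    [(15%Q, [y_jet 2; y_jet 2; y_jet 2]); ((-10)%Q, [y_jet 2; y_jet 3; P_jet]);
     (1%Q, [y_jet 4; P_jet; P_jet])] (seq 1 19).

Lemma ev_ode_pol rho e :
  ev rho (ode_pol e)
  = ode_P (fun i => ev rho (e i)) (rho P_jet) (rho (y_jet 2)) (rho (y_jet 3))
      (rho (y_jet 4)).
Proof.
  unfold ode_pol; cbn [fold_right seq].
  rewrite !ev_padd, !ev_pmul; unfold ode_P, ev; cbn.
  unfold Q2R; cbn [Qnum Qden]; field.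
Qed.

(** Logarithmic derivatives of [m] and [G], and the rescaling of [Y^k psi] by [m^k], make all
    prolongation formulas polynomial: no power of [1/m] or [1/G] survives. *)
Definition n_ : pol := jv 20.
Definition g1_ : pol := jv 21.
Definition g2_ : pol := jv 22.
Definition m_ : pol := jv 23.
Definition G_ : pol := jv 24.
Definition psi_ (k : nat) : pol := jv (25 + k).
Definition r_y : pol := pv (0, 1, 0)%nat.

(* m^k Y^k G / G *)
Fixpoint c_ (k : nat) : pol :=
  match k with
  | O => pc 1
  | S k' => padd (pder yraw (c_ k')) (pmul (psub g2_ (pmul (pz k') n_)) (c_ k'))
  end.

(* Jets of the transformation: "field" 32 is phi, m = phi_y, n = m_y / m,
   G = X psi = - Jac / m, g1 = X G / G, g2 = G_y / G and psi_ k = m^k Y^k psi,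
   where X = d/dx - r d/dy and Y = (1/m) d/dy commute. *)
Definition geo_rules : rules :=
  [((20, 0, 1)%nat, padd (pv (0, 2, 0)%nat) (pmul r_y n_));
   ((22, 0, 1)%nat, padd (pv (21, 1, 0)%nat) (pmul r_y g2_));
   ((23, 1, 0)%nat, pmul n_ m_); ((23, 0, 1)%nat, pmul r_y m_);
   ((24, 1, 0)%nat, pmul g2_ G_); ((24, 0, 1)%nat, pmul g1_ G_);
   ((32, 1, 0)%nat, m_); ((32, 0, 1)%nat, [])]
  ++ map (fun k => ((25 + k, 1, 0)%nat,
       padd (psi_ (S k)) (pmul (pz k) (pmul n_ (psi_ k))))) (seq 0 4)
  ++ map (fun k => ((25 + k, 0, 1)%nat,
       padd (pmul G_ (c_ k)) (pmul (pz k) (pmul r_y (psi_ k))))) (seq 0 5).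

Notation geo_num := (tder_num geo_rules 32 25 3).

Definition P_pow (k : nat) : pol := ppow (pv P_jet) k.

(* (P^7 m^3 psi_4 - geo_num) / (G m^3) *)
Definition geo_quot : pol :=
  map (fun t => (Qopp (fst t), filter (fun v =>
         negb (jeqb v (23, 0, 0)%nat || jeqb v (24, 0, 0)%nat)) (snd t)))
    (psub geo_num (pmul (P_pow 7) (pmul (psi_ 4) (ppow m_ 3)))).

(** Reads off the coefficient of [ode_mono i], separating field jets from curve jets. The extraction
    needs no proof of its own: [geo_num_factor] certifies the outcome. *)
Definition ode_coef (i : nat) : pol :=
  fold_right (fun t acc =>
    let '(f, cv) := partition (fun v : jet => Nat.ltb (fst (fst v)) 50) (snd t) in
    match mcmp cv (ode_mono i) with Eq => padd [(fst t, f)] acc | _ => acc end)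
    [] geo_quot.

(** Once [X phi = 0], the numerator of the fourth derivative has exactly the shape of the given
    class of equations; the terms [-10 y'' y'''] and [15 y''^3] come out automatically. *)
Lemma geo_num_factor :
  psub geo_num (psub (pmul (P_pow 7) (pmul (psi_ 4) (ppow m_ 3)))
                  (pmul (pmul G_ (ppow m_ 3)) (ode_pol ode_coef))) = [].
Proof. vm_compute; reflexivity. Qed.

Lemma geo_T1 : psub (Dc geo_rules (jv 32)) (pmul m_ (pv P_jet)) = [].
Proof. vm_compute; reflexivity. Qed.

Lemma geo_num0 :
  psub (tder_num geo_rules 32 25 0) (padd G_ (pmul (pv P_jet) (psi_ 1))) = [].
Proof. vm_compute; reflexivity. Qed.

Lemma ev_eq rho p q : psub p q = [] -> ev rho p = ev rho q.
Proof.
  intros H; assert (E : ev rho (psub p q) = 0) by now rewrite H.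
  rewrite ev_psub in E; lra.
Qed.

Opaque tder_num ode_coef ode_pol Dc.

Section Geometry.
Variable V : R -> R -> Prop.
Hypothesis HV : open2 V.
Variable fld : nat -> R -> R -> R.
Hypothesis Hfld : forall f, smooth_on V (fld f).
Hypothesis Hgeo : valid V fld geo_rules.
Hypothesis Hm : forall x y, V x y -> fld 23%nat x y <> 0.
Hypothesis HG : forall x y, V x y -> fld 24%nat x y <> 0.
Variables alpha beta : R -> R.

Definition A_val (x y : R) : R := alpha (fld 32%nat x y) * fld 23%nat x y ^ 3.
Definition B_val (x y : R) : R := beta (fld 32%nat x y) * fld 23%nat x y ^ 4.
Definition K_val (x y : R) : R :=
  - (fld 29%nat x y + A_val x y * fld 26%nat x y + B_val x y * fld 25%nat x y)
  / fld 24%nat x y.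

(** After multiplication by [-(m P)^7 / (G m^3)], with [U' = G + P psi_1], the lower terms
    contribute only to [P^6] and [P^7], that is to [K6] and [K7], numbers 15 and 16. *)
Definition lin_coef_val (x y : R) (i : nat) : R :=
  ev (jets fld x y) (ode_coef i)
  - (if Nat.eqb i 15 then A_val x y else 0)
  + (if Nat.eqb i 16 then K_val x y else 0).

Lemma lin_expr_geo y x0 :
  V x0 (y x0) -> curve_smooth_near y x0 ->
  let P := Derive_n y 1 x0 + fld 0%nat x0 (y x0) in
  let m := fld 23%nat x0 (y x0) in
  Derive (fun x => fld 32%nat x (y x)) x0 = m * P /\
  (P <> 0 ->
   lin_expr (fld 32%nat) (fld 25%nat) alpha beta y x0
   = - fld 24%nat x0 (y x0) * m ^ 3 / (m * P) ^ 7
     * ode_P (lin_coef_val x0 (y x0)) P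
         (Derive_n y 2 x0) (Derive_n y 3 x0) (Derive_n y 4 x0)).
Proof.
  intros HVx Hsm P m.
  destruct (lin_expr_num V HV fld Hfld geo_rules Hgeo y 32 25 alpha beta x0)
    as [HT HL]; try lia; trivial.
  set (rho := cjets fld y x0) in *.
  rewrite (ev_eq rho _ _ geo_T1) in HT, HL.
  assert (HmP : ev rho (pmul m_ (pv P_jet)) = m * P)
    by (unfold m_, jv; rewrite ev_pmul, !ev_pv; reflexivity).
  rewrite HmP in HT, HL; split; [exact HT|]; intros HP.
  assert (Hm0 : m <> 0) by now apply Hm.
  assert (HG0 := HG x0 (y x0) HVx).
  rewrite HL by now apply Rmult_integral_contrapositive.
  rewrite (ev_eq rho _ _ geo_num_factor), (ev_eq rho _ _ geo_num0).
  unfold P_pow, psi_, m_, G_, jv.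
  rewrite ev_psub, ev_padd, !ev_pmul, !ev_ppow, !ev_pv, ev_ode_pol.
  change (rho P_jet) with P; change (rho (23, 0, 0)%nat) with m.
  change (rho (y_jet 2)) with (Derive_n y 2 x0).
  change (rho (y_jet 3)) with (Derive_n y 3 x0).
  change (rho (y_jet 4)) with (Derive_n y 4 x0).
  change (rho (24, 0, 0)%nat) with (fld 24%nat x0 (y x0)).
  change (rho (25 + 4, 0, 0)%nat) with (fld 29%nat x0 (y x0)).
  change (rho (25 + 1, 0, 0)%nat) with (fld 26%nat x0 (y x0)).
  replace (ode_P (lin_coef_val x0 (y x0)) P (Derive_n y 2 x0) (Derive_n y 3 x0)
             (Derive_n y 4 x0)) with
    (ode_P (fun i => ev rho (ode_coef i)) P (Derive_n y 2 x0) (Derive_n y 3 x0)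
       (Derive_n y 4 x0) - A_val x0 (y x0) * P ^ 6 + K_val x0 (y x0) * P ^ 7).
  - unfold K_val, A_val, B_val; fold m; field; repeat split; trivial.
  - unfold ode_P, lin_coef_val; cbn [Nat.eqb].
    assert (Ec : forall i, (i < 20)%nat ->
      ev rho (ode_coef i) = ev (jets fld x0 (y x0)) (ode_coef i)).
    { intros i Hi; apply ev_cjets_field, field_only_on_fields.
      do 20 (destruct i as [|i]; [vm_compute; reflexivity|]); lia. }
    rewrite !Ec by lia; ring.
Qed.

Lemma geo_phi x y : V x y ->
  dY (fld 32%nat) x y = fld 23%nat x y /\
  Xop (fld 0%nat) (fld 32%nat) x y = 0 /\
  Xop (fld 0%nat) (fld 25%nat) x y = fld 24%nat x y.
Proof.
  intros Hxy.
  assert (E : forall v p, normal geo_rules (psub (pv v) p) = [] ->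
    jets fld x y v = ev (jets fld x y) p).
  { intros v p Hp; rewrite <- ev_pv.
    now apply (normal_zero V fld geo_rules). }
  split; [|split].
  - change (fld 23%nat x y) with (jets fld x y (23, 0, 0)%nat).
    rewrite <- (ev_pv (jets fld x y)).
    apply (E (32, 1, 0)%nat); vm_compute; reflexivity.
  - apply (E (32, 0, 1)%nat []); vm_compute; reflexivity.
  - change (fld 24%nat x y) with (jets fld x y (24, 0, 0)%nat).
    rewrite <- (ev_pv (jets fld x y)).
    apply (E (25, 0, 1)%nat); vm_compute; reflexivity.
Qed.

Lemma geo_Jac x y : V x y ->
  Jac (fld 32%nat) (fld 25%nat) x y = - (fld 23%nat x y * fld 24%nat x y).
Proof.
  intros Hxy; destruct (geo_phi x y Hxy) as (H1 & H2 & H3).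
  unfold Jac; rewrite <- H3, <- H1; unfold Xop in *.
  replace (dX (fld 32%nat) x y) with (fld 0%nat x y * dY (fld 32%nat) x y) by lra.
  ring.
Qed.

(** The linear expression is a factor without zeros times the equation with coefficients
    [lin_coef_val]. Equal coefficients therefore suffice, and since curves realize every jet they
    are necessary. *)
Lemma linearizes_iff_match c :
  fld 0%nat = cr c ->
  (linearizes c V (fld 32%nat) (fld 25%nat) alpha beta <->
   forall x y, V x y -> forall i, (1 <= i < 20)%nat ->
     low c i x y = lin_coef_val x y i).
Proof.
  intros Hr; split.
  - intros (_ & _ & _ & Hlin) x y Hxy.
    apply (ode_P_inj (fun i => low c i x y) (lin_coef_val x y)); intros P q s HP.
    (* The fourth derivative for which the given equation holds. *)
    set (w := - ode_P (fun i => low c i x y) P q s 0 / P ^ 2).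
    assert (Hw : forall l, ode_P l P q s w = P ^ 2 * w + ode_P l P q s 0)
      by (intros; unfold ode_P; ring).
    set (g := curve x y (P - cr c x y) q s w).
    assert (Eg : g x = y) by apply curve_start.
    assert (EP : Derive_n g 1 x + cr c x y = P)
      by (unfold g; rewrite curve_jet; simpl; ring).
    destruct (lin_expr_geo g x) as [HT HL]; [now rewrite Eg | apply curve_smooth |].
    rewrite Hr, Eg, EP in HT, HL; specialize (HL HP).
    assert (Hm0 := Hm x y Hxy); assert (HG0 := HG x y Hxy).
    assert (H0 : lin_expr (fld 32%nat) (fld 25%nat) alpha beta g x = 0).
    { apply (Hlin g x); rewrite ?Eg, ?EP; trivial.
      - apply curve_smooth.
      - rewrite HT; now apply Rmult_integral_contrapositive.
      - rewrite ode_expr_P, EP; [|rewrite EP; exact HP].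
        unfold g; rewrite !curve_jet; cbn [nth]; rewrite Hw.
        unfold w; field; exact HP. }
    rewrite H0 in HL; symmetry in HL.
    unfold g in HL; rewrite !curve_jet in HL; cbn [nth] in HL.
    apply Rmult_integral in HL as [HL|HL].
    + exfalso; revert HL; unfold Rdiv.
      apply Rmult_integral_contrapositive; split.
      * apply Rmult_integral_contrapositive; split;
          [now apply Ropp_neq_0_compat | now apply pow_nonzero].
      * apply Rinv_neq_0_compat, pow_nonzero.
        now apply Rmult_integral_contrapositive.
    + rewrite Hw in HL.
      apply (Rplus_eq_reg_l (P ^ 2 * w)); rewrite HL.
      unfold w; field; exact HP.
  - intros Hmatch; split; [apply Hfld|]; split; [apply Hfld|]; split.
    + intros x y Hxy; rewrite geo_Jac by exact Hxy.
      apply Ropp_neq_0_compat, Rmult_integral_contrapositive.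
      split; [now apply Hm | now apply HG].
    + intros y x0 HVx Hsm HP HT.
      destruct (lin_expr_geo y x0 HVx Hsm) as [_ HL].
      rewrite Hr in HL; rewrite HL, ode_expr_P by exact HP.
      set (P := Derive_n y 1 x0 + cr c x0 (y x0)) in *.
      assert (E : forall q s w, ode_P (lin_coef_val x0 (y x0)) P q s w
                        = ode_P (fun i => low c i x0 (y x0)) P q s w)
        by (intros; unfold ode_P; rewrite <- !(Hmatch _ _ HVx) by lia; ring).
      rewrite E; set (Z := ode_P _ P _ _ _).
      assert (Hm0 := Hm _ _ HVx); assert (HG0 := HG _ _ HVx).
      assert (HmP : fld 23%nat x0 (y x0) * P <> 0)
        by now apply Rmult_integral_contrapositive.
      split; intros H0.
      * replace Z with (Z / P ^ 2 * P ^ 2) by (field; exact HP).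
        rewrite H0; ring.
      * apply Rmult_integral in H0 as [H0|H0]; [|rewrite H0; field; exact HP].
        exfalso; revert H0; unfold Rdiv.
        apply Rmult_integral_contrapositive; split.
        -- apply Rmult_integral_contrapositive; split;
             [now apply Ropp_neq_0_compat | now apply pow_nonzero].
        -- now apply Rinv_neq_0_compat, pow_nonzero.
Qed.
End Geometry.

(** * The conditions as polynomials in jets *)

(* Polynomial expressions in partial derivatives: [CV i l] is the derivative
   [iter_pd l] of the i-th function of a list. *)
Inductive cexpr :=
| CZ (z : Z) | CV (i : nat) (l : list bool)
| CAdd (a b : cexpr) | CSub (a b : cexpr) | CMul (a b : cexpr)
| COpp (a : cexpr) | CPow (a : cexpr) (n : nat).

Definition sym (syms : list (R -> R -> R)) (i : nat) : R -> R -> R :=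
  nth i syms (fun _ _ => 0).

Fixpoint ceval (syms : list (R -> R -> R)) (x y : R) (e : cexpr) : R :=
  match e with
  | CZ z => IZR z
  | CV i l => iter_pd l (sym syms i) x y
  | CAdd a b => ceval syms x y a + ceval syms x y b
  | CSub a b => ceval syms x y a - ceval syms x y b
  | CMul a b => ceval syms x y a * ceval syms x y b
  | COpp a => - ceval syms x y a
  | CPow a n => ceval syms x y a ^ n
  end.

(** A plain x-derivative is translated as [X + r d/dy]; reducing after every derivation keeps the
    polynomials small. *)
Fixpoint to_pol (rs : rules) (ps : list pol) (e : cexpr) : pol :=
  match e with
  | CZ z => pc (inject_Z z)
  | CV i l =>
      fold_right (fun (d : bool) p =>
        if d then padd (DX rs p) (pmul (jv 0) (Dy rs p)) else Dy rs p)
        (normal rs (nth i ps [])) l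
  | CAdd a b => padd (to_pol rs ps a) (to_pol rs ps b)
  | CSub a b => psub (to_pol rs ps a) (to_pol rs ps b)
  | CMul a b => pmul (to_pol rs ps a) (to_pol rs ps b)
  | COpp a => pscale (-1) (to_pol rs ps a)
  | CPow a n => ppow (to_pol rs ps a) n
  end.

Ltac index_of g l :=
  match l with
  | g :: _ => constr:(0%nat)
  | _ :: ?t => let n := index_of g t in constr:(S n)
  end.

Ltac derivation_list g :=
  lazymatch g with
  | dX ?h => let l := derivation_list h in constr:(true :: l)
  | dY ?h => let l := derivation_list h in constr:(false :: l)
  | _ => constr:(@nil bool)
  end.

Ltac derived_symbol g :=
  lazymatch g with
  | dX ?h => derived_symbol h
  | dY ?h => derived_symbol h
  | _ => g
  end.

Ltac reify_expr syms t :=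
  lazymatch t with
  | Rplus ?a ?b =>
      let a' := reify_expr syms a in let b' := reify_expr syms b in constr:(CAdd a' b')
  | Rminus ?a ?b =>
      let a' := reify_expr syms a in let b' := reify_expr syms b in constr:(CSub a' b')
  | Rmult ?a ?b =>
      let a' := reify_expr syms a in let b' := reify_expr syms b in constr:(CMul a' b')
  | Ropp ?a => let a' := reify_expr syms a in constr:(COpp a')
  | pow ?a ?n => let a' := reify_expr syms a in constr:(CPow a' n)
  | IZR ?z => constr:(CZ z)
  | ?g _ _ =>
      let s := derived_symbol g in let i := index_of s syms in
      let l := derivation_list g in constr:(CV i l)
  end.

Ltac reify_eqs syms t :=
  lazymatch t with
  | ?a = ?b /\ ?u =>
      let a' := reify_expr syms a in let b' := reify_expr syms b in
      let u' := reify_eqs syms u in constr:((a', b') :: u')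
  | ?a = ?b =>
      let a' := reify_expr syms a in let b' := reify_expr syms b in constr:([(a', b')])
  end.

Definition coef_list (c : coefs) : list (R -> R -> R) :=
  [cr c; cF0 c; cF1 c; cF2 c; cJ0 c; cJ1 c; cJ2 c; cJ3 c; cJ4 c;
   cK0 c; cK1 c; cK2 c; cK3 c; cK4 c; cK5 c; cK6 c; cK7 c; cH0 c; cH1 c; cH2 c].

(** The change of coefficients inverse to [low]: substituting [P = y' + r] is a shift by [r],
    undoing the shift by [-r]. *)
Definition upper : list pol :=
  let sh := tshift padd pmul (jv 0) in
  jv 0 :: sh (map jv [1; 2; 3]%nat) ++ sh (map jv [4; 5; 6; 7; 8]%nat)
  ++ sh (map jv [9; 10; 11; 12; 13; 14; 15; 16]%nat)
  ++ sh (map jv [17; 18; 19]%nat).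

(** Obtained by reifying the body of [conditions], so that no equation is transcribed by hand; the
    symbols are treated under binders, which are stripped at the end. *)
Definition cond_eqs : list (cexpr * cexpr) :=
  ltac:(let f := constr:(fun (c : coefs) (x y : R) => ltac:(
          let t := eval cbv beta zeta delta [conditions] in (conditions c x y) in
          let s := eval cbv beta delta [coef_list] in (coef_list c) in
          let l := reify_eqs s t in exact l)) in
        lazymatch f with fun _ _ _ => ?l => exact l end).

Definition theta_expr : cexpr :=
  ltac:(let f := constr:(fun (c : coefs) (x y : R) => ltac:(
          let t := eval cbv beta zeta delta [Theta] in (Theta c x y) in
          let s := eval cbv beta delta [coef_list] in (coef_list c) in
          let l := reify_expr s t in exact l)) in
        lazymatch f with fun _ _ _ => ?l => exact l end).

Lemma Theta_eval c x y : Theta c x y = ceval (coef_list c) x y theta_expr.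
Proof. reflexivity. Qed.

Lemma conditions_eval c x y :
  conditions c x y <->
  (forall a b, In (a, b) cond_eqs ->
     ceval (coef_list c) x y a = ceval (coef_list c) x y b).
Proof.
  assert (H : forall l, (forall a b, In (a, b) l ->
      ceval (coef_list c) x y a = ceval (coef_list c) x y b) <->
    fold_right (fun ab (P : Prop) => ceval (coef_list c) x y (fst ab)
                        = ceval (coef_list c) x y (snd ab) /\ P) True l).
  { induction l as [|[a b] l IH]; simpl; [now split|].
    rewrite <- IH; split.
    - intros H; split; [apply H; now left | intros; apply H; now right].
    - intros [H1 H2] a' b' [E|Hin]; [now inversion E; subst | now apply H2]. }
  rewrite H; unfold conditions; cbv zeta.
  cbn [cond_eqs fold_right fst snd ceval sym coef_list nth iter_pd pd]; tauto.
Qed.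

Section Expressions.
Variable V : R -> R -> Prop.
Hypothesis HV : open2 V.
Variable fld : nat -> R -> R -> R.
Hypothesis Hfld : forall f, smooth_on V (fld f).
Variable rs : rules.
Hypothesis Hrs : valid V fld rs.
Variable syms : list (R -> R -> R).
Variable ps : list pol.
Hypothesis Hsyms : forall i x y, V x y ->
  sym syms i x y = ev (jets fld x y) (nth i ps []).

Lemma to_pol_sound e x y :
  V x y -> ceval syms x y e = ev (jets fld x y) (to_pol rs ps e).
Proof.
  intros Hxy; induction e as [z|i l|a IHa b IHb|a IHa b IHb|a IHa b IHb|a IHa|a IHa n];
    cbn [ceval to_pol].
  - rewrite ev_pc; unfold Q2R, inject_Z; cbn [Qnum Qden]; field.
  - revert x y Hxy; induction l as [|d l IH]; intros x y Hxy; cbn [iter_pd fold_right].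
    + rewrite (normal_sound V HV fld Hfld rs Hrs) by exact Hxy; now apply Hsyms.
    + set (q := fold_right _ _ l) in *.
      fold (iter_pd l (sym syms i)).
      assert (EX : dX (iter_pd l (sym syms i)) x y
                   = dX (fun x y => ev (jets fld x y) q) x y)
        by (apply (dX_eq_on V HV); trivial).
      assert (EY : dY (iter_pd l (sym syms i)) x y
                   = dY (fun x y => ev (jets fld x y) q) x y)
        by (apply (dY_eq_on V HV); trivial).
      destruct d; cbn [pd].
      * rewrite ev_padd, ev_pmul, (Dy_sound V HV fld Hfld rs Hrs),
          (DX_sound V HV fld Hfld rs Hrs), EX by exact Hxy.
        unfold Xop, jv; rewrite ev_pv; cbn [jets Nat.iter]; simpl; ring.
      * now rewrite (Dy_sound V HV fld Hfld rs Hrs), EY by exact Hxy.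
  - now rewrite ev_padd, IHa, IHb.
  - now rewrite ev_psub, IHa, IHb.
  - now rewrite ev_pmul, IHa, IHb.
  - rewrite ev_pscale, IHa; unfold Q2R; simpl; field.
  - now rewrite ev_ppow, IHa.
Qed.

Lemma ceval_eq a b x y :
  V x y -> psub (to_pol rs ps a) (to_pol rs ps b) = [] ->
  ceval syms x y a = ceval syms x y b.
Proof. intros Hxy H; rewrite !to_pol_sound by exact Hxy; now apply ev_eq. Qed.
End Expressions.

Lemma low_upper c fld x y :
  fld 0%nat = cr c -> (forall i, (i < 20)%nat -> fld i x y = low c i x y) ->
  forall i, sym (coef_list c) i x y = ev (jets fld x y) (nth i upper []).
Proof.
  intros Hr Hlow i.
  assert (E : forall k, (k < 20)%nat -> ev (jets fld x y) (jv k) = low c k x y)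
    by (intros k Hk; unfold jv; rewrite ev_pv; now apply Hlow).
  destruct (Nat.lt_ge_cases i 20) as [Hi|Hi].
  - do 20 (destruct i as [|i]; [
      unfold upper, sym, coef_list; cbn [map tshift ladd app nth];
      rewrite ?ev_padd, ?ev_pmul, ?ev_padd, ?ev_pmul, ?ev_padd, ?ev_pmul,
        ?ev_padd, ?ev_pmul, ?ev_padd, ?ev_pmul, ?ev_padd, ?ev_pmul,
        ?ev_padd, ?ev_pmul, ?ev_padd, ?ev_pmul, !E by lia;
      unfold low, low_list; cbn [tshift ladd map app nth]; ring|]); lia.
  - unfold sym; rewrite !nth_overflow; [reflexivity | exact Hi | exact Hi].
Qed.

(** Conditions are numbered from 1, hence [i - 1]. Out of range the result is the zero polynomial, a
    true relation. *)
Definition cond_pol (rs : rules) (i : nat) : pol :=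
  match nth_error cond_eqs (i - 1) with
  | Some (a, b) => psub (to_pol rs upper a) (to_pol rs upper b)
  | None => []
  end.

Definition solve_cond (rs : rules) (s : nat * jet) : rules :=
  rs ++ [(snd s, solve_for (snd s) (cond_pol rs (fst s)))].

(* The conditions solved one after the other, each for the jet it determines;
   the X-derivative of the first condition gives X J3. *)
Definition cond_rules : rules :=
  let rs := fold_left solve_cond
    [(2, (0, 0, 1)); (3, (19, 0, 0)); (4, (18, 0, 0)); (5, (17, 0, 0));
     (7, (3, 0, 1)); (8, (2, 0, 1)); (9, (1, 0, 1)); (10, (4, 0, 0));
     (1, (0, 2, 0)); (13, (8, 0, 1)); (6, (2, 2, 0)); (14, (1, 2, 0))]%nat [] in
  let rs := rs ++ [((7, 0, 1)%nat,
    solve_for (7, 0, 1)%nat (compat rs (0, 2, 0)%nat))] in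
  fold_left solve_cond
    [(15, (6, 0, 1)); (16, (5, 0, 1)); (17, (10, 0, 0)); (18, (9, 0, 0));
     (11, (15, 0, 1)); (12, (16, 0, 2))]%nat rs.

Section Conditions.
Variable V : R -> R -> Prop.
Hypothesis HV : open2 V.
Variable fld : nat -> R -> R -> R.
Hypothesis Hfld : forall f, smooth_on V (fld f).
Variable c : coefs.
Hypothesis Hr : fld 0%nat = cr c.
Hypothesis Hlow : forall i x y, V x y -> (i < 20)%nat -> fld i x y = low c i x y.

Lemma cond_pol_sound rs i x y :
  valid V fld rs -> (forall x y, V x y -> conditions c x y) -> V x y ->
  ev (jets fld x y) (cond_pol rs i) = 0.
Proof.
  intros Hrs Hc Hxy; unfold cond_pol.
  destruct (nth_error cond_eqs (i - 1)) as [[a b]|] eqn:E; [|easy].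
  assert (Hs : forall i x y, V x y ->
    sym (coef_list c) i x y = ev (jets fld x y) (nth i upper []))
    by (intros; apply low_upper; auto).
  rewrite ev_psub.
  rewrite <- !(to_pol_sound V HV fld Hfld rs Hrs (coef_list c) upper Hs) by exact Hxy.
  apply Rminus_diag_eq, conditions_eval; [now apply Hc|].
  now apply nth_error_In in E.
Qed.

Lemma cond_rules_valid :
  (forall x y, V x y -> conditions c x y) -> valid V fld cond_rules.
Proof.
  intros Hc.
  assert (Hf : forall l rs, valid V fld rs -> valid V fld (fold_left solve_cond l rs)).
  { induction l as [|s l IH]; intros rs Hrs; [exact Hrs|].
    apply IH, valid_solve; [exact Hrs|].
    intros; now apply cond_pol_sound. }
  apply Hf, valid_solve; [apply Hf, valid_nil|].
  intros; apply (compat_sound V HV fld Hfld); [apply Hf, valid_nil | easy].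
Qed.

Lemma conditions_of_rules rs x y :
  valid V fld rs -> V x y ->
  forallb (fun ab => match psub (to_pol rs upper (fst ab)) (to_pol rs upper (snd ab))
                     with [] => true | _ => false end) cond_eqs = true ->
  conditions c x y.
Proof.
  intros Hrs Hxy H; apply conditions_eval; intros a b Hin.
  rewrite forallb_forall in H; specialize (H _ Hin); cbn [fst snd] in H.
  apply (ceval_eq V HV fld Hfld rs Hrs (coef_list c) upper); [|exact Hxy|].
  - intros; apply low_upper; auto.
  - now destruct (psub _ _).
Qed.
End Conditions.

Lemma ev_tshift rho r l :
  map (ev rho) (tshift padd pmul r l)
  = tshift Rplus Rmult (ev rho r) (map (ev rho) l).
Proof.
  assert (Hadd : forall a b, map (ev rho) (ladd padd a b)
                   = ladd Rplus (map (ev rho) a) (map (ev rho) b)).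
  { induction a as [|p a IH]; intros [|q b]; cbn [ladd map]; trivial.
    now rewrite ev_padd, IH. }
  induction l as [|p l IH]; cbn [tshift map]; [easy|].
  rewrite Hadd; cbn [map]; rewrite IH; f_equal.
  rewrite map_map, <- IH, map_map; apply map_ext; intros q; apply ev_pmul.
Qed.

Lemma smooth_low c V i : open2 V -> coefs_smooth_on V c -> smooth_on V (low c i).
Proof.
  intros HV Hc.
  assert (Hs : forall k, smooth_on V (sym (coef_list c) k)).
  { unfold coefs_smooth_on in Hc; decompose [and] Hc; intros k.
    do 20 (destruct k as [|k]; [assumption|]).
    unfold sym; rewrite nth_overflow by (simpl; lia); now apply smooth_on_const. }
  set (rho := fun x y (v : jet) => sym (coef_list c) (fst (fst v)) x y).
  set (sh := tshift padd pmul (pscale (-1) (jv 0))).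
  set (lower := jv 0 :: sh (map jv [1; 2; 3]%nat) ++ sh (map jv [4; 5; 6; 7; 8]%nat)
    ++ sh (map jv [9; 10; 11; 12; 13; 14; 15; 16]%nat) ++ sh (map jv [17; 18; 19]%nat)).
  apply (smooth_on_ext V HV (fun x y => ev (rho x y) (nth i lower []))).
  - intros x y _; unfold low.
    replace (low_list c x y) with (map (ev (rho x y)) lower).
    + change 0 with (ev (rho x y) []); now rewrite map_nth.
    + unfold lower, sh; cbn [map]; rewrite !map_app, !ev_tshift, ev_pscale.
      unfold jv; cbn [map]; rewrite !ev_pv.
      replace (Q2R (-1) * _) with (- cr c x y); [reflexivity|].
      change (rho x y (0, 0, 0)%nat) with (cr c x y).
      unfold Q2R; cbn [Qnum Qden Qopp]; field.
  - apply smooth_on_ev; [exact HV | intros v; apply Hs].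
Qed.

(** * Extending and reducing systems of relations *)

Definition upd (fld : nat -> R -> R -> R) (l : list (nat * (R -> R -> R))) :
    nat -> R -> R -> R :=
  fun k => match find (fun t => Nat.eqb (fst t) k) l with
           | Some t => snd t | None => fld k end.

Definition avoids (fs : list nat) (p : pol) : bool :=
  forallb (fun t => forallb (fun v : jet =>
    negb (existsb (fun f => Nat.eqb f (fst (fst v))) fs)) (snd t)) p.

Definition rules_avoid (fs : list nat) (rs : rules) : bool :=
  forallb (fun t => avoids fs (pv (fst t)) && avoids fs (snd t)) rs.

Definition holds_in (R1 R2 : rules) : bool :=
  forallb (fun t => match normal R1 (psub (pv (fst t)) (snd t)) with
                    | [] => true | _ => false end) R2.

Section Extension.
Variable V : R -> R -> Prop.
Hypothesis HV : open2 V.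
Variable fld : nat -> R -> R -> R.
Hypothesis Hfld : forall f, smooth_on V (fld f).

Lemma upd_other l k :
  existsb (fun f => Nat.eqb f k) (map fst l) = false -> upd fld l k = fld k.
Proof.
  unfold upd; induction l as [|[f g] l IH]; [easy|]; cbn [map existsb find fst].
  destruct (Nat.eqb f k); [discriminate | exact IH].
Qed.

Lemma smooth_upd l :
  (forall t, In t l -> smooth_on V (snd t)) -> forall k, smooth_on V (upd fld l k).
Proof.
  intros Hl k; unfold upd; destruct (find _ l) as [t|] eqn:E; [|apply Hfld].
  apply find_some in E; now apply Hl.
Qed.

Lemma ev_upd l x y p :
  existsb (fun f => Nat.eqb f 0) (map fst l) = false ->
  avoids (map fst l) p = true -> ev (jets (upd fld l) x y) p = ev (jets fld x y) p.
Proof.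
  intros H0; induction p as [|[c m] p IH]; [easy|]; intros H.
  cbn [avoids forallb snd] in H; apply Bool.andb_true_iff in H as [Hm Hp].
  rewrite !ev_cons, IH by exact Hp; f_equal; f_equal; clear -H0 Hm.
  induction m as [|[[k a] b] m IH]; [easy|].
  cbn [forallb fst] in Hm; apply Bool.andb_true_iff in Hm as [Hk Hm].
  cbn [evm fold_right]; fold (evm (jets (upd fld l) x y) m).
  fold (evm (jets fld x y) m); rewrite IH by exact Hm; f_equal.
  unfold jets; apply Bool.negb_true_iff in Hk.
  now rewrite !upd_other.
Qed.

Lemma valid_upd l rs :
  existsb (fun f => Nat.eqb f 0) (map fst l) = false ->
  rules_avoid (map fst l) rs = true -> valid V fld rs -> valid V (upd fld l) rs.
Proof.
  intros H0 Hav Hrs v e Hin x y Hxy.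
  unfold rules_avoid in Hav; rewrite forallb_forall in Hav.
  specialize (Hav _ Hin); apply Bool.andb_true_iff in Hav as [Hv He]; cbn [fst snd] in *.
  rewrite <- (ev_pv (jets (upd fld l) x y)), !ev_upd, ev_pv by trivial.
  now apply Hrs.
Qed.

(** A name for the value of [p]. The number [f] must be fresh, and not 0, since field 0 determines
    the operator X. *)
Lemma valid_abbrev f p rs :
  Nat.eqb f 0 = false -> avoids [f] p = true -> rules_avoid [f] rs = true ->
  valid V fld rs ->
  valid V (upd fld [(f, fun x y => ev (jets fld x y) p)]) (((f, 0, 0)%nat, p) :: rs).
Proof.
  intros Hf Hp Hav Hrs.
  assert (H0 : existsb (fun g => Nat.eqb g 0) [f] = false)
    by (cbn [existsb]; now rewrite Hf).
  apply valid_cons; [|now apply valid_upd].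
  intros x y Hxy; rewrite ev_upd by trivial.
  unfold jets, upd; cbn [Nat.iter find fst]; now rewrite Nat.eqb_refl.
Qed.

Lemma valid_sub W rs :
  (forall x y, W x y -> V x y) -> valid V fld rs -> valid W fld rs.
Proof. intros HW Hrs v e Hin x y Hxy; apply Hrs; auto. Qed.

Lemma valid_by_normal R1 R2 :
  valid V fld R1 -> holds_in R1 R2 = true -> valid V fld R2.
Proof.
  intros H1 H v e Hin x y Hxy.
  unfold holds_in in H; rewrite forallb_forall in H; specialize (H _ Hin).
  cbn [fst snd] in H; rewrite <- (ev_pv (jets fld x y)).
  apply (normal_zero V fld R1); trivial.
  now destruct (normal R1 (psub (pv v) e)).
Qed.

(* From p = 0, q = 0 and p = d (v - e) + h q with d <> 0. *)
Lemma valid_divide rs d v e p h q :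
  valid V fld rs ->
  (forall x y, V x y -> ev (jets fld x y) p = 0) ->
  (forall x y, V x y -> ev (jets fld x y) q = 0) ->
  (forall x y, V x y -> ev (jets fld x y) d <> 0) ->
  normal rs (psub p (padd (pmul d (psub (pv v) e)) (pmul h q))) = [] ->
  valid V fld ((v, e) :: rs).
Proof.
  intros Hrs Hp Hq Hd H; apply valid_cons; [|exact Hrs]; intros x y Hxy.
  assert (E := normal_zero V fld rs _ _ x y HV Hfld Hrs Hxy H).
  rewrite ev_padd, !ev_pmul, ev_psub, ev_pv, Hp, Hq in E by exact Hxy.
  apply Rminus_diag_uniq, (Rmult_eq_reg_l (ev (jets fld x y) d)); [lra | auto].
Qed.

(** Turns an integrability condition into a rule after removing a factor without zeros. *)
Lemma valid_compat rs d v e w :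
  valid V fld rs -> (forall x y, V x y -> ev (jets fld x y) d <> 0) ->
  normal rs (psub (compat rs w) (pmul d (psub (pv v) e))) = [] ->
  valid V fld ((v, e) :: rs).
Proof.
  intros Hrs Hd H; apply valid_cons; [|exact Hrs]; intros x y Hxy.
  assert (E := normal_zero V fld rs _ _ x y HV Hfld Hrs Hxy H).
  rewrite (compat_sound V HV fld Hfld rs Hrs), ev_pmul, ev_psub, ev_pv in E by exact Hxy.
  apply Rminus_diag_uniq, (Rmult_eq_reg_l (ev (jets fld x y) d)); [lra | auto].
Qed.
End Extension.

Definition base_rules : rules :=
  [((32, 1, 0)%nat, m_); ((32, 0, 1)%nat, []); ((23, 1, 0)%nat, pmul n_ m_);
   ((24, 1, 0)%nat, pmul g2_ G_); ((24, 0, 1)%nat, pmul g1_ G_); ((25, 0, 1)%nat, G_)]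
  ++ map (fun k => ((25 + k, 1, 0)%nat,
       padd (psi_ (S k)) (pmul (pz k) (pmul n_ (psi_ k))))) (seq 0 4).

(** The rules missing from [base_rules] are integrability conditions: for instance [phi_y = m] and
    [X phi = 0] give [X m = r_y m], and each [X psi_k] follows from the preceding one. *)
Lemma geo_valid V fld :
  open2 V -> (forall f, smooth_on V (fld f)) -> valid V fld base_rules ->
  (forall x y, V x y -> fld 23%nat x y <> 0) ->
  (forall x y, V x y -> fld 24%nat x y <> 0) ->
  valid V fld geo_rules.
Proof.
  intros HV Hfld H0 Hm HG.
  assert (H1 : forall x y, V x y -> ev (jets fld x y) (pc 1) <> 0)
    by (intros; rewrite ev_pc, RMicromega.Q2R_1; lra).
  assert (Hm' : forall x y, V x y -> ev (jets fld x y) m_ <> 0)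
    by (intros; unfold m_, jv; rewrite ev_pv; now apply Hm).
  assert (HG' : forall x y, V x y -> ev (jets fld x y) G_ <> 0)
    by (intros; unfold G_, jv; rewrite ev_pv; now apply HG).
  apply (valid_compat V HV fld Hfld _ (pc 1) (23, 0, 1)%nat (pmul r_y m_)
           (32, 1, 0)%nat) in H0; [|exact H1 | vm_compute; reflexivity].
  apply (valid_compat V HV fld Hfld _ m_ (20, 0, 1)%nat
           (padd (pv (0, 2, 0)%nat) (pmul r_y n_)) (23, 1, 0)%nat) in H0;
    [|exact Hm' | vm_compute; reflexivity].
  apply (valid_compat V HV fld Hfld _ G_ (22, 0, 1)%nat
           (padd (pv (21, 1, 0)%nat) (pmul r_y g2_)) (24, 1, 0)%nat) in H0;
    [|exact HG' | vm_compute; reflexivity].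
  apply (valid_compat V HV fld Hfld _ (pc 1) (26, 0, 1)%nat
           (padd (pmul G_ (c_ 1)) (pmul (pz 1) (pmul r_y (psi_ 1)))) (25, 1, 0)%nat)
    in H0; [|exact H1 | vm_compute; reflexivity].
  apply (valid_compat V HV fld Hfld _ (pc 1) (27, 0, 1)%nat
           (padd (pmul G_ (c_ 2)) (pmul (pz 2) (pmul r_y (psi_ 2)))) (26, 1, 0)%nat)
    in H0; [|exact H1 | vm_compute; reflexivity].
  apply (valid_compat V HV fld Hfld _ (pc 1) (28, 0, 1)%nat
           (padd (pmul G_ (c_ 3)) (pmul (pz 3) (pmul r_y (psi_ 3)))) (27, 1, 0)%nat)
    in H0; [|exact H1 | vm_compute; reflexivity].
  apply (valid_compat V HV fld Hfld _ (pc 1) (29, 0, 1)%nat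
           (padd (pmul G_ (c_ 4)) (pmul (pz 4) (pmul r_y (psi_ 4)))) (28, 1, 0)%nat)
    in H0; [|exact H1 | vm_compute; reflexivity].
  apply (valid_by_normal V HV fld Hfld _ geo_rules H0); vm_compute; reflexivity.
Qed.

(** * Necessity *)

Ltac each_rule :=
  first [apply valid_nil | apply valid_cons; [intros x y Hxy | each_rule]].

(* "Fields" 30 and 31 are alpha o phi and beta o phi. *)
Definition A_ : pol := pmul (jv 30) (ppow m_ 3).
Definition B_ : pol := pmul (jv 31) (ppow m_ 4).

(* The last equation of the system: K7 G + psi_4 + A psi_1 + B psi_0 = 0. *)
Definition psi_eq : pol :=
  padd (pmul (jv 16) G_) (padd (psi_ 4) (padd (pmul A_ (psi_ 1)) (pmul B_ (psi_ 0)))).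

Definition coef_rule (i : nat) : jet * pol :=
  ((i, 0, 0)%nat, if Nat.eqb i 15 then psub (ode_coef i) A_ else ode_coef i).

(** [psi_eq] is solved for [psi_4] and not for [K7], which would require a division by [G]. Thus
    [K7] stays a free jet, restricted only by the formula for [X K7] that the X-derivative of
    [psi_eq] implies. *)
Definition trans_rules : rules :=
  [((29, 0, 0)%nat, psub (psi_ 4) psi_eq);
   ((30, 0, 1)%nat, []); ((31, 0, 1)%nat, []);
   ((16, 0, 1)%nat, psub (pmul (psub (pmul (pz 4) r_y) g1_) (jv 16))
                         (padd (c_ 4) (padd (pmul A_ g2_) B_)))]
  ++ map coef_rule (seq 1 15 ++ [17; 18; 19]%nat) ++ geo_rules.

(** [m^k Y^k psi] without division: from [m_y = n m], [m^k d/dy (m^(-k) g) = g_y - k n g]. *)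
Fixpoint hat (n psi : R -> R -> R) (k : nat) : R -> R -> R :=
  match k with
  | O => psi
  | S k' => fun x y => dY (hat n psi k') x y - INR k' * (n x y * hat n psi k' x y)
  end.

Definition trans_fld (c : coefs) (phi psi : R -> R -> R) (f : nat) : R -> R -> R :=
  let m := dY phi in
  let G := Xop (cr c) psi in
  let n := fun x y => dY m x y * / m x y in
  if Nat.ltb f 20 then low c f else
  match f with
  | 20%nat => n
  | 21%nat => fun x y => Xop (cr c) G x y * / G x y
  | 22%nat => fun x y => dY G x y * / G x y
  | 23%nat => m
  | 24%nat => G
  | 25%nat => hat n psi 0
  | 26%nat => hat n psi 1
  | 27%nat => hat n psi 2
  | 28%nat => hat n psi 3
  | 29%nat => hat n psi 4
  | 32%nat => phi
  | _ => fun _ _ => 0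
  end.

Section Transformation.
Variables (c : coefs) (V : R -> R -> Prop) (phi psi : R -> R -> R).
Variables (alpha beta : R -> R).
Hypothesis HV : open2 V.
Hypothesis Hc : coefs_smooth_on V c.
Hypothesis Hlin : linearizes c V phi psi alpha beta.

Let m := dY phi.
Let G := Xop (cr c) psi.
Let fld := trans_fld c phi psi.

Lemma trans_level x y : V x y -> m x y <> 0 /\ dX phi x y = cr c x y * m x y.
Proof. intros Hxy; now apply (linearizes_foliation c V phi psi alpha beta). Qed.

Lemma trans_G x y : V x y -> G x y <> 0.
Proof.
  intros Hxy; destruct (trans_level x y Hxy) as [_ Hr]; unfold m in Hr.
  destruct Hlin as (_ & _ & HJ & _).
  intros H0; apply (HJ x y Hxy); unfold Jac; rewrite Hr.
  unfold G, Xop in H0.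
  transitivity (- dY phi x y * (dX psi x y - cr c x y * dY psi x y)); [ring|].
  rewrite H0; ring.
Qed.

Lemma trans_smooth f : smooth_on V (fld f).
Proof.
  destruct Hlin as (Hphi & Hpsi & _).
  assert (Hcr : smooth_on V (cr c)) by apply Hc.
  assert (Hm : smooth_on V m) by now apply smooth_on_dY.
  assert (HX : forall g, smooth_on V g -> smooth_on V (Xop (cr c) g)).
  { intros g Hg; apply smooth_on_minus; [exact HV | now apply smooth_on_dX |].
    apply smooth_on_mult; [exact HV | exact Hcr | now apply smooth_on_dY]. }
  assert (HGs : smooth_on V G) by now apply HX.
  assert (Hdiv : forall a b, smooth_on V a -> smooth_on V b ->
    (forall x y, V x y -> b x y <> 0) -> smooth_on V (fun x y => a x y * / b x y)).
  { intros a b Ha Hb H0; apply smooth_on_mult; [exact HV | exact Ha|].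
    now apply smooth_on_inv. }
  assert (Hn : smooth_on V (fun x y => dY m x y * / m x y)).
  { apply Hdiv; [now apply smooth_on_dY | exact Hm | intros; now apply trans_level]. }
  assert (Hhat : forall k, smooth_on V (hat (fun x y => dY m x y * / m x y) psi k)).
  { induction k as [|k IH]; [exact Hpsi|].
    apply smooth_on_minus; [exact HV | now apply smooth_on_dY |].
    apply (smooth_on_mult V HV (fun _ _ => INR k)); [now apply smooth_on_const|].
    now apply smooth_on_mult. }
  unfold fld, trans_fld; fold m; fold G.
  assert (H0 : smooth_on V (fun _ _ => 0)) by now apply smooth_on_const.
  destruct (Nat.ltb f 20) eqn:E; [now apply smooth_low|].
  do 20 (destruct f as [|f]; [discriminate E|]).
  destruct f as [|f]; [exact Hn|].
  destruct f as [|f]; [apply (Hdiv _ G); [now apply HX | exact HGs | exact trans_G]|].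
  destruct f as [|f];
    [apply (Hdiv _ G); [now apply smooth_on_dY | exact HGs | exact trans_G]|].
  destruct f as [|f]; [exact Hm|].
  destruct f as [|f]; [exact HGs|].
  destruct f as [|f]; [apply (Hhat 0%nat)|].
  destruct f as [|f]; [apply (Hhat 1%nat)|].
  destruct f as [|f]; [apply (Hhat 2%nat)|].
  destruct f as [|f]; [apply (Hhat 3%nat)|].
  destruct f as [|f]; [apply (Hhat 4%nat)|].
  destruct f as [|[|[|f]]]; [exact H0 | exact H0 | exact Hphi | exact H0].
Qed.

Lemma trans_geo : valid V fld geo_rules.
Proof.
  apply geo_valid; [exact HV | apply trans_smooth | | | exact trans_G];
    [| intros; now apply trans_level].
  assert (Hdiv : forall a b, b <> 0 -> a = a * / b * b) by (intros; field; easy).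
  assert (Hhat : forall k n f, f = hat n psi k ->
    forall x y, dY f x y = hat n psi (S k) x y + INR k * (n x y * f x y))
    by (intros k n f -> x y; cbn [hat]; ring).
  unfold base_rules; cbn [map seq app].
  each_rule;
    destruct (trans_level x y Hxy) as [Hm0 Hr]; pose proof (trans_G x y Hxy) as HG0;
    unfold m_, n_, G_, g1_, g2_, psi_, jv; rewrite ?ev_padd, ?ev_pmul, ?ev_pz, ?ev_pv.
  - reflexivity.
  - change (Xop (cr c) phi x y = 0); unfold Xop; fold m; rewrite Hr; ring.
  - now apply Hdiv.
  - now apply Hdiv.
  - now apply Hdiv.
  - reflexivity.
  - now apply (Hhat 0%nat).
  - now apply (Hhat 1%nat).
  - now apply (Hhat 2%nat).
  - now apply (Hhat 3%nat).
Qed.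

Lemma trans_match i x y :
  (1 <= i < 20)%nat -> V x y -> low c i x y = lin_coef_val fld alpha beta x y i.
Proof.
  intros Hi Hxy.
  apply (linearizes_iff_match V HV fld trans_smooth trans_geo); trivial.
  - intros; now apply trans_level.
  - exact trans_G.
Qed.

(** The coefficient of [P^6] solved for [alpha]. This expression in jets is visibly smooth, which
    [alpha (phi x y)] is not. *)
Definition alpha_phi (x y : R) : R :=
  (ev (jets fld x y) (ode_coef 15) - low c 15 x y) * / m x y ^ 3.

Lemma alpha_phi_eq x y : V x y -> alpha_phi x y = alpha (phi x y).
Proof.
  intros Hxy; unfold alpha_phi.
  rewrite (trans_match 15 x y) by (trivial; lia).
  unfold lin_coef_val, A_val; cbn [Nat.eqb].
  change (fld 32%nat) with phi; change (fld 23%nat) with m.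
  destruct (trans_level x y Hxy); field; trivial.
Qed.

Lemma smooth_m_pow k : smooth_on V (fun x y => / m x y ^ k).
Proof.
  destruct Hlin as (Hphi & _).
  apply (smooth_on_inv V HV (fun x y => m x y ^ k));
    [intros; apply pow_nonzero; now apply trans_level|].
  induction k as [|k IH]; [apply (smooth_on_const V HV 1)|].
  apply (smooth_on_mult V HV m (fun x y => m x y ^ k)); [now apply smooth_on_dY | exact IH].
Qed.

Lemma smooth_alpha_phi : smooth_on V alpha_phi.
Proof.
  apply smooth_on_mult; [exact HV | | apply smooth_m_pow].
  apply smooth_on_minus; [exact HV | | now apply smooth_low].
  apply (smooth_ev V HV fld trans_smooth).
Qed.

Lemma X_const r k x y : Xop r (fun _ _ => k) x y = 0.
Proof. unfold Xop, dX, dY; rewrite !Derive_const; ring. Qed.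

Lemma X_level a f x y :
  smooth_on V a -> (forall x y, V x y -> a x y = f (phi x y)) -> V x y ->
  Xop (cr c) a x y = 0.
Proof.
  intros Ha Haf Hxy.
  rewrite (X_through_level V phi (cr c) a (fun _ _ => 1) f x y); trivial.
  - rewrite X_const; ring.
  - apply Hlin.
  - now apply smooth_on_const.
  - intros; now apply trans_level.
  - intros; rewrite Rmult_1_r; auto.
Qed.

(* beta o phi = X h / X psi with h = (beta o phi) psi; dividing h by psi would
   not do, as psi may vanish. *)
Definition beta_psi (x y : R) : R :=
  - (low c 16 x y * G x y + fld 29%nat x y
     + alpha_phi x y * m x y ^ 3 * fld 26%nat x y) * / m x y ^ 4.

Definition beta_phi (x y : R) : R := Xop (cr c) beta_psi x y * / G x y.

Lemma beta_psi_eq x y : V x y -> beta_psi x y = beta (phi x y) * psi x y.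
Proof.
  intros Hxy; unfold beta_psi; rewrite alpha_phi_eq by exact Hxy.
  rewrite (trans_match 16 x y) by (trivial; lia).
  unfold lin_coef_val, K_val, A_val, B_val; cbn [Nat.eqb].
  replace (ev (jets fld x y) (ode_coef 16)) with 0
    by (symmetry; apply (ev_eq _ (ode_coef 16) []); vm_compute; reflexivity).
  change (fld 32%nat) with phi; change (fld 23%nat) with m.
  change (fld 24%nat) with G; change (fld 25%nat) with psi.
  pose proof (trans_G x y Hxy); destruct (trans_level x y Hxy); field; split; trivial.
Qed.

Lemma smooth_beta_psi : smooth_on V beta_psi.
Proof.
  apply smooth_on_mult; [exact HV | | apply smooth_m_pow].
  apply (smooth_on_opp V HV).
  apply (smooth_on_plus V HV (fun x y => low c 16 x y * G x y + fld 29%nat x y)).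
  - apply (smooth_on_plus V HV (fun x y => low c 16 x y * G x y)).
    + apply (smooth_on_mult V HV); [now apply smooth_low | apply (trans_smooth 24)].
    + apply trans_smooth.
  - apply (smooth_on_mult V HV (fun x y => alpha_phi x y * m x y ^ 3));
      [|apply trans_smooth].
    apply (smooth_on_mult V HV); [apply smooth_alpha_phi|].
    assert (Hm : smooth_on V m) by apply (trans_smooth 23).
    apply (smooth_on_mult V HV m (fun x y => m x y ^ 2)); trivial.
    apply (smooth_on_mult V HV m (fun x y => m x y ^ 1)); trivial.
    apply (smooth_on_mult V HV m (fun x y => m x y ^ 0)); trivial.
    apply (smooth_on_const V HV 1).
Qed.

Lemma beta_phi_eq x y : V x y -> beta_phi x y = beta (phi x y).
Proof.
  intros Hxy; unfold beta_phi.
  rewrite (X_through_level V phi (cr c) beta_psi psi beta x y); trivial.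
  - fold G; pose proof (trans_G x y Hxy); field; easy.
  - apply Hlin.
  - apply smooth_beta_psi.
  - apply Hlin.
  - intros; now apply trans_level.
  - exact beta_psi_eq.
Qed.

Lemma smooth_beta_phi : smooth_on V beta_phi.
Proof.
  apply smooth_on_mult; [exact HV | |].
  - apply (smooth_Xop V HV fld trans_smooth), smooth_beta_psi.
  - apply (smooth_on_inv V HV); [exact trans_G | apply (trans_smooth 24)].
Qed.

Definition full_fld : nat -> R -> R -> R :=
  upd fld [(30%nat, alpha_phi); (31%nat, beta_phi)].

Lemma full_smooth f : smooth_on V (full_fld f).
Proof.
  apply smooth_upd; [apply trans_smooth|].
  intros t [<-|[<-|[]]]; [apply smooth_alpha_phi | apply smooth_beta_phi].
Qed.

Lemma ev_full p x y :
  avoids [30; 31]%nat p = true -> ev (jets full_fld x y) p = ev (jets fld x y) p.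
Proof. intros H; now apply (ev_upd fld [(30%nat, alpha_phi); (31%nat, beta_phi)]). Qed.

Lemma ev_psi_eq x y : V x y -> ev (jets full_fld x y) psi_eq = 0.
Proof.
  intros Hxy; unfold psi_eq, A_, B_, G_, psi_, m_, jv.
  rewrite !ev_padd, !ev_pmul, !ev_ppow, !ev_pv.
  change (low c 16 x y * G x y + (fld 29%nat x y +
    (alpha_phi x y * m x y ^ 3 * fld 26%nat x y + beta_phi x y * m x y ^ 4 * psi x y)) = 0).
  rewrite beta_phi_eq by exact Hxy.
  assert (E : beta (phi x y) * m x y ^ 4 * psi x y = beta_psi x y * m x y ^ 4)
    by (rewrite beta_psi_eq by exact Hxy; ring).
  rewrite E; unfold beta_psi; destruct (trans_level x y Hxy); field; trivial.
Qed.

Lemma full_low i x y : (i < 20)%nat -> full_fld i x y = low c i x y.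
Proof.
  intros Hi; unfold full_fld; rewrite upd_other.
  - unfold fld, trans_fld; apply Nat.ltb_lt in Hi; now rewrite Hi.
  - cbn [map existsb fst]; rewrite !(proj2 (Nat.eqb_neq _ _)) by lia; easy.
Qed.

Lemma trans_rules_valid : valid V full_fld trans_rules.
Proof.
  assert (Hgeo : valid V full_fld geo_rules).
  { apply valid_upd; [reflexivity | vm_compute; reflexivity | exact trans_geo]. }
  assert (HX : forall a f, smooth_on V a ->
    (forall x y, V x y -> a x y = f (phi x y)) -> forall x y, V x y ->
    Xop (cr c) a x y = 0) by (intros; now apply (X_level a f)).
  assert (H1 : valid V full_fld ([((30, 0, 1)%nat, []); ((31, 0, 1)%nat, [])]
    ++ map coef_rule (seq 1 15 ++ [17; 18; 19]%nat) ++ geo_rules)).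
  { apply valid_app; [|apply valid_app; [|exact Hgeo]].
    - apply valid_cons; [|apply valid_cons; [|apply valid_nil]]; intros x y Hxy.
      + apply (HX alpha_phi alpha); trivial; [apply smooth_alpha_phi | exact alpha_phi_eq].
      + apply (HX beta_phi beta); trivial; [apply smooth_beta_phi | exact beta_phi_eq].
    - intros v e Hin x y Hxy; apply in_map_iff in Hin as (i & E & Hin).
      inversion E; subst v e; clear E.
      assert (Hi : (1 <= i < 20)%nat /\ i <> 16%nat).
      { apply in_app_iff in Hin as [Hin|Hin]; [apply in_seq in Hin; lia|].
        simpl in Hin; lia. }
      assert (Hav : forall k, (k < 20)%nat -> avoids [30; 31]%nat (ode_coef k) = true).
      { intros k Hk; do 20 (destruct k as [|k]; [vm_compute; easy|]); lia. }
      specialize (Hav i (proj2 (proj1 Hi))).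
      replace (jets full_fld x y (i, 0, 0)%nat) with (low c i x y).
      + rewrite trans_match by (trivial; lia).
        unfold lin_coef_val; replace (Nat.eqb i 16) with false
          by (symmetry; apply Nat.eqb_neq; lia).
        destruct (Nat.eqb i 15) eqn:E.
        * rewrite ev_psub.
          rewrite (ev_full (ode_coef i) x y Hav).
          replace (ev (jets full_fld x y) A_) with (A_val fld alpha x y); [ring|].
          unfold A_, m_, jv; rewrite ev_pmul, ev_ppow, !ev_pv; unfold A_val.
          change (fld 32%nat x y) with (phi x y); rewrite <- alpha_phi_eq by exact Hxy.
          reflexivity.
        * rewrite (ev_full (ode_coef i) x y Hav); ring.
      + symmetry; apply full_low; lia. }
  assert (HG' : forall x y, V x y -> ev (jets full_fld x y) G_ <> 0)
    by (intros; unfold G_, jv; rewrite ev_pv; now apply trans_G).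
  (* The X-derivative of [psi_eq] is [G] times the new relation plus [4 r_y] times [psi_eq]: all
     terms with [psi_k] scale under X with the same weight four. *)
  apply (valid_divide V HV full_fld full_smooth _ G_ (16, 0, 1)%nat
    (psub (pmul (psub (pmul (pz 4) r_y) g1_) (jv 16))
          (padd (c_ 4) (padd (pmul A_ g2_) B_)))
    (pder xraw psi_eq) (pmul (pz 4) r_y) psi_eq) in H1.
  - assert (H2 : valid V full_fld [((29, 0, 0)%nat, psub (psi_ 4) psi_eq)]).
    { apply valid_cons; [|apply valid_nil]; intros x y Hxy.
      rewrite ev_psub, ev_psi_eq by exact Hxy.
      unfold psi_, jv; rewrite ev_pv; cbn [Nat.add]; ring. }
    (* Validity depends only on membership, so the rules may be reordered. *)
    intros v e Hin; destruct Hin as [E|[E|[E|[E|Hin]]]].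
    + apply H2; now left.
    + apply H1; right; now left.
    + apply H1; right; right; now left.
    + apply H1; now left.
    + apply H1; right; right; now right.
  - intros; now apply (ev_zero_derivatives V HV full_fld full_smooth _ ev_psi_eq).
  - exact ev_psi_eq.
  - exact HG'.
  - vm_compute; reflexivity.
Qed.

(** Under [trans_rules] the two sides of each condition reduce to the same polynomial in the
    remaining jets. *)
Lemma linearizes_conditions x y : V x y -> conditions c x y.
Proof.
  intros Hxy.
  apply (conditions_of_rules V HV full_fld full_smooth c eq_refl) with trans_rules.
  - intros; now apply full_low.
  - exact trans_rules_valid.
  - exact Hxy.
  - vm_compute; reflexivity.
Qed.
End Transformation.

(** * The system for the transformation and the formulas for alpha and beta *)

Section System.
Variables (c : coefs) (V : R -> R -> Prop) (phi psi : R -> R -> R).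
Variables (alpha beta : R -> R).
Hypothesis HV : open2 V.
Hypothesis Hc : coefs_smooth_on V c.
Hypothesis Hlin : linearizes c V phi psi alpha beta.

Let fld := full_fld c phi psi.
Let al := alpha_phi c phi psi.
Let be := beta_phi c phi psi.

(** The Jacobian and [Theta] are symbols of their own because their y-derivatives occur; the
    Jacobian is represented by [- m G]. *)
Definition sys_syms : list (R -> R -> R) :=
  coef_list c ++ [phi; psi; Jac phi psi; al; be; Theta c].
Definition sys_pols : list pol :=
  upper ++ [jv 32; jv 25; pscale (-1) (pmul m_ G_); jv 30; jv 31;
            to_pol trans_rules upper theta_expr].

Lemma sys_syms_sound i x y :
  V x y -> sym sys_syms i x y = ev (jets fld x y) (nth i sys_pols []).
Proof.
  intros Hxy.
  assert (Hfld : forall f, smooth_on V (fld f))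
    by (eapply full_smooth; eassumption).
  assert (Hrs : valid V fld trans_rules)
    by (eapply trans_rules_valid; eassumption).
  assert (Hup : forall i x y, V x y ->
    sym (coef_list c) i x y = ev (jets fld x y) (nth i upper [])).
  { intros; apply low_upper; [reflexivity | intros; now apply full_low]. }
  assert (H : forall l ps i, length l = 20%nat -> length ps = 20%nat ->
    (forall i, sym l i x y = ev (jets fld x y) (nth i ps [])) ->
    forall l' ps', (forall i, sym l' i x y = ev (jets fld x y) (nth i ps' [])) ->
    sym (l ++ l') i x y = ev (jets fld x y) (nth i (ps ++ ps') [])).
  { intros l ps k Hl Hps H1 l' ps' H2; unfold sym.
    destruct (Nat.lt_ge_cases k 20).
    - rewrite !app_nth1 by lia; apply H1.
    - rewrite !app_nth2, Hl, Hps by lia; apply H2. }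
  apply H; [reflexivity | reflexivity | intros; now apply Hup |]; clear i.
  intros i.
  destruct i as [|[|[|[|[|[|i]]]]]]; unfold sym; cbn [nth].
  - unfold jv; rewrite ev_pv; reflexivity.
  - unfold jv; rewrite ev_pv; reflexivity.
  - rewrite ev_pscale, ev_pmul; unfold m_, G_, jv; rewrite !ev_pv.
    destruct (trans_level c V phi psi alpha beta HV Hlin x y Hxy) as [_ Hr].
    change (Jac phi psi x y = Q2R (-1) * (dY phi x y * Xop (cr c) psi x y)).
    unfold Jac, Xop; rewrite Hr; unfold Q2R; cbn [Qnum Qden Qopp]; field.
  - unfold jv; rewrite ev_pv; reflexivity.
  - unfold jv; rewrite ev_pv; reflexivity.
  - rewrite <- (to_pol_sound V HV fld Hfld trans_rules Hrs (coef_list c) upper Hup)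
      by exact Hxy.
    apply Theta_eval.
  - destruct i; reflexivity.
Qed.

Lemma sys_eq a b x y :
  V x y ->
  psub (to_pol trans_rules sys_pols a) (to_pol trans_rules sys_pols b) = [] ->
  ceval sys_syms x y a = ceval sys_syms x y b.
Proof.
  intros Hxy; apply (ceval_eq V HV fld); trivial.
  - eapply full_smooth; eassumption.
  - eapply trans_rules_valid; eassumption.
  - intros; now apply sys_syms_sound.
Qed.

Ltac by_jets x y Hxy :=
  lazymatch goal with
  | |- ?a = ?b =>
      let s := eval cbv beta delta [sys_syms coef_list app] iota in sys_syms in
      let a' := reify_expr s a in let b' := reify_expr s b in
      change (ceval sys_syms x y a' = ceval sys_syms x y b');
      apply sys_eq; [exact Hxy | vm_compute; reflexivity]
  end.

(** With [alpha] and [beta] replaced by their smooth expressions and the denominators cleared, each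
    equation is a polynomial identity modulo [trans_rules]. *)
Lemma linearizes_system x y :
  V x y ->
  trans_system c phi psi alpha beta x y /\
  alpha (phi x y) = alpha_formula c phi x y /\
  beta (phi x y) = beta_formula c phi psi x y.
Proof.
  intros Hxy.
  assert (Ea : alpha (phi x y) = al x y)
    by (symmetry; eapply alpha_phi_eq; eassumption).
  assert (Eb : beta (phi x y) = be x y)
    by (symmetry; eapply beta_phi_eq; eassumption).
  assert (Hm : dY phi x y <> 0)
    by (eapply trans_level; eassumption).
  assert (HD : Jac phi psi x y <> 0) by now apply Hlin.
  split; [|split].
  - unfold trans_system; cbv zeta; rewrite Ea, Eb.
    repeat split; by_jets x y Hxy.
  - unfold alpha_formula; rewrite Ea.
    apply (Rmult_eq_reg_r (8 * dY phi x y ^ 3));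
      [|apply Rmult_integral_contrapositive; split;
        [lra | now apply pow_nonzero]].
    transitivity (Theta c x y); [by_jets x y Hxy | field; exact Hm].
  - unfold beta_formula; cbv zeta; rewrite Eb.
    assert (H0 : 1600 * Jac phi psi x y * dY phi x y ^ 4 <> 0).
    { apply Rmult_integral_contrapositive; split; [|now apply pow_nonzero].
      apply Rmult_integral_contrapositive; split; [lra | exact HD]. }
    apply (Rmult_eq_reg_l (1600 * Jac phi psi x y * dY phi x y ^ 4)); [|exact H0].
    rewrite <- Rmult_assoc, Rinv_r, Rmult_1_l by exact H0.
    by_jets x y Hxy.
Qed.
End System.

(** * Sufficiency *)

Fixpoint psum (n : nat) (f : nat -> pol) : pol :=
  match n with O => [] | S k => padd (psum k f) (f k) end.

Lemma ev_psum rho n f : ev rho (psum n f) = rsum n (fun k => ev rho (f k)).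
Proof. induction n as [|n IH]; [easy|]; cbn [psum rsum]; now rewrite ev_padd, IH. Qed.

(* X B + B C = C_y + C B + r_y B, the compatibility of Z_y = B Z and X Z = C Z. *)
Definition flat (rs : rules) (N : nat) (B C : nat -> nat -> pol) : bool :=
  forallb (fun i => forallb (fun j =>
    match normal rs (psub
      (padd (pder xraw (B i j)) (psum N (fun k => pmul (B i k) (C k j))))
      (padd (pder yraw (C i j))
        (padd (psum N (fun k => pmul (C i k) (B k j))) (pmul r_y (B i j)))))
    with [] => true | _ => false end) (seq 0 N)) (seq 0 N).

Definition frob_rules (F : list nat) (B C : nat -> nat -> pol) : rules :=
  let N := length F in
  map (fun i => ((nth i F 0%nat, 1, 0)%nat,
    psum N (fun j => pmul (B i j) (jv (nth j F 0%nat))))) (seq 0 N)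
  ++ map (fun i => ((nth i F 0%nat, 0, 1)%nat,
    psum N (fun j => pmul (C i j) (jv (nth j F 0%nat))))) (seq 0 N).

(** Linearity of the system: no unknown occurs in its coefficients. *)
Definition entries_avoid (F : list nat) (B : nat -> nat -> pol) : bool :=
  forallb (fun i => forallb (fun j => avoids F (B i j)) (seq 0 (length F)))
    (seq 0 (length F)).

Section FrobeniusJets.
Variable V : R -> R -> Prop.
Hypothesis HV : open2 V.
Variable fld : nat -> R -> R -> R.
Hypothesis Hfld : forall f, smooth_on V (fld f).
Variable rs : rules.
Hypothesis Hrs : valid V fld rs.

(** Solves a system given in the frame of X and [d/dy] and adjoins its solution as new fields, so
    that the equations become rules for later reductions. *)
Lemma frobenius_extend F B C z0 x0 y0 :
  V x0 y0 -> NoDup F -> existsb (fun f => Nat.eqb f 0) F = false ->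
  flat rs (length F) B C = true -> rules_avoid F rs = true ->
  entries_avoid F B = true -> entries_avoid F C = true ->
  exists (W : R -> R -> Prop) (fld' : nat -> R -> R -> R),
    open2 W /\ W x0 y0 /\ (forall x y, W x y -> V x y) /\
    (forall f, smooth_on W (fld' f)) /\
    (forall k, existsb (fun f => Nat.eqb f k) F = false -> fld' k = fld k) /\
    (forall i, (i < length F)%nat -> fld' (nth i F 0%nat) x0 y0 = z0 i) /\
    valid W fld' (frob_rules F B C ++ rs).
Proof.
  intros H0 HF HF0 Hflat Hrav HBav HCav; set (N := length F) in *.
  set (e := fun (M : nat -> nat -> pol) i j x y => ev (jets fld x y) (M i j)).
  set (r := fld 0%nat).
  assert (He : forall M i j, smooth_on V (e M i j))
    by (intros; now apply smooth_ev).
  (* Back to coordinates by [d/dx = X + r d/dy]; the commutator of X and [d/dy] accounts for the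
     term with [r_y] in [flat]. *)
  set (A := fun i j x y => e C i j x y + r x y * e B i j x y).
  destruct (frobenius_linear V x0 y0 N A (e B) z0)
    as (W & Z & HW & HW0 & HWV & HZ); trivial.
  { intros i j; unfold A.
    apply smooth_on_plus; [exact HV | apply He |].
    apply smooth_on_mult; [exact HV | apply Hfld | apply He]. }
  { intros i j x y Hi Hj Hxy.
    assert (E : normal rs (psub
      (padd (pder xraw (B i j)) (psum N (fun k => pmul (B i k) (C k j))))
      (padd (pder yraw (C i j))
        (padd (psum N (fun k => pmul (C i k) (B k j))) (pmul r_y (B i j))))) = []).
    { unfold flat in Hflat; rewrite forallb_forall in Hflat.
      specialize (Hflat i ltac:(apply in_seq; lia)).
      rewrite forallb_forall in Hflat.
      specialize (Hflat j ltac:(apply in_seq; lia)).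
      now destruct (normal rs _). }
    apply (normal_zero V fld rs _ _ x y HV Hfld Hrs Hxy) in E.
    rewrite !ev_padd, !ev_psum, ev_pmul in E.
    rewrite <- (X_ev V HV fld Hfld), <- (dY_ev V HV fld Hfld) in E by exact Hxy.
    fold (e B i j) in E; fold (e C i j) in E.
    replace (ev (jets fld x y) r_y) with (dY r x y) in E
      by (unfold r_y; rewrite ev_pv; reflexivity).
    assert (EA : dY (A i j) x y
      = dY (e C i j) x y + (dY r x y * e B i j x y + r x y * dY (e B i j) x y)).
    { apply is_derive_unique.
      apply (is_derive_plus (V := R_NormedModule) (e C i j x)).
      - apply (is_derive_dY V); [apply He | exact Hxy].
      - apply (is_derive_mult (r x) (e B i j x)).
        + apply (is_derive_dY V); [apply Hfld | exact Hxy].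
        + apply (is_derive_dY V); [apply He | exact Hxy].
        + intros; apply Rmult_comm. }
    rewrite EA; unfold A; unfold Xop in E; fold r in E.
    rewrite (rsum_ext _ (fun k => (e C i k x y + r x y * e B i k x y) * e B k j x y)
      (fun k => ev (jets fld x y) (pmul (C i k) (B k j))
                + r x y * (e B i k x y * e B k j x y)))
      by (intros; rewrite ev_pmul; unfold e; ring).
    rewrite (rsum_ext _ (fun k => e B i k x y * (e C k j x y + r x y * e B k j x y))
      (fun k => ev (jets fld x y) (pmul (B i k) (C k j))
                + r x y * (e B i k x y * e B k j x y)))
      by (intros; rewrite ev_pmul; unfold e; ring).
    rewrite !rsum_plus.
    change (ev (jets fld x y) (B i j)) with (e B i j x y) in E; lra. }
  set (l := map (fun i => (nth i F 0%nat, Z i)) (seq 0 N)).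
  assert (Hl : map fst l = F).
  { unfold l; rewrite map_map; cbn [fst]; unfold N; clear.
    induction F as [|f F IH] using rev_ind; [easy|].
    rewrite length_app, Nat.add_1_r, seq_S, map_app; cbn [map].
    f_equal.
    - rewrite <- IH at 2; apply map_ext_in; intros i Hi; apply in_seq in Hi.
      now rewrite app_nth1 by lia.
    - now rewrite Nat.add_0_l, app_nth2, Nat.sub_diag by lia. }
  set (fld' := upd fld l).
  assert (HZi : forall i, (i < N)%nat -> fld' (nth i F 0%nat) = Z i).
  { intros i Hi; unfold fld', upd.
    destruct (find _ l) as [t|] eqn:E.
    - apply find_some in E as [Hin E]; apply in_map_iff in Hin as (j & <- & Hj).
      apply in_seq in Hj; apply Nat.eqb_eq in E; cbn [fst snd] in *.
      f_equal; eapply NoDup_nth; [exact HF | fold N; lia | exact Hi | exact E].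
    - exfalso; apply find_none with (x := (nth i F 0%nat, Z i)) in E.
      + cbn [fst] in E; now rewrite Nat.eqb_refl in E.
      + apply in_map_iff; exists i; split; [easy | apply in_seq; lia]. }
  assert (Hsm : forall f, smooth_on W (fld' f)).
  { apply smooth_upd; [intros; now apply smooth_on_sub with V|].
    intros t Ht; apply in_map_iff in Ht as (i & <- & Hi); apply in_seq in Hi.
    apply HZ; lia. }
  assert (Hev : forall p x y, avoids F p = true ->
    ev (jets fld' x y) p = ev (jets fld x y) p).
  { intros p x y Hp; apply ev_upd; rewrite Hl; assumption. }
  assert (Hr : fld' 0%nat = r) by (apply upd_other; rewrite Hl; exact HF0).
  assert (Hent : forall M i j, entries_avoid F M = true -> (i < N)%nat -> (j < N)%nat ->
    avoids F (M i j) = true).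
  { intros M i j HM Hi Hj; unfold entries_avoid in HM; rewrite forallb_forall in HM.
    specialize (HM i ltac:(apply in_seq; fold N; lia)).
    rewrite forallb_forall in HM; apply HM, in_seq; fold N; lia. }
  assert (Hsum : forall M i x y, entries_avoid F M = true -> (i < N)%nat ->
    ev (jets fld' x y) (psum N (fun j => pmul (M i j) (jv (nth j F 0%nat))))
    = rsum N (fun j => e M i j x y * Z j x y)).
  { intros M i x y HM Hi; rewrite ev_psum; apply rsum_ext; intros j Hj.
    unfold jv; rewrite ev_pmul, ev_pv, Hev by now apply Hent.
    unfold e; f_equal.
    change (fld' (nth j F 0%nat) x y = Z j x y); now rewrite HZi. }
  exists W, fld'; split; [exact HW|]; split; [exact HW0|]; split; [exact HWV|].
  split; [exact Hsm|]; split; [|split].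
  - intros k Hk; apply upd_other; now rewrite Hl.
  - intros i Hi; rewrite HZi by exact Hi; now apply HZ.
  - apply valid_app; [apply valid_app|].
    + intros v p Hin x y Hxy; apply in_map_iff in Hin as (i & E & Hi).
      apply in_seq in Hi; injection E as <- <-; fold N in Hi |- *.
      rewrite Hsum by (trivial; lia).
      change (dY (fld' (nth i F 0%nat)) x y = rsum N (fun j => e B i j x y * Z j x y)).
      rewrite HZi by lia; apply HZ; [lia | exact Hxy].
    + intros v p Hin x y Hxy; apply in_map_iff in Hin as (i & E & Hi).
      apply in_seq in Hi; injection E as <- <-; fold N in Hi |- *.
      rewrite Hsum by (trivial; lia).
      change (Xop (fld' 0%nat) (fld' (nth i F 0%nat)) x y
              = rsum N (fun j => e C i j x y * Z j x y)).
      rewrite HZi, Hr by lia; unfold Xop.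
      destruct (HZ i ltac:(lia)) as (_ & _ & HD); destruct (HD x y Hxy) as [HX HY].
      rewrite HX, HY, <- rsum_scal, <- rsum_minus.
      apply rsum_ext; intros j Hj; unfold A; ring.
    + apply valid_upd; rewrite ?Hl; trivial.
      now apply valid_sub with V.
Qed.
End FrobeniusJets.

Lemma open2_nonzero V f :
  open2 V -> smooth_on V f -> open2 (fun x y => V x y /\ f x y <> 0).
Proof.
  intros HV Hf; apply locally_2d_open2; intros x y [Hxy H0].
  apply locally_2d_and; [now apply open2_locally|].
  apply continuity_2d_pt_neq_0; [now apply (smooth_on_C1 V f) | exact H0].
Qed.

(** The Schwarzian derivative of [phi] in y, which is [n_y - n^2/2], expressed through [F2] and
    [J4]. *)
Definition S_ : pol :=
  pscale (1 # 5) (psub (jv 8)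
    (padd (pscale (3 # 2) (pv (3, 1, 0)%nat)) (pscale (3 # 8) (pmul (jv 3) (jv 3))))).

(* n = -2 w_y / w turns the Riccati equation n_y = n^2/2 + S into w_yy = -S w / 2. *)
Definition w_B (i j : nat) : pol :=
  match i, j with
  | 0, 1 => pc 1
  | 1, 0 => pscale (-1 # 2) S_
  | _, _ => []
  end%nat.
(** [w] plays the role of [phi_y^(-1/2)]. From [X phi_y = r_y phi_y] it has weight [-1/2] under X;
    the second row follows by the commutator. *)
Definition w_C (i j : nat) : pol :=
  match i, j with
  | 0, 0 => pscale (-1 # 2) r_y
  | 1, 0 => pscale (-1 # 2) (pv (0, 2, 0)%nat)
  | 1, 1 => pscale (1 # 2) r_y
  | _, _ => []
  end%nat.

(** The values of [g2] and [g1] are those that match the coefficients of [y'''], namely [F2] and the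
    shifted [F1]. *)
Definition n_rules : rules :=
  [((22, 0, 0)%nat, pscale (1 # 4) (padd (jv 3) (pscale 6 n_)));
   ((21, 0, 0)%nat, pscale (1 # 4) (padd (jv 2) (pscale 16 r_y)));
   ((20, 0, 1)%nat, padd (pv (0, 2, 0)%nat) (pmul r_y n_));
   ((20, 1, 0)%nat, padd (pscale (1 # 2) (pmul n_ n_)) S_)]
  ++ frob_rules [33; 34]%nat w_B w_C ++ cond_rules.

(** [Theta / 8] after the shift, where [K6 - 7 K7 r] is coefficient 15; the expected value of
    [alpha phi_y^3]. *)
Definition theta8 : pol :=
  pscale (1 # 8)
    (padd (pmul (psub (pmul (jv 3) (jv 3)) (pscale 4 (jv 8))) (jv 3))
    (padd (pscale (-8) (jv 15)) (padd (pscale (-8) (pv (8, 1, 0)%nat))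
    (padd (pscale 6 (pmul (pv (3, 1, 0)%nat) (jv 3))) (pscale 4 (pv (3, 2, 0)%nat)))))).

(* The value of beta m^4 forced by the X-derivative of psi_eq. *)
Definition beta4 : pol :=
  psub (pmul (psub (pmul (pz 4) r_y) g1_) (jv 16))
       (padd (c_ 4) (padd (pmul theta8 g2_) (pv (16, 0, 1)%nat))).

Definition sol_fields : list nat := [23; 32; 24; 25; 26; 27; 28]%nat.

(** The system closes in the last row, where [psi_4] is replaced by
    [-K7 G - theta8 psi_1 - beta4 psi_0]. It is linear because [n], [g1] and [g2] are already known
    functions. *)
Definition sol_B (i j : nat) : pol :=
  match i, j with
  | 0, 0 => n_
  | 1, 0 => pc 1
  | 2, 2 => g2_
  | 3, 4 | 4, 5 | 5, 6 => pc 1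
  | 4, 4 => n_
  | 5, 5 => pmul (pz 2) n_
  | 6, 6 => pmul (pz 3) n_
  | 6, 4 => pscale (-1) theta8
  | 6, 3 => pscale (-1) beta4
  | 6, 2 => pscale (-1) (jv 16)
  | _, _ => []
  end%nat.
Definition sol_C (i j : nat) : pol :=
  match i, j with
  | 0, 0 => r_y
  | 2, 2 => g1_
  | 3, 2 => c_ 0
  | 4, 2 => c_ 1
  | 5, 2 => c_ 2
  | 6, 2 => c_ 3
  | 4, 4 => r_y
  | 5, 5 => pmul (pz 2) r_y
  | 6, 6 => pmul (pz 3) r_y
  | _, _ => []
  end%nat.

Definition sol_rules : rules :=
  ((29, 0, 0)%nat, pscale (-1) (padd (pmul (jv 16) G_)
     (padd (pmul theta8 (psi_ 1)) (pmul beta4 (psi_ 0)))))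
  :: frob_rules sol_fields sol_B sol_C ++ n_rules.

Lemma n_extension c U x0 y0 :
  open2 U -> coefs_smooth_on U c -> (forall x y, U x y -> conditions c x y) -> U x0 y0 ->
  exists (V : R -> R -> Prop) (fld : nat -> R -> R -> R),
    open2 V /\ V x0 y0 /\ (forall x y, V x y -> U x y) /\
    (forall f, smooth_on V (fld f)) /\
    (forall i, (i < 20)%nat -> fld i = low c i) /\ valid V fld n_rules.
Proof.
  intros HU Hc Hcond H0.
  set (fld0 := fun f => if Nat.ltb f 20 then low c f else fun _ _ => 0).
  assert (Hlow0 : forall i, (i < 20)%nat -> fld0 i = low c i)
    by (intros i Hi; unfold fld0; apply Nat.ltb_lt in Hi; now rewrite Hi).
  assert (Hs0 : forall f, smooth_on U (fld0 f)).
  { intros f; unfold fld0; destruct (Nat.ltb f 20);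
      [now apply smooth_low | now apply smooth_on_const]. }
  assert (Hv0 : valid U fld0 cond_rules).
  { apply (cond_rules_valid U HU fld0 Hs0 c); [reflexivity | | exact Hcond].
    intros i x y _ Hi; now rewrite Hlow0. }
  destruct (frobenius_extend U HU fld0 Hs0 cond_rules Hv0 [33; 34]%nat w_B w_C
    (* Initial values [w = 1], [w_y = 0]: only [w <> 0] matters, to make the quotient defining [n]
       smooth nearby. *)
    (fun i => match i with O => 1 | _ => 0 end) x0 y0)
    as (W & fld1 & HW & HW0 & HWU & Hs1 & Hold1 & Hstart & Hv1);
    [exact H0 | repeat constructor; simpl; lia | reflexivity
    | vm_compute; reflexivity | vm_compute; reflexivity | reflexivity | reflexivity |].
  set (V := fun x y => W x y /\ fld1 33%nat x y <> 0).
  assert (HV : open2 V) by (apply open2_nonzero; trivial).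
  assert (HVW : forall x y, V x y -> W x y) by (intros x y Hxy; apply Hxy).
  assert (HV0 : V x0 y0).
  { split; [exact HW0|]; change 33%nat with (nth 0 [33; 34]%nat 0%nat).
    rewrite Hstart by (simpl; lia); lra. }
  set (n := fun x y => -2 * fld1 34%nat x y * / fld1 33%nat x y).
  assert (Hsn : smooth_on V n).
  { assert (Hs : forall f, smooth_on V (fld1 f))
      by (intros; now apply smooth_on_sub with W).
    apply (smooth_on_mult V HV (fun x y => -2 * fld1 34%nat x y)).
    - apply (smooth_on_mult V HV (fun _ _ => -2)); [now apply smooth_on_const | apply Hs].
    - apply (smooth_on_inv V HV); [now intros x y [_ Hw] | apply Hs]. }
  set (R1 := frob_rules [33; 34]%nat w_B w_C ++ cond_rules) in *.
  set (fld2 := upd fld1 [(20%nat, n)]).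
  assert (Hs2 : forall f, smooth_on V (fld2 f)).
  { apply smooth_upd; [intros; now apply smooth_on_sub with W|].
    intros t [<-|[]]; exact Hsn. }
  assert (Hv2 : valid V fld2 R1).
  { apply valid_upd; [reflexivity | vm_compute; reflexivity|].
    now apply valid_sub with W. }
  (* The definition [n = -2 w_y / w] without denominator; its two derivatives, divided by [w], give
     the Riccati equation and the formula for [X n]. *)
  set (rel := padd (pmul n_ (jv 33)) (pscale 2 (jv 34))).
  assert (Hrel : forall x y, V x y -> ev (jets fld2 x y) rel = 0).
  { intros x y [_ Hw]; unfold rel, n_, jv.
    rewrite ev_padd, ev_pscale, ev_pmul, !ev_pv.
    change (n x y * fld1 33%nat x y + Q2R 2 * fld1 34%nat x y = 0).
    unfold n, Q2R; cbn [Qnum Qden]; field; exact Hw. }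
  assert (Hd : forall x y, V x y -> ev (jets fld2 x y) (jv 33) <> 0)
    by (intros x y [_ Hw]; unfold jv; rewrite ev_pv; exact Hw).
  pose proof (ev_zero_derivatives V HV fld2 Hs2 rel Hrel) as Hzero.
  apply (valid_divide V HV fld2 Hs2 _ (jv 33) (20, 1, 0)%nat
    (padd (pscale (1 # 2) (pmul n_ n_)) S_) (pder yraw rel) (pscale (1 # 2) n_) rel)
    in Hv2; [| apply Hzero | exact Hrel | exact Hd | vm_compute; reflexivity].
  apply (valid_divide V HV fld2 Hs2 _ (jv 33) (20, 0, 1)%nat
    (padd (pv (0, 2, 0)%nat) (pmul r_y n_)) (pder xraw rel) (pscale (1 # 2) r_y) rel)
    in Hv2; [| apply Hzero | exact Hrel | exact Hd | vm_compute; reflexivity].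
  apply (valid_abbrev V fld2 21 (pscale (1 # 4) (padd (jv 2) (pscale 16 r_y))))
    in Hv2; [| reflexivity | vm_compute; reflexivity | vm_compute; reflexivity].
  set (fld3 := upd fld2 _) in Hv2.
  assert (Hs3 : forall f, smooth_on V (fld3 f)).
  { apply smooth_upd; [exact Hs2|].
    intros t [<-|[]]; now apply (smooth_ev V HV). }
  apply (valid_abbrev V fld3 22 (pscale (1 # 4) (padd (jv 3) (pscale 6 n_))))
    in Hv2; [| reflexivity | vm_compute; reflexivity | vm_compute; reflexivity].
  eexists V, _; split; [exact HV|]; split; [exact HV0|].
  split; [intros; now apply HWU, HVW|]; split; [|split; [|exact Hv2]].
  - apply smooth_upd; [exact Hs3|].
    intros t [<-|[]]; now apply (smooth_ev V HV).
  - intros i Hi.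
    assert (Hne : forall k, (20 <= k)%nat -> Nat.eqb k i = false)
      by (intros; apply Nat.eqb_neq; lia).
    unfold fld3, fld2; rewrite !upd_other
      by (cbn [map fst existsb]; rewrite !Hne by lia; reflexivity).
    rewrite Hold1 by (cbn [existsb]; rewrite !Hne by lia; reflexivity).
    now apply Hlow0.
Qed.

Lemma sol_extension c U x0 y0 :
  open2 U -> coefs_smooth_on U c -> (forall x y, U x y -> conditions c x y) -> U x0 y0 ->
  exists (V : R -> R -> Prop) (fld : nat -> R -> R -> R),
    open2 V /\ V x0 y0 /\ (forall x y, V x y -> U x y) /\
    (forall f, smooth_on V (fld f)) /\
    (forall i, (i < 20)%nat -> fld i = low c i) /\
    (forall x y, V x y -> fld 23%nat x y <> 0) /\
    (forall x y, V x y -> fld 24%nat x y <> 0) /\ valid V fld sol_rules.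
Proof.
  intros HU Hc Hcond H0.
  destruct (n_extension c U x0 y0 HU Hc Hcond H0)
    as (W & fld & HW & HW0 & HWU & Hs & Hlow & Hv).
  destruct (frobenius_extend W HW fld Hs n_rules Hv sol_fields sol_B sol_C
    (* [m = G = 1] at the base point, so the Jacobian [- m G] does not vanish nearby. *)
    (fun i => match i with 0%nat | 2%nat => 1 | _ => 0 end) x0 y0)
    as (W1 & fld1 & HW1 & HW10 & HW1W & Hs1 & Hold1 & Hstart & Hv1);
    [exact HW0 | unfold sol_fields; repeat constructor; simpl; lia | reflexivity
    | vm_compute; reflexivity | vm_compute; reflexivity
    | vm_compute; reflexivity | vm_compute; reflexivity |].
  set (V := fun x y => (W1 x y /\ fld1 23%nat x y <> 0) /\ fld1 24%nat x y <> 0).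
  assert (HV : open2 V).
  { apply open2_nonzero; [now apply open2_nonzero|].
    apply smooth_on_sub with W1; [intros x y Hxy; apply Hxy | apply Hs1]. }
  assert (HVW : forall x y, V x y -> W1 x y) by (intros x y Hxy; apply Hxy).
  assert (Hs1V : forall f, smooth_on V (fld1 f))
    by (intros; now apply smooth_on_sub with W1).
  apply (valid_sub W1 fld1 V _ HVW) in Hv1.
  apply (valid_abbrev V fld1 29 (pscale (-1) (padd (pmul (jv 16) G_)
     (padd (pmul theta8 (psi_ 1)) (pmul beta4 (psi_ 0))))))
    in Hv1; [| reflexivity | vm_compute; reflexivity | vm_compute; reflexivity].
  eexists V, _; split; [exact HV|]; split; [|split; [|split; [|split; [|split; [|split]]]]];
    [ | | | | | | exact Hv1].
  - assert (H23 : fld1 23%nat x0 y0 = 1) by (apply (Hstart 0%nat); simpl; lia).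
    assert (H24 : fld1 24%nat x0 y0 = 1) by (apply (Hstart 2%nat); simpl; lia).
    split; [split; [exact HW10|]|]; lra.
  - intros; now apply HWU, HW1W, HVW.
  - apply smooth_upd; [exact Hs1V|].
    intros t [<-|[]]; now apply (smooth_ev V HV).
  - intros i Hi.
    assert (Hne : forall k, (20 <= k)%nat -> Nat.eqb k i = false)
      by (intros; apply Nat.eqb_neq; lia).
    rewrite upd_other by (cbn [map fst existsb]; rewrite !Hne by lia; reflexivity).
    rewrite Hold1 by (cbn [sol_fields existsb]; rewrite !Hne by lia; reflexivity).
    now apply Hlow.
  - intros x y Hxy; apply Hxy.
  - intros x y Hxy; apply Hxy.
Qed.

Lemma Xop_mult V r a b x y :
  smooth_on V a -> smooth_on V b -> V x y ->
  Xop r (fun x y => a x y * b x y) x y = Xop r a x y * b x y + a x y * Xop r b x y.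
Proof.
  intros Ha Hb Hxy; unfold Xop.
  destruct (smooth_on_C1 V a x y Ha Hxy) as (a1 & a2 & _).
  destruct (smooth_on_C1 V b x y Hb Hxy) as (b1 & b2 & _).
  assert (EX : dX (fun x y => a x y * b x y) x y = dX a x y * b x y + a x y * dX b x y)
    by now apply (Derive_mult (fun t => a t y) (fun t => b t y)).
  assert (EY : dY (fun x y => a x y * b x y) x y = dY a x y * b x y + a x y * dY b x y)
    by now apply (Derive_mult (a x) (b x)).
  rewrite EX, EY; ring.
Qed.

Lemma Xop_pow V r m c x y k :
  open2 V -> smooth_on V m -> V x y -> Xop r m x y = c * m x y ->
  smooth_on V (fun x y => m x y ^ k) /\
  Xop r (fun x y => m x y ^ k) x y = INR k * c * m x y ^ k.
Proof.
  intros HV Hm Hxy E; induction k as [|k [IHs IH]].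
  - split; [apply (smooth_on_const V HV 1)|].
    change (Xop r (fun _ _ => 1) x y = 0 * c * 1).
    unfold Xop, dX, dY; rewrite !Derive_const; ring.
  - split; [now apply (smooth_on_mult V HV m (fun x y => m x y ^ k))|].
    change (Xop r (fun x y => m x y * m x y ^ k) x y = INR (S k) * c * (m x y * m x y ^ k)).
    rewrite (Xop_mult V) by trivial; rewrite E, IH, S_INR; ring.
Qed.

(** Coefficient 16, [K7], is left out: it matches by the very choice of [psi_4]. *)
Lemma sol_match i :
  (1 <= i < 20)%nat -> i <> 16%nat ->
  normal sol_rules (psub (jv i) (if Nat.eqb i 15 then psub (ode_coef i) theta8
                                 else ode_coef i)) = [].
Proof.
  intros Hi Hne.
  do 20 (destruct i as [|i]; [try lia; vm_compute; reflexivity|]); lia.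
Qed.

Lemma conditions_linearizable c U :
  open2 U -> coefs_smooth_on U c -> (forall x y, U x y -> conditions c x y) ->
  locally_linearizable c U.
Proof.
  intros HU Hc Hcond x0 y0 H0.
  destruct (sol_extension c U x0 y0 HU Hc Hcond H0)
    as (W & fld & HW & HW0 & HWU & Hs & Hlow & Hm & HG & Hv).
  assert (Hgeo : valid W fld geo_rules)
    by (apply (valid_by_normal W HW fld Hs sol_rules); [exact Hv | vm_compute; reflexivity]).
  assert (Hr : fld 0%nat = cr c) by (now rewrite Hlow by lia).
  assert (HXm : forall x y, W x y ->
    Xop (cr c) (fld 23%nat) x y = dY (cr c) x y * fld 23%nat x y).
  { intros x y Hxy.
    assert (E := normal_zero W fld geo_rules (pv (23, 0, 1)%nat) (pmul r_y m_) x y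
      HW Hs Hgeo Hxy ltac:(vm_compute; reflexivity)).
    unfold r_y, m_, jv in E; rewrite ev_pmul, !ev_pv in E; rewrite <- Hr; exact E. }
  assert (Hpw := fun k x y Hxy => Xop_pow W (cr c) (fld 23%nat) _ x y k HW (Hs _) Hxy
                                    (HXm x y Hxy)).
  assert (Hphi : forall x y, W x y -> dY (fld 32%nat) x y <> 0 /\
    dX (fld 32%nat) x y = cr c x y * dY (fld 32%nat) x y).
  { intros x y Hxy; destruct (geo_phi W HW fld Hs Hgeo x y Hxy) as (H1 & H2 & _).
    split; [rewrite H1; now apply Hm|].
    rewrite Hr in H2; unfold Xop in H2; lra. }
  destruct (function_of_level W (fld 32%nat) (cr c) x0 y0 HW (Hs 32%nat) HW0 Hphi)
    as (V & HV & HV0 & HVW & Hfun).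
  assert (Hpow : forall p k, normal sol_rules
      (psub (DX sol_rules p) (pmul (pz k) (pmul r_y p))) = [] ->
    exists f, forall x y, V x y ->
      ev (jets fld x y) p = f (fld 32%nat x y) * fld 23%nat x y ^ k).
  { intros p k Hp.
    set (a := fun x y => ev (jets fld x y) p * / fld 23%nat x y ^ k).
    assert (Ha : smooth_on W a).
    { apply smooth_on_mult; [exact HW | now apply (smooth_ev W HW) |].
      apply (smooth_on_inv W HW (fun x y => fld 23%nat x y ^ k));
        [intros; apply pow_nonzero; now apply Hm | now apply (Hpw k x0 y0)]. }
    destruct (Hfun a Ha) as [f Hf].
    - intros x y Hxy.
      assert (Hk0 : fld 23%nat x y ^ k <> 0) by (apply pow_nonzero; now apply Hm).
      destruct (Hpw k x y Hxy) as [Hsk EXk].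
      assert (E1 : Xop (cr c) (fun x y => ev (jets fld x y) p) x y
        = Xop (cr c) (fun x y => a x y * fld 23%nat x y ^ k) x y).
      { assert (Ea : forall u v, W u v ->
          ev (jets fld u v) p = a u v * fld 23%nat u v ^ k)
          by (intros u v Huv; unfold a; field; apply pow_nonzero; now apply Hm).
        unfold Xop; rewrite (dX_eq_on W HW _ _ x y Ea Hxy).
        now rewrite (dY_eq_on W HW _ _ x y Ea Hxy). }
      rewrite (Xop_mult W), EXk in E1 by trivial.
      assert (E2 := normal_zero W fld sol_rules _ _ x y HW Hs Hv Hxy Hp).
      rewrite (DX_sound W HW fld Hs sol_rules Hv), Hr, E1 in E2 by exact Hxy.
      unfold r_y in E2; rewrite !ev_pmul, ev_pz, ev_pv in E2.
      change (jets fld x y (0, 1, 0)%nat) with (dY (fld 0%nat) x y) in E2.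
      rewrite Hr in E2; unfold a in E2 at 2.
      apply (Rmult_eq_reg_r (fld 23%nat x y ^ k)); [|exact Hk0].
      rewrite Rmult_0_l; apply (Rplus_eq_reg_r (ev (jets fld x y) p * INR k * dY (cr c) x y)).
      rewrite Rplus_0_l; transitivity (INR k * (dY (cr c) x y * ev (jets fld x y) p));
        [rewrite <- E2; field; exact Hk0 | ring].
    - exists f; intros x y Hxy; rewrite <- Hf by exact Hxy; unfold a.
      field; apply pow_nonzero, Hm; now apply HVW. }
  destruct (Hpow theta8 3%nat) as [alpha Halpha]; [vm_compute; reflexivity|].
  destruct (Hpow beta4 4%nat) as [beta Hbeta]; [vm_compute; reflexivity|].
  exists V; split; [exact HV|]; split; [exact HV0|].
  split; [intros; now apply HWU, HVW|].
  exists (fld 32%nat), (fld 25%nat), alpha, beta.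
  assert (HsV : forall f, smooth_on V (fld f)) by (intros; now apply smooth_on_sub with W).
  apply (linearizes_iff_match V HV fld HsV).
  - now apply (valid_sub W).
  - intros; now apply Hm, HVW.
  - intros; now apply HG, HVW.
  - exact Hr.
  - intros x y Hxy i Hi; assert (HWxy := HVW x y Hxy).
    unfold lin_coef_val, K_val, A_val, B_val.
    rewrite <- Halpha, <- Hbeta by exact Hxy.
    destruct (Nat.eq_dec i 16) as [->|Hne].
    + cbn [Nat.eqb].
      replace (ev (jets fld x y) (ode_coef 16)) with 0
        by (symmetry; apply (ev_eq _ (ode_coef 16) []); vm_compute; reflexivity).
      assert (E := Hv (29, 0, 0)%nat _ (or_introl eq_refl) x y HWxy).
      change (jets fld x y (29, 0, 0)%nat) with (fld 29%nat x y) in E; rewrite E.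
      unfold psi_, G_, jv.
      rewrite ev_pscale, !ev_padd, !ev_pmul, !ev_pv.
      change (jets fld x y (16, 0, 0)%nat) with (fld 16%nat x y).
      rewrite Hlow by lia.
      change (jets fld x y (24, 0, 0)%nat) with (fld 24%nat x y).
      change (jets fld x y (25 + 1, 0, 0)%nat) with (fld 26%nat x y).
      change (jets fld x y (25 + 0, 0, 0)%nat) with (fld 25%nat x y).
      replace (Q2R (-1)) with (-1) by (unfold Q2R; simpl; lra).
      field; now apply HG.
    + assert (E := normal_zero W fld sol_rules _ _ x y HW Hs Hv HWxy (sol_match i Hi Hne)).
      unfold jv in E; rewrite ev_pv in E.
      change (jets fld x y (i, 0, 0)%nat) with (fld i x y) in E.
      rewrite Hlow in E by lia; rewrite E.
      apply Nat.eqb_neq in Hne; rewrite Hne.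
      destruct (Nat.eqb i 15); [rewrite ev_psub|]; ring.
Qed.

Theorem theorem2 (c : coefs) (U : R -> R -> Prop) :
  open2 U -> coefs_smooth_on U c ->
  (* linearizability criterion *)
  ((forall x y, U x y -> conditions c x y) <-> locally_linearizable c U) /\
  (* under the conditions, every linearizing transformation solves the
     system, and alpha, beta are given by the formulas *)
  ((forall x y, U x y -> conditions c x y) ->
   forall (V : R -> R -> Prop) (phi psi : R -> R -> R) (alpha beta : R -> R),
     open2 V -> (forall x y, V x y -> U x y) ->
     linearizes c V phi psi alpha beta ->
     forall x y, V x y ->
       trans_system c phi psi alpha beta x y /\
       alpha (phi x y) = alpha_formula c phi x y /\
       beta (phi x y) = beta_formula c phi psi x y).
Proof.
  intros HU Hc.
  assert (Hsub : forall V : R -> R -> Prop,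
    (forall x y, V x y -> U x y) -> coefs_smooth_on V c).
  { intros V HV; unfold coefs_smooth_on in *; decompose [and] Hc.
    repeat match goal with |- _ /\ _ => split end; now apply smooth_on_sub with U. }
  split; [split|].
  - now apply conditions_linearizable.
  - intros Hlin x y Hxy.
    destruct (Hlin x y Hxy) as (V & HV & HVxy & HVU & phi & psi & alpha & beta & H).
    apply (linearizes_conditions c V phi psi alpha beta); auto.
  - intros _ V phi psi alpha beta HV HVU Hlin x y Hxy.
    apply (linearizes_system c V phi psi alpha beta); auto.
Qed.
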